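(* Let $p$ be a prime with $p\ge 5$. Every positive integer $n$ is a sum of $k$ squares not divisible by $p$ for some positive integer $k\le 4$, except in the case $p=5$ and $n=79$. In the exceptional case, $79$ is a sum of $5$ squares not divisible by $5$.
   Context: For a prime $p$, an integer $n$ is a sum of $k$ squares not divisible by $p$ if there are integers $x_1,\dots,x_k$ with $n=x_1^2+\cdots+x_k^2$ and $\gcd(p,x_1x_2\cdots x_k)=1$. *)

(* Defs.v *)
From mathcomp Require Import all_boot all_order all_algebra.
Set Implicit Arguments.
Unset Strict Implicit.
Unset Printing Implicit Defensive.
Import Order.TTheory GRing.Theory Num.Theory.
Local Open Scope ring_scope.

Definition sum_of_squares_not_div (p k : nat) (n : int) : Prop :=
  exists x : 'I_k -> int,
    n = \sum_(i < k) x i ^+ 2 /\ gcdz p%:Z (\prod_(i < k) x i) = 1.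

(* Main.v *)
(* For odd l, k, t with t^2 < 4 l k, the number 4 l k - t^2 is 3 modulo 8, hence a sum of three odd
   squares; factoring the corresponding Hurwitz quaternion of norm l k gives vectors V, Z with odd
   coordinates, |V|^2 = 4 l, |Z|^2 = 4 k and V.Z = 2 t. If n = s^2 l + s p t + p^2 k then
   x = (s V + p Z) / 2 has norm n, and when 4 l < p^2 and p does not divide s its coordinates are
   congruent to nonzero multiples of coordinates of V smaller than p in absolute value, so they are
   prime to p. For n = 2 m one uses sums and differences of two pairs of coordinates instead, for
   which l = 2 modulo 3 excludes three equal |V_i|. Numbers below p^2 are covered by Lagrange's
   theorem, large n by a suitable choice of l and k, multiples of 4 by doubling; p = 5 and p = 7
   need an additional reflection in a vector of norm 3, and finitely many n remain.

   That M = 3 (mod 8) is a sum of three odd squares is proved by counting. Let S(M) be the number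
   of solutions of x^2 + 2 u^2 + 2 v^2 = M with x odd, and G(M) the number of solutions of
   xy + yz + zx = M in odd positive integers. For m odd, the sum of S(4 m - K^2) over odd K > 0 is
   8 sigma(m), by Jacobi's two-square theorem and an involution of Liouville, while the sum of
   G(4 m - K^2) is the number sigma(m) of sublattices of Z^2 of index m, each of which has exactly
   one reduced basis of a certain kind. Hence S = 8 G by induction, and G(M) > 0 because of the
   solution (1, 1, (M - 1) / 2). *)
Require Import Defs.
From Stdlib Require Import ZArith Lia List Znumtheory Wf_Z Permutation Classical FMapPositive.
Import ListNotations.
Set Implicit Arguments.
Unset Strict Implicit.
Unset Printing Implicit Defensive.

(** * Enumerations and finite sums *)

Section Counting.
Local Open Scope Z_scope.

(** The identity S = 8 G stands in for Dirichlet's theorem on primes and the reduction of ternary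
    forms, the usual road to three squares. The link is 4 (a d + B C) = (a + d)^2 + x y + y z + z x
    for an integer matrix with determinant m = a d + B C: its trace gives K, and K = 1 is the top
    level in the induction.

    The obstacle in the second half is to find an odd l in a prescribed class modulo p that is small
    enough for the coordinates and large enough for the discriminant. For odd n the window [4 p^2 /
    25, p^2 / 4) contains a whole period 2 p once p >= 23. For n = 2 m the period is 6 p, and [3 p^2
    / 20, p^2 / 2) contains one once p >= 19. Smaller primes are treated by tables of pairs (t, l).
    For p = 5 and n = 2 m only l = 5 and l = 11 qualify, and t^2 l is never 2 or 3 modulo 5; for p =
    7 the values are 5, 11, 17, 23, none divisible by 7. The missing classes force l = 7 or l = 3,
    where V always has three coordinates of equal absolute value; this is what the reflection
    repairs. *)

Fixpoint zsum (A : Type) (f : A -> Z) (l : list A) : Z :=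
  match l with nil => 0 | a :: l' => f a + zsum f l' end.

Lemma zsum_app A (f : A -> Z) l l' : zsum f (l ++ l') = zsum f l + zsum f l'.
Proof. induction l as [|a l IH]; simpl; lia. Qed.

Lemma zsum_ext A (f g : A -> Z) l :
  (forall a, In a l -> f a = g a) -> zsum f l = zsum g l.
Proof.
  induction l as [|a l IH]; simpl; intros H; [reflexivity|].
  rewrite (H a) by now left. rewrite IH; [lia|]. intros; apply H; now right.
Qed.

Lemma zsum_add A (f g : A -> Z) l : zsum (fun a => f a + g a) l = zsum f l + zsum g l.
Proof. induction l as [|a l IH]; simpl; lia. Qed.

Lemma zsum_scale A (f : A -> Z) c l : zsum (fun a => c * f a) l = c * zsum f l.
Proof. induction l as [|a l IH]; simpl; lia. Qed.

Lemma zsum_map A B (f : B -> Z) (h : A -> B) l : zsum f (map h l) = zsum (fun a => f (h a)) l.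
Proof. induction l as [|a l IH]; simpl; lia. Qed.

Lemma zsum_const A c (l : list A) : zsum (fun _ => c) l = c * Z.of_nat (length l).
Proof. induction l as [|a l IH]; simpl length; simpl zsum; lia. Qed.

Lemma zsum_flat_map A B (f : B -> Z) (h : A -> list B) l :
  zsum f (flat_map h l) = zsum (fun a => zsum f (h a)) l.
Proof. induction l as [|a l IH]; simpl; [reflexivity|]. rewrite zsum_app, IH; lia. Qed.

Lemma zsum_filter A (f : A -> Z) P l :
  zsum f (filter P l) = zsum (fun a => if P a then f a else 0) l.
Proof. induction l as [|a l IH]; simpl; [reflexivity|]. destruct (P a); simpl; lia. Qed.

Lemma zsum_permutation A (f : A -> Z) l l' : Permutation l l' -> zsum f l = zsum f l'.
Proof. induction 1; simpl; lia. Qed.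

Definition enum (A : Type) (l : list A) (P : A -> Prop) : Prop :=
  NoDup l /\ forall a, In a l <-> P a.

Lemma enum_zsum_bij A B l l' (P : A -> Prop) (Q : B -> Prop) (f : A -> Z) (g : B -> Z)
    (h : A -> B) (k : B -> A) :
  enum l P -> enum l' Q ->
  (forall a, P a -> Q (h a) /\ k (h a) = a /\ f a = g (h a)) ->
  (forall b, Q b -> P (k b) /\ h (k b) = b) ->
  zsum f l = zsum g l'.
Proof.
  intros [N E] [N' E'] H K.
  transitivity (zsum g (map h l)).
  - rewrite zsum_map. apply zsum_ext. intros a Ha. apply H. now apply E.
  - apply zsum_permutation, NoDup_Permutation; [|exact N'|].
    + apply (@NoDup_map_NoDup_ForallPairs A B h); [|exact N].
      intros a a' Ha Ha' Hh. apply E in Ha. apply E in Ha'.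
      destruct (H a Ha) as (_ & <- & _), (H a' Ha') as (_ & <- & _). congruence.
    + intros b. rewrite in_map_iff, E'. split.
      * intros (a & <- & Ha). apply H. now apply E.
      * intros Hb. exists (k b). destruct (K b Hb). split; [assumption|now apply E].
Qed.

Definition card (A : Type) (l : list A) : Z := zsum (fun _ => 1) l.

Lemma card_length A (l : list A) : card l = Z.of_nat (length l).
Proof. unfold card. rewrite zsum_const. lia. Qed.

Lemma card_nonneg A (l : list A) : 0 <= card l.
Proof. rewrite card_length. lia. Qed.

Lemma enum_card_bij A B l l' (P : A -> Prop) (Q : B -> Prop) (h : A -> B) (k : B -> A) :
  enum l P -> enum l' Q ->
  (forall a, P a -> Q (h a) /\ k (h a) = a) ->
  (forall b, Q b -> P (k b) /\ h (k b) = b) ->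
  card l = card l'.
Proof.
  intros E E' H K. apply (enum_zsum_bij (h := h) (k := k) E E'); [|exact K].
  intros a Ha. destruct (H a Ha). auto.
Qed.

Lemma card_le_rel A B (R : A -> B -> Prop) (l : list A) : forall l' : list B,
  NoDup l -> (forall a, In a l -> exists b, In b l' /\ R a b) ->
  (forall a a' b, In a l -> In a' l -> R a b -> R a' b -> a = a') ->
  card l <= card l'.
Proof.
  rewrite card_length. induction l as [|a l IH]; intros l' N H I.
  - pose proof (@card_nonneg _ l'). simpl; lia.
  - inversion N; subst. destruct (H a (or_introl eq_refl)) as (b & Hb & Rab).
    destruct (in_split _ _ Hb) as (l1 & l2 & ->).
    assert (Z.of_nat (length l) <= card (l1 ++ l2)).
    { apply IH; [assumption| |].
      - intros a' Ha'. destruct (H a' (or_intror Ha')) as (b' & Hb' & Rb').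
        exists b'. split; [|assumption].
        apply in_app_iff in Hb'. apply in_app_iff. simpl in Hb'.
        destruct Hb' as [?|[<-|?]]; auto.
        exfalso. assert (a = a') by (apply (I a a' b); simpl; auto). subst. contradiction.
      - intros a' a'' b' ? ? ? ?. apply (I a' a'' b'); simpl; auto. }
    rewrite card_length, length_app in *. simpl length. lia.
Qed.

(** The correspondence is a relation, total and injective in both directions. This suits bijections
    known through existence and uniqueness theorems, such as the one between lattices and reduced
    bases. *)
Lemma enum_card_rel A B l l' (P : A -> Prop) (Q : B -> Prop) (R : A -> B -> Prop) :
  enum l P -> enum l' Q ->
  (forall a, P a -> exists b, Q b /\ R a b) ->
  (forall b, Q b -> exists a, P a /\ R a b) ->
  (forall a a' b, P a -> P a' -> R a b -> R a' b -> a = a') ->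
  (forall a b b', Q b -> Q b' -> R a b -> R a b' -> b = b') ->
  card l = card l'.
Proof.
  intros [N E] [N' E'] H K I I'. apply Z.le_antisymm.
  - apply (card_le_rel (R := R)); [assumption| |].
    + intros a Ha. apply E in Ha. destruct (H a Ha) as (b & ? & ?). exists b. split; [now apply E'|assumption].
    + intros a a' b Ha Ha'. apply E in Ha. apply E in Ha'. now apply I.
  - apply (card_le_rel (R := fun b a => R a b)); [assumption| |].
    + intros b Hb. apply E' in Hb. destruct (K b Hb) as (a & ? & ?). exists a. split; [now apply E|assumption].
    + intros b b' a Hb Hb'. apply E' in Hb. apply E' in Hb'. now apply I'.
Qed.

Lemma enum_filter A l (P : A -> Prop) (b : A -> bool) (Q : A -> Prop) :
  enum l P -> (forall a, P a -> (b a = true <-> Q a)) -> enum (filter b l) (fun a => P a /\ Q a).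
Proof.
  intros [N E] H. split; [now apply NoDup_filter|].
  intros a. rewrite filter_In, E. firstorder.
Qed.

Lemma enum_iff A l (P Q : A -> Prop) : enum l P -> (forall a, P a <-> Q a) -> enum l Q.
Proof. intros [N E] H. split; [assumption|]. intros a. now rewrite E. Qed.

Definition dsum (A B : Type) (l : list A) (L : A -> list B) : list (A * B) :=
  flat_map (fun a => map (pair a) (L a)) l.

Lemma enum_dsum A B l (P : A -> Prop) (L : A -> list B) (Q : A -> B -> Prop) :
  enum l P -> (forall a, P a -> enum (L a) (Q a)) ->
  enum (dsum l L) (fun x => P (fst x) /\ Q (fst x) (snd x)).
Proof.
  intros [N E] H. split.
  - unfold dsum. assert (HL : forall a, In a l -> NoDup (L a)) by (intros a Ha; now apply H, E).
    clear E H. induction l as [|a l IH]; simpl; [constructor|].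
    inversion N; subst. apply NoDup_app.
    + apply (@NoDup_map_NoDup_ForallPairs); [|apply HL; now left].
      intros x y _ _ [=]; assumption.
    + apply IH; [assumption|]. intros; apply HL; now right.
    + intros [a' b] Hi Hi'. apply in_map_iff in Hi as (? & [= <- _] & _).
      apply in_flat_map in Hi' as (a'' & Ha'' & Hi). apply in_map_iff in Hi as (? & [= -> _] & _).
      contradiction.
  - intros [a b]. unfold dsum. rewrite in_flat_map. simpl. split.
    + intros (a' & Ha' & Hi). apply in_map_iff in Hi as (b' & [= -> ->] & Hb).
      apply E in Ha'. split; [assumption|]. now apply (H a Ha').
    + intros [Ha Hb]. exists a. split; [now apply E|]. apply in_map, (H a Ha), Hb.
Qed.

Lemma zsum_dsum A B l (L : A -> list B) (f : A * B -> Z) :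
  zsum f (dsum l L) = zsum (fun a => zsum (fun b => f (a, b)) (L a)) l.
Proof. unfold dsum. rewrite zsum_flat_map. apply zsum_ext. intros. apply zsum_map. Qed.

Lemma card_dsum A B l (L : A -> list B) :
  card (dsum l L) = zsum (fun a => card (L a)) l.
Proof. unfold card. now rewrite zsum_dsum. Qed.

Definition zrange (a b : Z) : list Z :=
  map (fun i => a + Z.of_nat i) (seq 0 (Z.to_nat (b - a))).

Lemma enum_zrange a b : enum (zrange a b) (fun x => a <= x < b).
Proof.
  split.
  - apply NoDup_map_NoDup_ForallPairs; [|apply seq_NoDup]. intros x y _ _. lia.
  - intros x. unfold zrange. rewrite in_map_iff. split.
    + intros (i & <- & Hi). apply in_seq in Hi. lia.
    + intros H. exists (Z.to_nat (x - a)). rewrite in_seq. lia.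
Qed.

Lemma card_zrange a b : a <= b -> card (zrange a b) = b - a.
Proof. intros. rewrite card_length. unfold zrange. rewrite length_map, length_seq. lia. Qed.

Definition zbox (n : Z) : list Z := zrange (- n) (n + 1).

Definition zbox2 (n : Z) : list (Z * Z) := dsum (zbox n) (fun _ => zbox n).

Lemma enum_zbox n : enum (zbox n) (fun x => Z.abs x <= n).
Proof. apply (enum_iff (enum_zrange _ _)). intros; lia. Qed.

Lemma enum_zbox2 n : enum (zbox2 n) (fun x => Z.abs (fst x) <= n /\ Z.abs (snd x) <= n).
Proof.
  refine (enum_iff (enum_dsum (Q := fun _ y => Z.abs y <= n) (enum_zbox n) _) _).
  - intros; apply enum_zbox.
  - intros; tauto.
Qed.

(** The involution shows that the sum equals its own negative. Fixed points are harmless, since [f]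
    vanishes at them. *)
Lemma zsum_sign_reversing A l (P : A -> Prop) (f : A -> Z) (h : A -> A) :
  enum l P -> (forall a, P a -> P (h a) /\ h (h a) = a /\ f (h a) = - f a) -> zsum f l = 0.
Proof.
  intros E H.
  assert (zsum f l = zsum (fun a => -1 * f a) l).
  { apply (enum_zsum_bij (h := h) (k := h) E E).
    - intros a Ha. destruct (H a Ha) as (? & ? & ?). repeat split; auto. lia.
    - intros a Ha. destruct (H a Ha) as (? & ? & ?). auto. }
  rewrite zsum_scale in *. lia.
Qed.

End Counting.

(** * Reduced bases of plane lattices of odd index *)

Section Lattices.
Local Open Scope Z_scope.

Record basis := Basis { b11 : Z; b12 : Z; b21 : Z; b22 : Z }.

Definition bdet (b : basis) := b11 b * b22 b - b12 b * b21 b.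
Definition bX (b : basis) (i j : Z) := i * b11 b + j * b21 b.
Definition bY (b : basis) (i j : Z) := i * b12 b + j * b22 b.
Definition bmem (b : basis) (X Y : Z) := exists i j, X = bX b i j /\ Y = bY b i j.

(* The linear map [(X, Y) -> (Y, - X - Y)] permutes cyclically the three forms X, Y, - X - Y
   and the three nonzero classes modulo 2. *)
Definition brot (b : basis) :=
  Basis (b12 b) (- b11 b - b12 b) (b22 b) (- b21 b - b22 b).

(* In terms of [z = a - d], [y = 2 B - z] and [x = 2 C - z] the inequalities are [x, y, z > 0],
   and [4 (a d + B C) = (a + d)^2 + x y + y z + z x]. *)
Definition reduced (a d B C : Z) : Prop :=
  Z.Even a /\ Z.Odd d /\ Z.Odd B /\ Z.Odd C /\ 0 < a - d /\ a - d < 2 * B /\ a - d < 2 * C.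

(** The determinant condition makes u = (a, - B) and v = (C, d) an oriented basis of the lattice
    spanned by the rows of [b]. *)
Definition has_reduced (b : basis) : Prop :=
  exists a d B C, bmem b a (- B) /\ bmem b C d /\ a * d + B * C = bdet b /\ reduced a d B C.

Lemma bdet_brot b : bdet (brot b) = bdet b.
Proof. unfold bdet, brot; simpl; ring. Qed.

Lemma bX_brot b i j : bX (brot b) i j = bY b i j.
Proof. reflexivity. Qed.

Lemma bY_brot b i j : bY (brot b) i j = - bX b i j - bY b i j.
Proof. unfold bX, bY, brot; simpl; ring. Qed.

(** The vectors u, - v, v - u with sum 0 are permuted cyclically, and the parameters (x, y, z)
    become (y, z, x). *)
Lemma has_reduced_brot b : has_reduced (brot b) -> has_reduced b.
Proof.
  intros (a & d & B & C & (i & j & Hu) & (k & l & Hv) & Hdet & Hr).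
  rewrite bX_brot, bY_brot in Hu, Hv. rewrite bdet_brot in Hdet.
  unfold reduced in Hr. destruct Hr as ([a' Ha] & [d' Hd] & [B' HB] & [C' HC] & Hz & Hy & Hx).
  exists (C + d), (a - C), C, (B + d + C - a). repeat split.
  - exists (- k), (- l). unfold bX, bY in *. lia.
  - exists (i - k), (j - l). unfold bX, bY in *. lia.
  - rewrite <- Hdet. ring.
  - exists (C' + d' + 1). lia.
  - exists (a' - C' - 1). lia.
  - exists C'. lia.
  - exists (B' + d' + C' - a' + 1). lia.
  - lia.
  - lia.
  - lia.
Qed.

Lemma bdet_minor b i j k l :
  bX b i j * bY b k l - bY b i j * bX b k l = (i * l - j * k) * bdet b.
Proof. unfold bX, bY, bdet. ring. Qed.

Lemma square_le_of_abs w r : Z.abs w <= r -> w * w <= r * r.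
Proof. intros H. rewrite <- (Z.abs_square w). apply Z.square_le_mono_nonneg; lia. Qed.

(** Up to a positive factor, z is a mean of p and q with the positive weights 2 A - x and x; as p
    and q are distinct and nonnegative, one of them is positive. *)
Lemma chain_positive A x p q z :
  0 < A -> 0 < x < 2 * A -> 0 <= p -> 0 <= q -> p <> q ->
  2 * A * (A * z) = 2 * ((2 * A - x) * p) + 2 * (x * q) -> 0 < z.
Proof.
  intros HA Hx Hp Hq Hpq E.
  assert (0 <= (2 * A - x) * p) by (apply Z.mul_nonneg_nonneg; lia).
  assert (0 <= x * q) by (apply Z.mul_nonneg_nonneg; lia).
  assert (0 < (2 * A - x) * p + x * q).
  { destruct (Z.eq_dec p 0).
    - assert (0 < x * q) by (apply Z.mul_pos_pos; lia). lia.
    - assert (0 < (2 * A - x) * p) by (apply Z.mul_pos_pos; lia). lia. }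
  assert (0 < A * (A * z)) by lia.
  apply Z.mul_pos_cancel_l in H2; [|lia]. apply Z.mul_pos_cancel_l in H2; lia.
Qed.

Lemma bezout_complement i j : Z.gcd i j = 1 -> exists k l, i * l - j * k = 1.
Proof.
  intros H. destruct (Z.gcd_bezout i j 1 H) as (u & v & E).
  exists (- v), u. lia.
Qed.

(* A primitive vector of class (1, 0) in the square [|X|, |Y| <= r] is the vector [u - v] of
   a reduced basis: translating [v] by multiples of [2 w] we may take [0 < x < 2 A]. *)
Lemma class_box_reduced b r w1 w2 i j :
  Z.Odd (bdet b) -> r * r <= bdet b ->
  Z.gcd i j = 1 -> w1 = bX b i j -> w2 = bY b i j -> Z.Odd w1 -> Z.Even w2 ->
  Z.abs w1 <= r -> Z.abs w2 <= r -> has_reduced b.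
Proof.
  intros b_odd r_le.
  assert (main : forall w1 w2 i j v1 v2 k l, w1 = bX b i j -> w2 = bY b i j ->
    v1 = bX b k l -> v2 = bY b k l -> w1 * v2 - w2 * v1 = bdet b ->
    Z.Odd w1 -> Z.Even w2 -> Z.Odd v1 ->
    Z.abs w1 <= r -> Z.abs w2 <= r -> w1 + w2 < 0 -> has_reduced b).
  { clear w1 w2 i j. intros w1 w2 i j v1 v2 k l Hw1 Hw2 Hv1 Hv2 Hd [w1' Ow1] [w2' Ew2] [v1' Ov1] L1 L2 HA.
    (* The basis aimed at is u = V + w, v = V, with parameters x, y = 2 A - x and z = 2 V1 - x. So
       x, y > 0 means 0 < x < 2 A, which is reached by adding multiples of 2 w to v; x is odd, hence
       not 0. *)
    set (A := - (w1 + w2)). set (n := (v1 + v2 - w1) / (2 * A)).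
    set (V1 := v1 + 2 * n * w1). set (V2 := v2 + 2 * n * w2).
    set (x := V1 + V2 - w1).
    assert (HAp : 0 < A) by (unfold A; lia).
    assert (Hx0 : x = (v1 + v2 - w1) mod (2 * A)).
    { rewrite Z.mod_eq by lia. fold n. unfold x, V1, V2, A. ring. }
    assert (Hxb : 0 <= x < 2 * A) by (rewrite Hx0; apply Z.mod_pos_bound; lia).
    assert (HdV : w1 * V2 - w2 * V1 = bdet b) by (rewrite <- Hd; unfold V1, V2; ring).
    destruct b_odd as [m' Hm].
    assert (Ov2 : exists v2', v2 = 2 * v2' + 1).
    { destruct (Z.Even_or_Odd v2) as [[t Ht]|[t Ht]]; [exfalso|exists t; lia].
      assert (2 * (w1 * t - w2' * v1) = 2 * m' + 1) by (rewrite <- Hm, <- Hd, Ht, Ew2; ring). lia. }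
    destruct Ov2 as [v2' Ov2].
    assert (Hxo : exists t, x = 2 * t + 1).
    { exists (v1' + v2' - w1' + n * w1 + n * w2). unfold x, V1, V2. lia. }
    destruct Hxo as [t Ht].
    assert (Hz : A * (2 * V1 - x) = 2 * (bdet b - w1 * w1) - x * (w1 - w2)).
    { rewrite <- HdV. unfold A. replace V2 with (x + w1 - V1) by (unfold x; ring). ring. }
    (* It remains to see z > 0. The numbers det - w1^2 and det - w2^2 are nonnegative by the size of
       the box, and distinct because w1 and w2 have different parities. *)
    assert (Hz2 : 2 * A * (A * (2 * V1 - x)) =
      2 * ((2 * A - x) * (bdet b - w1 * w1)) + 2 * (x * (bdet b - w2 * w2))).
    { rewrite Hz. unfold A. ring. }
    assert (S1 := square_le_of_abs L1). assert (S2 := square_le_of_abs L2).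
    assert (Hne : w1 * w1 <> w2 * w2).
    { intros E. rewrite Ow1, Ew2 in E.
      assert (2 * (2 * w1' * w1' + 2 * w1') + 1 = 2 * (2 * w2' * w2')) by lia. lia. }
    assert (Hz3 : 0 < 2 * V1 - x) by (refine (chain_positive HAp _ _ _ _ Hz2); lia).
    exists (V1 + w1), V2, (- (V2 + w2)), V1. unfold reduced. repeat split.
    - exists (k + (2 * n + 1) * i), (l + (2 * n + 1) * j).
      unfold V1, V2. rewrite Hv1, Hv2, Hw1, Hw2. unfold bX, bY. split; ring.
    - exists (k + 2 * n * i), (l + 2 * n * j).
      unfold V1, V2. rewrite Hv1, Hv2, Hw1, Hw2. unfold bX, bY. split; ring.
    - rewrite <- HdV. ring.
    - exists (v1' + n * w1 + w1' + 1). unfold V1. lia.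
    - exists (v2' + n * w2). unfold V2. lia.
    - exists (- (v2' + n * w2 + w2') - 1). unfold V2. lia.
    - exists (v1' + n * w1). unfold V1. lia.
    - unfold x in Hz3. lia.
    - unfold x, A in *. lia.
    - unfold x, A in *. lia. }
  intros Hg Hw1 Hw2 Ow Ew L1 L2.
  destruct (bezout_complement Hg) as (k & l & Hkl).
  (* The sum w1 + w2 is odd, so it is negative for w or for - w. If the complementary vector v has
     an even first coordinate, v + w replaces it. *)
  assert (signed : forall s, (s = 1 \/ s = -1) -> s * (w1 + w2) < 0 -> has_reduced b).
  { intros s Hs Hneg.
    assert (Os : Z.Odd (s * w1)) by (destruct Ow as [t Ht]; destruct Hs as [-> | ->]; [exists t|exists (- t - 1)]; lia).
    assert (Es : Z.Even (s * w2)) by (destruct Ew as [t Ht]; exists (s * t); nia).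
    assert (Hdet : s * w1 * (s * bY b k l) - s * w2 * (s * bX b k l) = bdet b).
    { replace (s * w1 * (s * bY b k l) - s * w2 * (s * bX b k l))
        with ((s * s) * (w1 * bY b k l - w2 * bX b k l)) by ring.
      rewrite Hw1, Hw2, bdet_minor, Hkl. destruct Hs as [-> | ->]; ring. }
    destruct (Z.Even_or_Odd (s * bX b k l)) as [[t Ht]|Ho].
    - refine (main (s * w1) (s * w2) (s * i) (s * j) (s * bX b k l + s * w1) (s * bY b k l + s * w2)
        (s * k + s * i) (s * l + s * j) _ _ _ _ _ Os Es _ _ _ _).
      1,2: rewrite ?Hw1, ?Hw2; unfold bX, bY; ring.
      1,2: rewrite ?Hw1, ?Hw2; unfold bX, bY; ring.
      + rewrite <- Hdet. ring.
      + destruct Os as [t' Ht']. exists (t + t'). lia.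
      + destruct Hs; subst s; lia.
      + destruct Hs; subst s; lia.
      + lia.
    - refine (main (s * w1) (s * w2) (s * i) (s * j) (s * bX b k l) (s * bY b k l)
        (s * k) (s * l) _ _ _ _ Hdet Os Es Ho _ _ _).
      1,2: rewrite ?Hw1, ?Hw2; unfold bX, bY; ring.
      1,2: unfold bX, bY; ring.
      + destruct Hs; subst s; lia.
      + destruct Hs; subst s; lia.
      + lia. }
  destruct Ow as [t Ht], Ew as [t' Ht'].
  destruct (Z_lt_le_dec (w1 + w2) 0).
  - apply (signed 1); lia.
  - apply (signed (-1)); lia.
Qed.

End Lattices.

(** * Short vectors of a plane lattice *)

Section Pigeonhole.
Local Open Scope Z_scope.

Lemma pigeonhole (A : Type) (f : A -> Z) (l : list A) n :
  0 <= n -> NoDup l -> (forall a, In a l -> 0 <= f a < n) -> n < card l ->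
  exists a a', In a l /\ In a' l /\ a <> a' /\ f a = f a'.
Proof.
  intros Hn N H L. apply NNPP. intros C.
  assert (Nm : NoDup (map f l)).
  { apply NoDup_map_NoDup_ForallPairs; [|exact N]. intros a a' Ha Ha' E.
    apply NNPP. intros D. apply C. exists a, a'. auto. }
  assert (incl (map f l) (zrange 0 n)).
  { intros y Hy. apply in_map_iff in Hy as (a & <- & Ha). apply enum_zrange. auto. }
  assert (Le := NoDup_incl_length Nm H0). rewrite length_map in Le.
  assert (E := card_zrange Hn). rewrite card_length in E, L. lia.
Qed.

(* Pigeonhole principle on residues modulo the lattice, for a basis made triangular first. *)
Lemma linear_forms_box b r : 0 < bdet b -> 0 <= r -> bdet b < (r + 1) * (r + 1) ->
  exists i j, (i <> 0 \/ j <> 0) /\ Z.abs (bX b i j) <= r /\ Z.abs (bY b i j) <= r.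
Proof.
  intros Hdet Hr Hlt.
  assert (H : exists i j, ~ (i = 0 /\ j = 0) /\ Z.abs (bX b i j) <= r /\ Z.abs (bY b i j) <= r).
  2: { destruct H as (i & j & H & ?). exists i, j. split; [lia|assumption]. }
  set (E := Z.gcd (b11 b) (b21 b)).
  assert (HE : 0 < E).
  { assert (0 <= E) by apply Z.gcd_nonneg. destruct (Z.eq_dec E 0) as [e|]; [|lia].
    apply Z.gcd_eq_0 in e as [e1 e2]. unfold bdet in Hdet. rewrite e1, e2 in Hdet. lia. }
  destruct (Z.gcd_divide_l (b11 b) (b21 b)) as [e He]. fold E in He.
  destruct (Z.gcd_divide_r (b11 b) (b21 b)) as [g Hg]. fold E in Hg.
  destruct (Z.gcd_bezout (b11 b) (b21 b) E eq_refl) as (al & be & Hbez).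
  assert (Heg : al * e + be * g = 1).
  { apply (Z.mul_cancel_r _ _ E); [lia|]. rewrite Z.mul_1_l.
    transitivity (al * b11 b + be * b21 b); [rewrite He, Hg; ring|assumption]. }
  set (c := al * b12 b + be * b22 b). set (D := e * b22 b - g * b12 b).
  assert (HD : E * D = bdet b) by (unfold D, bdet; rewrite He, Hg; ring).
  assert (HDp : 0 < D) by (apply Z.mul_pos_cancel_l with E; lia).
  (* The lattice is spanned by (E, c) and (0, D); [f] numbers its E D residue classes, by the first
     coordinate modulo E and then the corrected second coordinate modulo D. *)
  set (f := fun v : Z * Z => (fst v mod E) * D + ((snd v - c * (fst v / E)) mod D)).
  set (l := dsum (zrange 0 (r + 1)) (fun _ => zrange 0 (r + 1))).
  assert (El : enum l (fun v => (0 <= fst v < r + 1) /\ (0 <= snd v < r + 1))).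
  { refine (enum_dsum (Q := fun _ y => 0 <= y < r + 1) (enum_zrange _ _) _). intros; apply enum_zrange. }
  destruct (pigeonhole (f := f) (l := l) (n := bdet b)) as ([X Y] & [X' Y'] & HX & HX' & Hne & Hf).
  - lia.
  - apply El.
  - intros [X Y] _. unfold f; simpl.
    assert (0 <= X mod E < E) by now apply Z.mod_pos_bound.
    assert (0 <= (Y - c * (X / E)) mod D < D) by now apply Z.mod_pos_bound.
    rewrite <- HD.
    assert (0 <= (X mod E) * D) by (apply Z.mul_nonneg_nonneg; lia).
    assert ((X mod E) * D <= (E - 1) * D) by (apply Z.mul_le_mono_nonneg_r; lia). lia.
  - unfold l. rewrite card_dsum.
    rewrite (@zsum_ext _ _ (fun _ => r + 1)) by (intros; rewrite card_zrange; lia).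
    rewrite zsum_const, <- card_length, card_zrange by lia. lia.
  - apply El in HX. apply El in HX'. unfold f in Hf; simpl in *.
    assert (B1 : 0 <= (Y - c * (X / E)) mod D < D) by now apply Z.mod_pos_bound.
    assert (B2 : 0 <= (Y' - c * (X' / E)) mod D < D) by now apply Z.mod_pos_bound.
    destruct (Z.div_mod_unique D (X mod E) (X' mod E) _ _ (or_introl B1) (or_introl B2)) as [F1 F2]; [lia|].
    assert (M1 := Z.div_mod X E). assert (M2 := Z.div_mod X' E).
    assert (N1 := Z.div_mod (Y - c * (X / E)) D). assert (N2 := Z.div_mod (Y' - c * (X' / E)) D).
    set (s := X / E - X' / E).
    set (t := (Y - c * (X / E)) / D - (Y' - c * (X' / E)) / D).
    assert (S1 : X - X' = E * s) by (unfold s; lia).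
    assert (S2 : Y - Y' = c * s + D * t) by (unfold s, t; lia).
    assert (EX : bX b (s * al - t * g) (s * be + t * e) = X - X').
    { transitivity (E * s * (al * e + be * g)).
      - unfold bX. rewrite He, Hg. ring.
      - rewrite Heg. lia. }
    assert (EY : bY b (s * al - t * g) (s * be + t * e) = Y - Y').
    { rewrite S2. unfold bY, c, D. ring. }
    exists (s * al - t * g), (s * be + t * e). rewrite EX, EY. repeat split; try lia.
    intros [Z1 Z2]. rewrite Z1, Z2 in EX, EY. unfold bX, bY in EX, EY.
    apply Hne. f_equal; lia.
Qed.

Lemma primitive_part i j : i <> 0 \/ j <> 0 ->
  exists i' j' k, Z.gcd i' j' = 1 /\ 0 < k /\ i = k * i' /\ j = k * j'.
Proof.
  intros H. set (k := Z.gcd i j).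
  assert (0 < k).
  { assert (0 <= k) by apply Z.gcd_nonneg. destruct (Z.eq_dec k 0) as [e|]; [|lia].
    apply Z.gcd_eq_0 in e. lia. }
  destruct (Z.gcd_divide_l i j) as [i' Hi]. destruct (Z.gcd_divide_r i j) as [j' Hj].
  fold k in Hi, Hj. exists i', j', k. repeat split; try lia.
  apply (Z.mul_cancel_l _ _ k); [lia|]. rewrite Z.mul_1_r.
  rewrite <- (Z.abs_eq k) at 1 by lia. rewrite <- Z.gcd_mul_mono_l.
  unfold k at 3. f_equal; lia.
Qed.

Lemma bX_scale b k i j : bX b (k * i) (k * j) = k * bX b i j.
Proof. unfold bX; ring. Qed.
Lemma bY_scale b k i j : bY b (k * i) (k * j) = k * bY b i j.
Proof. unfold bY; ring. Qed.
Lemma abs_scaled_le k x r : 0 < k -> Z.abs (k * x) <= r -> Z.abs x <= r.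
Proof. intros Hk. rewrite Z.abs_mul, (Z.abs_eq k) by lia. nia. Qed.

Lemma coordinates_even b i j : Z.Odd (bdet b) -> Z.Even (bX b i j) -> Z.Even (bY b i j) ->
  Z.Even i /\ Z.Even j.
Proof.
  intros [d Hd] [x Hx] [y Hy].
  assert (E1 : i * bdet b = bX b i j * b22 b - bY b i j * b21 b) by (unfold bX, bY, bdet; ring).
  assert (E2 : j * bdet b = bY b i j * b11 b - bX b i j * b12 b) by (unfold bX, bY, bdet; ring).
  rewrite Hx, Hy, Hd in E1, E2. split.
  - exists (x * b22 b - y * b21 b - i * d). lia.
  - exists (y * b11 b - x * b12 b - j * d). lia.
Qed.

End Pigeonhole.

(** * Existence of reduced bases *)

Section Existence.
Local Open Scope Z_scope.

Lemma primitive_not_even b i j : Z.Odd (bdet b) -> Z.gcd i j = 1 ->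
  Z.Even (bX b i j) -> Z.Even (bY b i j) -> False.
Proof.
  intros Hb Hg Ex Ey. destruct (coordinates_even Hb Ex Ey) as [[s ->] [t ->]].
  rewrite Z.gcd_mul_mono_l in Hg. change (Z.abs 2) with 2 in Hg.
  assert (0 <= Z.gcd s t) by apply Z.gcd_nonneg. lia.
Qed.

Definition floor_sqrt (r m : Z) := 0 <= r /\ r * r <= m < (r + 1) * (r + 1).

(** The primitive part lies in one of the three nonzero classes modulo 2, and at most two rotations
    bring it to the class (1, 0). The hexagon, unlike the box, is invariant under rotation. *)
Lemma hexagon_reduced b r i j : Z.Odd (bdet b) -> floor_sqrt r (bdet b) ->
  i <> 0 \/ j <> 0 -> Z.abs (bX b i j) <= r -> Z.abs (bY b i j) <= r ->
  Z.abs (bX b i j + bY b i j) <= r -> has_reduced b.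
Proof.
  intros b_odd (r_ge0 & r_le & r_gt) H L1 L2 L3.
  destruct (primitive_part H) as (i' & j' & k & Hg & Hk & -> & ->).
  rewrite bX_scale in *. rewrite bY_scale in *. rewrite <- Z.mul_add_distr_l in L3.
  apply abs_scaled_le in L1, L2, L3; try assumption.
  destruct (Z.Even_or_Odd (bX b i' j')) as [Ex|Ox], (Z.Even_or_Odd (bY b i' j')) as [Ey|Oy].
  - destruct (primitive_not_even b_odd Hg Ex Ey).
  - do 2 apply has_reduced_brot. destruct Ex as [x Ex], Oy as [y Oy].
    refine (class_box_reduced (b := brot (brot b)) (r := r) _ _ Hg eq_refl eq_refl _ _ _ _);
      rewrite ?bdet_brot, ?bX_brot, ?bY_brot, ?bX_brot, ?bY_brot; auto; try lia.
    + exists (- x - y - 1). lia.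
    + exists x. lia.
  - exact (class_box_reduced b_odd r_le Hg eq_refl eq_refl Ox Ey L1 L2).
  - apply has_reduced_brot. destruct Ox as [x Ox], Oy as [y Oy].
    refine (class_box_reduced (b := brot b) (r := r) _ _ Hg eq_refl eq_refl _ _ _ _);
      rewrite ?bdet_brot, ?bX_brot, ?bY_brot; auto; try lia.
    + now exists y.
    + exists (- x - y - 1). lia.
Qed.

(** As the determinant is odd, an even vector is twice a lattice vector, so the hexagon may be
    doubled. *)
Lemma half_hexagon_reduced b r i j : Z.Odd (bdet b) -> floor_sqrt r (bdet b) ->
  Z.Even (bX b i j) -> Z.Even (bY b i j) -> i <> 0 \/ j <> 0 ->
  Z.abs (bX b i j) <= 2 * r -> Z.abs (bY b i j) <= 2 * r ->
  Z.abs (bX b i j + bY b i j) <= 2 * r -> has_reduced b.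
Proof.
  intros b_odd Hr Ex Ey H L1 L2 L3. destruct (coordinates_even b_odd Ex Ey) as [[s ->] [t ->]].
  rewrite bX_scale in *. rewrite bY_scale in *.
  apply (hexagon_reduced (r := r) (i := s) (j := t)); try assumption; lia.
Qed.

(** The box contains a nonzero vector. If it is outside the hexagon, its coordinates have the same
    sign; if moreover Y is even, its class is (1, 0) and the box suffices. What remains is Y odd. *)
Lemma box_or_quadrant b r : Z.Odd (bdet b) -> 0 < bdet b -> floor_sqrt r (bdet b) ->
  has_reduced b \/ exists i j, Z.gcd i j = 1 /\ Z.Odd (bY b i j) /\
  0 < bX b i j <= r /\ 0 < bY b i j <= r /\ r < bX b i j + bY b i j.
Proof.
  intros b_odd pos_det Hr. pose proof Hr as (r_ge0 & r_le & r_gt).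
  destruct (linear_forms_box pos_det r_ge0 r_gt) as (i0 & j0 & H & L1 & L2).
  destruct (primitive_part H) as (i & j & k & Hg & Hk & -> & ->).
  rewrite bX_scale in *. rewrite bY_scale in *. apply abs_scaled_le in L1, L2; try assumption.
  destruct (Z_le_gt_dec (Z.abs (bX b i j + bY b i j)) r) as [L3|L3].
  { left. apply (hexagon_reduced (r := r) (i := i) (j := j)); try assumption.
    destruct (Z.eq_dec i 0), (Z.eq_dec j 0); auto. subst. simpl in Hg. lia. }
  destruct (Z.Even_or_Odd (bY b i j)) as [Ey|Oy].
  { left. destruct (Z.Even_or_Odd (bX b i j)) as [Ex|Ox].
    - destruct (primitive_not_even b_odd Hg Ex Ey).
    - exact (class_box_reduced b_odd r_le Hg eq_refl eq_refl Ox Ey L1 L2). }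
  right. destruct (Z_lt_le_dec 0 (bX b i j)).
  - exists i, j. repeat split; try assumption; lia.
  - exists (- i), (- j).
    replace (bX b (- i) (- j)) with (- bX b i j) by (unfold bX; ring).
    replace (bY b (- i) (- j)) with (- bY b i j) by (unfold bY; ring).
    destruct Oy as [y Oy]. repeat split; try lia.
    + now rewrite Z.gcd_opp_l, Z.gcd_opp_r.
    + exists (- y - 1). lia.
Qed.

(** Vectors whose determinant vanishes modulo 3 are proportional there, and for primitive vectors
    the factor is 1 or -1. *)
Lemma parallel_mod3 i j k l : 3 * 1 = i * l - j * k -> Z.gcd i j = 1 -> Z.gcd k l = 1 ->
  exists s t, (k - i = 3 * s /\ l - j = 3 * t) \/ (k + i = 3 * s /\ l + j = 3 * t).
Proof.
  intros E G1 G2.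
  assert (N : forall x y, Z.gcd x y = 1 -> ~ (x mod 3 = 0 /\ y mod 3 = 0)).
  { intros x y G [Hx Hy]. apply Z.mod_divide in Hx, Hy; try lia.
    assert (D := Z.gcd_greatest _ _ _ Hx Hy). rewrite G in D. apply Z.divide_1_r in D. lia. }
  apply N in G1. apply N in G2. clear N.
  assert (M : (i * l - j * k) mod 3 = 0) by (rewrite <- E; reflexivity). clear E.
  rewrite Zminus_mod, (Zmult_mod i l), (Zmult_mod j k) in M.
  assert (Di := Z.div_mod i 3). assert (Dj := Z.div_mod j 3).
  assert (Dk := Z.div_mod k 3). assert (Dl := Z.div_mod l 3).
  assert (Bi := Z.mod_pos_bound i 3). assert (Bj := Z.mod_pos_bound j 3).
  assert (Bk := Z.mod_pos_bound k 3). assert (Bl := Z.mod_pos_bound l 3).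
  assert (Ci : i mod 3 = 0 \/ i mod 3 = 1 \/ i mod 3 = 2) by lia.
  assert (Cj : j mod 3 = 0 \/ j mod 3 = 1 \/ j mod 3 = 2) by lia.
  assert (Ck : k mod 3 = 0 \/ k mod 3 = 1 \/ k mod 3 = 2) by lia.
  assert (Cl : l mod 3 = 0 \/ l mod 3 = 1 \/ l mod 3 = 2) by lia.
  set (qi := i / 3) in *. set (qj := j / 3) in *. set (qk := k / 3) in *. set (ql := l / 3) in *.
  clearbody qi qj qk ql.
  destruct Ci as [Ci|[Ci|Ci]], Cj as [Cj|[Cj|Cj]], Ck as [Ck|[Ck|Ck]], Cl as [Cl|[Cl|Cl]];
    rewrite Ci, Cj, Ck, Cl in *; try (exfalso; vm_compute in M; discriminate M);
    try (exfalso; tauto);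
    first [ exists (qk - qi), (ql - qj); left; lia
          | exists (qk + qi), (ql + qj); right; lia
          | exists (qk + qi + 1), (ql + qj); right; lia
          | exists (qk + qi), (ql + qj + 1); right; lia
          | exists (qk + qi + 1), (ql + qj + 1); right; lia ].
Qed.

(* If no vector of class [i] lies in the box of the other two linear forms, the three boxes
   contribute three vectors of distinct classes with sum 0; these form a reduced superbase. *)
Theorem reduced_exists b : Z.Odd (bdet b) -> 0 < bdet b -> has_reduced b.
Proof.
  intros b_odd pos_det.
  assert (Hr : exists r, floor_sqrt r (bdet b)).
  { exists (Z.sqrt (bdet b)). assert (S := Z.sqrt_spec (bdet b)).
    assert (0 <= Z.sqrt (bdet b)) by apply Z.sqrt_nonneg. unfold floor_sqrt, Z.succ in *. lia. }
  destruct Hr as [r Hr]. pose proof Hr as (r_ge0 & r_le & r_gt).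
  destruct (@box_or_quadrant b r) as [|(i & j & Hg & Oy & Bx & By & Bs)]; try assumption.
  destruct (@box_or_quadrant (brot b) r) as [|(i1 & j1 & Hg1 & Oy1 & Bx1 & By1 & Bs1)];
    rewrite ?bdet_brot; try assumption; [now apply has_reduced_brot|].
  destruct (@box_or_quadrant (brot (brot b)) r) as [|(i2 & j2 & Hg2 & Oy2 & Bx2 & By2 & Bs2)];
    rewrite ?bdet_brot; try assumption; [now do 2 apply has_reduced_brot|].
  rewrite ?bX_brot, ?bY_brot, ?bX_brot, ?bY_brot in *.
  assert (Sum : forall i j i' j', bX b (i + i') (j + j') = bX b i j + bX b i' j' /\
                                  bY b (i + i') (j + j') = bY b i j + bY b i' j').
  { intros; split; unfold bX, bY; ring. }
  assert (Zero : bX b 0 0 = 0 /\ bY b 0 0 = 0) by (split; reflexivity).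
  assert (Hq1 := bdet_minor b i1 j1 i2 j2).
  set (X := bX b i j) in *. set (Y := bY b i j) in *.
  set (X1 := bX b i1 j1) in *. set (Y1 := bY b i1 j1) in *.
  set (X2 := bX b i2 j2) in *. set (Y2 := bY b i2 j2) in *.
  destruct Oy as [y Oy], Oy1 as [y1 Oy1], Oy2 as [x2 Ox2].
  replace (- Y2 - (- X2 - Y2)) with X2 in * by ring.
  assert (Hh : forall k l, Z.Even (bX b k l) -> Z.Even (bY b k l) ->
    (bX b k l <> 0 \/ bY b k l <> 0) ->
    Z.abs (bX b k l) <= 2 * r -> Z.abs (bY b k l) <= 2 * r ->
    Z.abs (bX b k l + bY b k l) <= 2 * r -> has_reduced b).
  { intros k l E1 E2 N. apply half_hexagon_reduced; try assumption.
    destruct (Z.eq_dec k 0) as [->|]; [|now left]. destruct (Z.eq_dec l 0) as [->|]; [|now right].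
    destruct N as [N|N]; now destruct N. }
  (* Two of the three vectors in the same class modulo 2 have an even sum, which is nonzero and lies
     in the doubled hexagon. *)
  assert (A1 : Z.Even X -> Z.Even X1 -> has_reduced b).
  { intros [x Ex] [x1 Ex1]. destruct (Sum i j i1 j1) as [S1 S2]. fold X Y X1 Y1 in S1, S2.
    apply (Hh (i + i1) (j + j1)); rewrite ?S1, ?S2; try lia.
    - exists (x + x1). lia.
    - exists (y - x1 - y1). lia. }
  assert (A2 : Z.Odd X -> Z.Odd Y2 -> has_reduced b).
  { intros [x Ox] [y2 Oy2]. destruct (Sum i j i2 j2) as [S1 S2]. fold X Y X2 Y2 in S1, S2.
    apply (Hh (i + i2) (j + j2)); rewrite ?S1, ?S2; try lia.
    - exists (x + x2 + 1). lia.
    - exists (y + y2 + 1). lia. }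
  assert (A3 : Z.Odd X1 -> Z.Even Y2 -> has_reduced b).
  { intros [x1 Ox1] [y2 Oy2]. destruct (Sum i1 j1 i2 j2) as [S1 S2]. fold X1 Y1 X2 Y2 in S1, S2.
    apply (Hh (i1 + i2) (j1 + j2)); rewrite ?S1, ?S2; try lia.
    - exists (x1 + x2 + 1). lia.
    - exists (y2 - x1 - y1 - 1). lia. }
  destruct (Sum i1 j1 i2 j2) as [S1 S2]. destruct (Sum i j (i1 + i2) (j1 + j2)) as [T1 T2].
  rewrite S1 in T1. rewrite S2 in T2. fold X1 Y1 X2 Y2 X Y in T1, T2.
  clear S1 S2.
  (* With three distinct classes the sum of all three vectors is even and lies in the doubled
     hexagon, so it settles the matter unless it is 0. *)
  assert (Hz : has_reduced b \/ (i + (i1 + i2) = 0 /\ j + (j1 + j2) = 0 /\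
    (Z.Even X /\ Z.Odd X1 /\ Z.Odd Y2 \/ Z.Odd X /\ Z.Even X1 /\ Z.Even Y2))).
  { assert (F : forall k l, bX b k l = 0 -> bY b k l = 0 -> k = 0 /\ l = 0).
    { intros k l E1 E2.
      assert (F1 : k * bdet b = 0).
      { replace (k * bdet b) with (bX b k l * b22 b - bY b k l * b21 b)
          by (unfold bX, bY, bdet; ring). rewrite E1, E2; ring. }
      assert (F2 : l * bdet b = 0).
      { replace (l * bdet b) with (bY b k l * b11 b - bX b k l * b12 b)
          by (unfold bX, bY, bdet; ring). rewrite E1, E2; ring. }
      apply Z.mul_eq_0 in F1, F2. lia. }
    assert (G : Z.Even (X + (X1 + X2)) -> Z.Even (Y + (Y1 + Y2)) ->
      has_reduced b \/ (i + (i1 + i2) = 0 /\ j + (j1 + j2) = 0)).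
    { intros E1 E2.
      destruct (Z.eq_dec (X + (X1 + X2)) 0) as [Z1|Z1]; destruct (Z.eq_dec (Y + (Y1 + Y2)) 0) as [Z2|Z2].
      - right. apply F; [now rewrite T1|now rewrite T2].
      - left. apply (Hh (i + (i1 + i2)) (j + (j1 + j2))); rewrite ?T1, ?T2; auto; lia.
      - left. apply (Hh (i + (i1 + i2)) (j + (j1 + j2))); rewrite ?T1, ?T2; auto; lia.
      - left. apply (Hh (i + (i1 + i2)) (j + (j1 + j2))); rewrite ?T1, ?T2; auto; lia. }
    destruct (Z.Even_or_Odd X) as [Ex|Ox], (Z.Even_or_Odd X1) as [Ex1|Ox1],
      (Z.Even_or_Odd Y2) as [Ey2|Oy2]; try (left; now auto).
    - assert (E1 : Z.Even (X + (X1 + X2))).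
      { destruct Ex as [x Ex], Ox1 as [x1 Ox1]. exists (x + x1 + x2 + 1). lia. }
      assert (E2 : Z.Even (Y + (Y1 + Y2))).
      { destruct Ox1 as [x1 Ox1], Oy2 as [y2 Oy2]. exists (y - y1 - x1 + y2). lia. }
      destruct (G E1 E2) as [|[]]; auto 10.
    - assert (E1 : Z.Even (X + (X1 + X2))).
      { destruct Ox as [x Ox], Ex1 as [x1 Ex1]. exists (x + x1 + x2 + 1). lia. }
      assert (E2 : Z.Even (Y + (Y1 + Y2))).
      { destruct Ex1 as [x1 Ex1], Ey2 as [y2 Ey2]. exists (y - y1 - x1 + y2). lia. }
      destruct (G E1 E2) as [|[]]; auto 10. }
  destruct Hz as [|(Zi & Zj & Hc)]; [assumption|].
  rewrite Zi, Zj in T1, T2. destruct Zero as [Z1 Z2]. rewrite Z1 in T1. rewrite Z2 in T2.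
  (* [D] is the determinant of the second and third vectors relative to [b]. Since D det = X Y + X
     Y1 + X2 Y is a sum of three positive terms, each at most r^2 <= det, it is 1, 2 or 3. *)
  set (D := i1 * j2 - j1 * i2) in *.
  assert (EX : X = - X1 - X2) by lia. assert (EY : Y = - Y1 - Y2) by lia.
  assert (P : X1 * Y2 - Y1 * X2 = X * Y + X * Y1 + X2 * Y) by (rewrite EX, EY; ring).
  assert (P1 : 0 < X * Y) by (apply Z.mul_pos_pos; lia).
  assert (P2 : 0 < X * Y1) by (apply Z.mul_pos_pos; lia).
  assert (P3 : 0 < X2 * Y) by (apply Z.mul_pos_pos; lia).
  assert (Q1 : X * Y <= r * r) by (apply Z.mul_le_mono_nonneg; lia).
  assert (Q2 : X * Y1 <= r * r) by (apply Z.mul_le_mono_nonneg; lia).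
  assert (Q3 : X2 * Y <= r * r) by (apply Z.mul_le_mono_nonneg; lia).
  assert (D1 : 0 < D) by (apply (Z.mul_pos_cancel_r _ (bdet b)); [assumption|lia]).
  assert (D3 : D <= 3).
  { apply (Z.mul_le_mono_pos_r _ _ (bdet b)); [assumption|lia]. }
  (* D = 2 contradicts the parities. For D = 3 the two vectors are parallel modulo 3: either a third
     of their difference is a lattice vector in the hexagon, or their sum is divisible by 3, and
     with it the primitive first vector. *)
  assert (HD : has_reduced b \/ D = 1).
  { assert (C : D = 1 \/ D = 2 \/ D = 3) by lia. destruct C as [C|[C|C]]; [now right| |left].
    - exfalso. rewrite C in Hq1.
      destruct Hc as [([x Ex] & [x1 Ox1] & [y2 Oy2])|([x Ex] & [x1 Ox1] & [y2 Oy2])].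
      + rewrite Ox1, Oy2 in Hq1.
        assert (W : exists y1', Y1 = 2 * y1') by (exists (- y1 - x1 - 1); lia). destruct W as [y1' W].
        rewrite W in Hq1.
        assert (2 * (2 * x1 * y2 + x1 + y2 - y1' * X2) + 1 = 2 * bdet b) by lia. lia.
      + assert (W : exists y1', Y1 = 2 * y1' + 1) by (exists (- y1 - x1 - 1); lia). destruct W as [y1' W].
        rewrite Ox1, Oy2, W, Ox2 in Hq1.
        assert (2 * (2 * x1 * y2 - (2 * y1' * x2 + y1' + x2) - 1) + 1 = 2 * bdet b) by lia. lia.
    - destruct (parallel_mod3 (i := i1) (j := j1) (k := i2) (l := j2)) as (s & t & C3);
        [fold D; lia|assumption|assumption|].
      destruct C3 as [[C1 C2]|[C1 C2]].
      + destruct (Sum i1 j1 (3 * s) (3 * t)) as [U1 U2].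
        replace (i1 + 3 * s) with i2 in U1, U2 by lia. replace (j1 + 3 * t) with j2 in U1, U2 by lia.
        rewrite bX_scale in U1. rewrite bY_scale in U2. fold X1 X2 in U1. fold Y1 Y2 in U2.
        apply (hexagon_reduced (r := r) (i := s) (j := t)); try assumption; try lia.
      + exfalso. assert (Di : (3 | i)) by (exists (- s); lia). assert (Dj : (3 | j)) by (exists (- t); lia).
        assert (Dg := Z.gcd_greatest _ _ _ Di Dj). rewrite Hg in Dg. apply Z.divide_1_r in Dg. lia. }
  destruct HD as [|HD]; [assumption|]. rewrite HD, Z.mul_1_l in Hq1.
  assert (Neg : forall k l, bX b (- k) (- l) = - bX b k l /\ bY b (- k) (- l) = - bY b k l).
  { intros; split; unfold bX, bY; ring. }
  destruct Hc as [([x Ex] & [x1 Ox1] & [y2 Oy2])|([x Ex] & [x1 Ox1] & [y2 Oy2])].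
  - exists (- X), Y2, Y, X2. unfold reduced. repeat split; try lia.
    + exists (- i), (- j). destruct (Neg i j) as [-> ->]. split; reflexivity.
    + exists i2, j2. split; reflexivity.
    + exists (- x). lia.
    + exists y2. lia.
    + exists y. lia.
    + exists x2. lia.
  - exists (- X1), Y, Y1, X. unfold reduced. repeat split; try lia.
    + exists (- i1), (- j1). destruct (Neg i1 j1) as [-> ->]. split; reflexivity.
    + exists i, j. split; reflexivity.
    + exists (- x1). lia.
    + exists y. lia.
    + exists (- y1 - x1 - 1). lia.
    + exists x. lia.
Qed.

End Existence.

(** * Uniqueness of reduced bases *)

Section Uniqueness.
Local Open Scope Z_scope.

Lemma odd_square_ge1 t : Z.Odd t -> 1 <= t * t.
Proof. intros [s ->]. nia. Qed.

Lemma basis_coordinates b u1 u2 v1 v2 w1 w2 : bdet b <> 0 ->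
  bmem b u1 u2 -> bmem b v1 v2 -> u1 * v2 - u2 * v1 = bdet b -> bmem b w1 w2 ->
  exists p q, w1 = p * u1 + q * v1 /\ w2 = p * u2 + q * v2.
Proof.
  intros H (i & j & -> & ->) (k & l & -> & ->) D (s & t & -> & ->).
  rewrite bdet_minor in D.
  assert (E : i * l - j * k = 1) by (apply (Z.mul_cancel_r _ _ (bdet b)); lia).
  exists (s * l - t * k), (i * t - j * s).
  split; [transitivity ((i * l - j * k) * bX b s t)|transitivity ((i * l - j * k) * bY b s t)];
    solve [rewrite E; ring|unfold bX, bY; ring].
Qed.

(* With [F = x X^2 + y Y^2 + z (X - Y)^2] and [F'] likewise, the identity below expresses that
   the polar form of the discriminant takes the same value on [(F, F')] and on
   [(F, F' o h)]; by parity every square in it is at least its value for [h = 1]. *)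
Lemma reduced_unique b a d B C a' d' B' C' : 0 < bdet b ->
  reduced a d B C -> bmem b a (- B) -> bmem b C d -> a * d + B * C = bdet b ->
  reduced a' d' B' C' -> bmem b a' (- B') -> bmem b C' d' -> a' * d' + B' * C' = bdet b ->
  a = a' /\ d = d' /\ B = B' /\ C = C'.
Proof.
  intros Hb (Ea & Od & OB & OC & Pz & Py & Px) Mu Mv D (Ea' & Od' & OB' & OC' & Pz' & Py' & Px') Mu' Mv' D'.
  assert (D0 : a * d - - B * C = bdet b) by (rewrite <- D; ring).
  destruct (basis_coordinates (Z.neq_sym _ _ (Z.lt_neq _ _ Hb)) Mu Mv D0 Mu') as (al & be & E1 & E2).
  destruct (basis_coordinates (Z.neq_sym _ _ (Z.lt_neq _ _ Hb)) Mu Mv D0 Mv') as (ga & de & E3 & E4).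
  assert (Hdet : al * de - be * ga = 1).
  { apply (Z.mul_cancel_r _ _ (bdet b)); [lia|]. rewrite Z.mul_1_l. rewrite <- D' at 2.
    rewrite <- D0. replace B' with (- - B') by ring. rewrite E1, E2, E3, E4. ring. }
  destruct Ea as [ta Ea], Od as [td Od], OB as [tB OB], OC as [tC OC].
  destruct Ea' as [ta' Ea'], Od' as [td' Od'], OB' as [tB' OB'], OC' as [tC' OC'].
  assert (Pbe : exists t, be = 2 * t).
  { exists (ta' - al * ta - be * tC). lia. }
  destruct Pbe as [tbe Ebe].
  assert (Pal : exists t, al = 2 * t + 1).
  { exists (tB' - al * tB + be * td + tbe). lia. }
  destruct Pal as [tal Eal].
  assert (Pde : exists t, de = 2 * t + 1).
  { exists (tC' - ga * ta - de * tC). lia. }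
  destruct Pde as [tde Ede].
  assert (Pga : exists t, ga = 2 * t).
  { exists (- td' - ga * tB + de * td + tde). lia. }
  destruct Pga as [tga Ega].
  set (z := a - d) in *. set (x := 2 * C - z). set (y := 2 * B - z).
  set (z' := a' - d') in *. set (x' := 2 * C' - z'). set (y' := 2 * B' - z').
  assert (Id : x * (x' * (be * be) + y' * (de * de) + z' * ((be - de) * (be - de)))
     + y * (x' * (al * al) + y' * (ga * ga) + z' * ((al - ga) * (al - ga)))
     + z * (x' * ((al + be) * (al + be)) + y' * ((ga + de) * (ga + de))
            + z' * ((al + be - ga - de) * (al + be - ga - de)))
     = x * (y' + z') + y * (x' + z') + z * (x' + y')).
  { rewrite <- (Z.mul_1_l (x * (y' + z') + _ + _)), <- Hdet.
    unfold x', y', z'. replace B' with (- - B') by ring. rewrite E1, E2, E3, E4.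
    unfold x, y, z. ring. }
  assert (N : forall p q s, 0 < p -> 0 < q -> 0 <= s -> 0 <= p * q * s).
  { intros. apply Z.mul_nonneg_nonneg; [apply Z.mul_nonneg_nonneg|]; lia. }
  assert (X0 : 0 < x) by (unfold x; lia). assert (Y0 : 0 < y) by (unfold y; lia).
  assert (X0' : 0 < x') by (unfold x'; lia). assert (Y0' : 0 < y') by (unfold y'; lia).
  clearbody x y x' y'.
  assert (S1 : 1 <= de * de) by (apply odd_square_ge1; now exists tde).
  assert (S2 : 1 <= (be - de) * (be - de)) by (apply odd_square_ge1; exists (tbe - tde - 1); lia).
  assert (S3 : 1 <= al * al) by (apply odd_square_ge1; now exists tal).
  assert (S4 : 1 <= (al - ga) * (al - ga)) by (apply odd_square_ge1; exists (tal - tga); lia).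
  assert (S5 : 1 <= (al + be) * (al + be)) by (apply odd_square_ge1; exists (tal + tbe); lia).
  assert (S6 : 1 <= (ga + de) * (ga + de)) by (apply odd_square_ge1; exists (tga + tde); lia).
  assert (T1 := N x y' (de * de - 1) X0 Y0' (ltac:(lia))).
  assert (T2 := N x z' ((be - de) * (be - de) - 1) X0 Pz' (ltac:(lia))).
  assert (T3 := N y x' (al * al - 1) Y0 X0' (ltac:(lia))).
  assert (T4 := N y z' ((al - ga) * (al - ga) - 1) Y0 Pz' (ltac:(lia))).
  assert (T5 := N z x' ((al + be) * (al + be) - 1) Pz X0' (ltac:(lia))).
  assert (T6 := N z y' ((ga + de) * (ga + de) - 1) Pz Y0' (ltac:(lia))).
  assert (T7 := N x x' (be * be) X0 X0' (Z.square_nonneg be)).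
  assert (T8 := N y y' (ga * ga) Y0 Y0' (Z.square_nonneg ga)).
  assert (T9 := N z z' ((al + be - ga - de) * (al + be - ga - de)) Pz Pz' (Z.square_nonneg _)).
  assert (be0 : be = 0).
  { assert (E : x * x' * (be * be) = 0) by lia. apply Z.mul_eq_0 in E as [E|E].
    - apply Z.mul_eq_0 in E; lia.
    - apply Z.mul_eq_0 in E; lia. }
  assert (ga0 : ga = 0).
  { assert (E : y * y' * (ga * ga) = 0) by lia. apply Z.mul_eq_0 in E as [E|E].
    - apply Z.mul_eq_0 in E; lia.
    - apply Z.mul_eq_0 in E; lia. }
  rewrite be0, ga0 in *.
  assert (al1 : al = 1 \/ al = -1) by (apply Z.eq_mul_1 with de; lia).
  assert (de1 : de = al) by (destruct al1 as [-> | ->]; lia).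
  rewrite de1 in *. destruct al1 as [-> | ->]; lia.
Qed.

End Uniqueness.

(** * Sublattices of index m: Hermite normal forms and reduced bases *)

Section Forms.
Local Open Scope Z_scope.

Definition odds (n : Z) : list Z := filter Z.odd (zrange 1 (n + 1)).

Lemma enum_odds n : enum (odds n) (fun x => Z.Odd x /\ 0 < x <= n).
Proof.
  refine (enum_iff (enum_filter (Q := Z.Odd) (enum_zrange 1 (n + 1)) _) _).
  - intros x _. apply Z.odd_spec.
  - intros x; split; intros; repeat split; try tauto; lia.
Qed.

Definition divisors (n : Z) : list Z := filter (fun d => n mod d =? 0) (zrange 1 (n + 1)).

Lemma enum_divisors n : 0 < n -> enum (divisors n) (fun d => 0 < d /\ (d | n)).
Proof.
  intros Hn. refine (enum_iff (enum_filter (Q := fun d => (d | n)) (enum_zrange 1 (n + 1)) _) _).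
  - intros d Hd. rewrite Z.eqb_eq, Z.mod_divide by lia. tauto.
  - intros d. split; [intros [? ?]; split; [lia|assumption]|]. intros [Hd H].
    split; [|assumption]. apply Z.divide_pos_le in H; lia.
Qed.

Definition three_forms_eq (M : Z) (w : Z * (Z * Z)) : Prop :=
  let '(x, (y, z)) := w in
  (Z.Odd x /\ 0 < x) /\ (Z.Odd y /\ 0 < y) /\ (Z.Odd z /\ 0 < z) /\ x * y + y * z + z * x = M.

Definition three_forms (M : Z) : list (Z * (Z * Z)) :=
  filter (fun w => let '(x, (y, z)) := w in x * y + y * z + z * x =? M)
    (dsum (odds M) (fun _ => dsum (odds M) (fun _ => odds M))).

Lemma enum_three_forms M : enum (three_forms M) (three_forms_eq M).
Proof.
  refine (enum_iff (enum_filter (Q := fun w => let '(x, (y, z)) := w in x * y + y * z + z * x = M)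
    (enum_dsum (Q := fun _ w => (Z.Odd (fst w) /\ 0 < fst w <= M) /\ Z.Odd (snd w) /\ 0 < snd w <= M)
      (enum_odds M) _) _) _).
  - intros x _. exact (enum_dsum (enum_odds M) (fun _ _ => enum_odds M)).
  - intros (x & y & z) _. apply Z.eqb_eq.
  - intros (x & y & z). simpl. split; [intuition lia|].
    intros ((? & ?) & (? & ?) & (? & ?) & E).
    assert (0 < x * y) by nia. assert (0 < y * z) by nia. assert (0 < z * x) by nia.
    assert (x <= x * y) by nia. assert (y <= y * z) by nia. assert (z <= z * x) by nia.
    repeat split; auto; lia.
Qed.

(** The pair (e, c) stands for the Hermite normal form with rows (e, c) and (0, m / e); there are
    sigma(m) of them. *)
Definition hermite_eq (m : Z) (w : Z * Z) : Prop :=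
  let '(e, c) := w in 0 < e /\ (e | m) /\ 0 <= c < m / e.

Definition hermite (m : Z) : list (Z * Z) := dsum (divisors m) (fun e => zrange 0 (m / e)).

Lemma enum_hermite m : 0 < m -> enum (hermite m) (hermite_eq m).
Proof.
  intros Hm. refine (enum_iff (enum_dsum (Q := fun e c => 0 <= c < m / e) (enum_divisors Hm) _) _).
  - intros e _. apply enum_zrange.
  - intros (e & c). simpl. tauto.
Qed.

Definition hermite_basis (m : Z) (w : Z * Z) := Basis (fst w) (snd w) 0 (m / fst w).

Lemma bdet_hermite m w : hermite_eq m w -> bdet (hermite_basis m w) = m.
Proof.
  destruct w as (e & c). intros (He & (q & ->) & Hc). unfold bdet; simpl.
  rewrite Z.div_mul by lia. ring.
Qed.

(** Bezout coefficients s, t of a and C produce the row (g, t d - s B) with g = gcd(a, C), whose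
    second entry is then reduced modulo m / g. *)
Lemma hermite_exists m a d B C : 0 < m -> a * d + B * C = m ->
  exists w, hermite_eq m w /\ bmem (hermite_basis m w) a (- B) /\ bmem (hermite_basis m w) C d.
Proof.
  intros Hm E.
  destruct (Z.gcd_bezout a C (Z.gcd a C) eq_refl) as (s & t & Hst).
  assert (Hg : 0 <= Z.gcd a C) by apply Z.gcd_nonneg.
  destruct (Z.gcd_divide_l a C) as (a' & Ha). destruct (Z.gcd_divide_r a C) as (C' & HC).
  set (g := Z.gcd a C) in *. clearbody g.
  assert (g0 : 0 < g).
  { destruct (Z.eq_dec g 0) as [->|]; [|lia]. rewrite Ha, HC in E. lia. }
  assert (Hm' : m = g * (a' * d + B * C')) by (rewrite <- E, Ha, HC; ring).
  set (q := a' * d + B * C') in *.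
  assert (q0 : 0 < q) by nia.
  assert (Hq : m / g = q) by (rewrite Hm', Z.mul_comm; apply Z.div_mul; lia).
  set (c0 := t * d - s * B).
  assert (H1 : s * a' + t * C' = 1).
  { apply (Z.mul_cancel_r _ _ g); [lia|]. transitivity (s * a + t * C); [rewrite Ha, HC; ring|lia]. }
  assert (Hc := Z.div_mod c0 q (ltac:(lia))). assert (Hc' := Z.mod_pos_bound c0 q q0).
  exists (g, c0 mod q). unfold hermite_eq, hermite_basis, bmem, bX, bY. simpl. rewrite Hq.
  set (r := c0 mod q) in *. set (k := c0 / q) in *. clearbody r k.
  assert (Hr : r = c0 - q * k) by lia.
  split; [repeat split; [lia|exists q; rewrite Hm'; ring|lia|lia]|].
  split.
  - exists a', (a' * k - t). split; [rewrite Ha; ring|].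
    rewrite Hr. unfold c0, q. transitivity (- (B * (s * a' + t * C'))); [rewrite H1|]; ring.
  - exists C', (C' * k + s). split; [rewrite HC; ring|].
    rewrite Hr. unfold c0, q. transitivity (d * (s * a' + t * C')); [rewrite H1|]; ring.
Qed.

(** Both lattices have index m and contain (a, - B) and (C, d), whose determinant is m. So these two
    vectors span both, and the lattices coincide. *)
Lemma hermite_row_mem m w w' a d B C : 0 < m -> a * d + B * C = m ->
  hermite_eq m w -> bmem (hermite_basis m w) a (- B) -> bmem (hermite_basis m w) C d ->
  hermite_eq m w' -> bmem (hermite_basis m w') a (- B) -> bmem (hermite_basis m w') C d ->
  exists i j, fst w = i * fst w' /\ snd w = i * snd w' + j * (m / fst w').
Proof.
  intros Hm E H1 H2 H3 H1' H2' H3'.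
  assert (D0 : a * d - - B * C = bdet (hermite_basis m w)) by (rewrite bdet_hermite by assumption; rewrite <- E; ring).
  assert (D1 : bdet (hermite_basis m w) <> 0) by (rewrite bdet_hermite by assumption; lia).
  assert (M : bmem (hermite_basis m w) (fst w) (snd w))
    by (exists 1, 0; unfold bX, bY, hermite_basis, b11, b12, b21, b22; split; ring).
  destruct (basis_coordinates D1 H2 H3 D0 M) as (p & q & -> & ->).
  destruct H2' as (i & j & -> & ->), H3' as (k & l & -> & ->).
  exists (p * i + q * k), (p * j + q * l). unfold bX, bY. simpl. split; ring.
Qed.

Lemma hermite_unique m w w' a d B C : 0 < m -> a * d + B * C = m ->
  hermite_eq m w -> bmem (hermite_basis m w) a (- B) -> bmem (hermite_basis m w) C d ->
  hermite_eq m w' -> bmem (hermite_basis m w') a (- B) -> bmem (hermite_basis m w') C d ->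
  w = w'.
Proof.
  intros Hm E H1 H2 H3 H1' H2' H3'.
  destruct (hermite_row_mem Hm E H1 H2 H3 H1' H2' H3') as (i & j & Ei & Ej).
  destruct (hermite_row_mem Hm E H1' H2' H3' H1 H2 H3) as (i' & j' & Ei' & Ej').
  destruct w as (e & c), w' as (e' & c'). simpl in *.
  destruct H1 as (He & _ & Hc), H1' as (He' & _ & Hc').
  assert (Hee : e = e').
  { apply Z.divide_antisym_nonneg; [now apply Z.lt_le_incl|now apply Z.lt_le_incl|now exists i'|now exists i]. }
  clear Ei' H2 H3 H2' H3'. subst e'. set (q := m / e) in *. clearbody q.
  assert (i = 1) by (apply (Z.mul_cancel_r _ _ e); lia). subst i. f_equal.
  clear - Hc Hc' Ej. assert (j = 0) by nia. subst j. lia.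
Qed.

Definition level_forms (m : Z) : list (Z * (Z * (Z * Z))) :=
  dsum (odds (4 * m)) (fun K => three_forms (4 * m - K * K)).

Definition form_matrix (f : Z * (Z * (Z * Z))) (a d B C : Z) : Prop :=
  let '(K, (x, (y, z))) := f in
  K = Z.abs (a + d) /\ z = a - d /\ y = 2 * B - z /\ x = 2 * C - z.

Lemma form_matrix_det m K x y z a d B C : form_matrix (K, (x, (y, z))) a d B C ->
  x * y + y * z + z * x = 4 * m - K * K <-> a * d + B * C = m.
Proof.
  intros (-> & -> & -> & ->). rewrite Z.abs_square. split; intros; nia.
Qed.

(* Sublattices of index [m] are counted by Hermite normal forms and by reduced bases. *)
Lemma level_forms_hermite m : Z.Odd m -> 0 < m -> card (level_forms m) = card (hermite m).
Proof.
  intros Om Hm.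
  pose (R := fun f w => hermite_eq m w /\ exists a d B C, form_matrix f a d B C /\ reduced a d B C /\
    a * d + B * C = m /\ bmem (hermite_basis m w) a (- B) /\ bmem (hermite_basis m w) C d).
  apply (enum_card_rel (R := R)
    (enum_dsum (enum_odds (4 * m)) (fun K _ => enum_three_forms (4 * m - K * K)))
    (enum_hermite Hm)).
  - intros (K & x & y & z) ((OK & HK) & ((Ox & Hx) & (Oy & Hy) & (Oz & Hz) & E)).
    simpl in *.
    (* The form gives a + d only up to sign; the sign is fixed by requiring a = (K' + z) / 2 to be
       even. *)
    assert (HK' : exists K', K = Z.abs K' /\ exists t, K' + z = 4 * t).
    { destruct OK as (k & ->), Oz as (l & ->).
      destruct (Z.Even_or_Odd (k + l)) as [(t & Ht)|(t & Ht)].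
      - exists (- (2 * k + 1)). split; [lia|]. exists (l - t). lia.
      - exists (2 * k + 1). split; [lia|]. exists (t + 1). lia. }
    destruct HK' as (K' & HK' & t & Ht).
    destruct Ox as (i & Ex), Oy as (j & Ey), Oz as (l & Ez).
    assert (G : form_matrix (K, (x, (y, z))) (2 * t) (2 * t - z) (j + l + 1) (i + l + 1)).
    { unfold form_matrix. rewrite HK'. repeat split; try lia. }
    assert (Om' := Om). destruct Om' as (u & Eu).
    assert (D := proj1 (form_matrix_det m G) E).
    (* B C = m - a d is odd because a is even and m is odd. *)
    assert (Oprod : Z.Odd ((j + l + 1) * (i + l + 1))).
    { exists (u - t * (2 * t - z)). lia. }
    apply Z.odd_spec in Oprod. rewrite Z.odd_mul, Bool.andb_true_iff, !Z.odd_spec in Oprod.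
    destruct (hermite_exists Hm D) as (w & Hw & M1 & M2).
    exists w. split; [exact Hw|]. split; [exact Hw|]. exists (2 * t), (2 * t - z), (j + l + 1), (i + l + 1).
    split; [exact G|]. split; [|auto].
    unfold reduced. split; [now exists t|]. split; [exists (t - l - 1); lia|].
    split; [tauto|]. split; [tauto|]. lia.
  - intros w Hw.
    destruct (@reduced_exists (hermite_basis m w)) as (a & d & B & C & M1 & M2 & D & Hr);
      rewrite ?bdet_hermite in * by assumption; [assumption..|].
    destruct Hr as ((a' & Ea) & (d' & Ed) & (B' & EB) & (C' & EC) & Hz & Hy & Hx).
    exists (Z.abs (a + d), (2 * C - (a - d), (2 * B - (a - d), a - d))).
    assert (G : form_matrix (Z.abs (a + d), (2 * C - (a - d), (2 * B - (a - d), a - d))) a d B C)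
      by (unfold form_matrix; repeat split; lia).
    assert (E := proj2 (form_matrix_det m G) D).
    split.
    + unfold three_forms_eq. cbn [fst snd]. split; [|repeat split; try lia].
      * split.
        -- destruct (Z.abs_spec (a + d)) as [[_ ->]|[_ ->]]; [exists (a' + d')|exists (- a' - d' - 1)]; lia.
        -- assert (K0 : 0 < Z.abs (a + d)) by lia.
           assert (X0 : 0 < 2 * C - (a - d)) by lia. assert (Y0 : 0 < 2 * B - (a - d)) by lia.
           assert (T1 := Z.mul_pos_pos _ _ X0 Y0). assert (T2 := Z.mul_pos_pos _ _ Y0 Hz).
           assert (T3 := Z.mul_pos_pos _ _ Hz X0).
           set (K := Z.abs (a + d)) in *. clearbody K.
           assert (KK : K * K < 4 * m) by lia. assert (K <= K * K) by (clear - K0; nia). lia.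
      * exists (C' * 2 + 1 - a' + d'). lia.
      * exists (B' * 2 + 1 - a' + d'). lia.
      * exists (a' - d' - 1). lia.
    + split; [exact Hw|]. exists a, d, B, C. split; [exact G|]. unfold reduced, Z.Even, Z.Odd. repeat split; eauto.
  - intros (K & x & y & z) (K' & x' & y' & z') w _ _
      (Hw & a & d & B & C & G & Hr & D & M1 & M2) (_ & a' & d' & B' & C' & G' & Hr' & D' & M1' & M2').
    destruct (@reduced_unique (hermite_basis m w) a d B C a' d' B' C') as (-> & -> & -> & ->);
      rewrite ?bdet_hermite by assumption; auto.
    destruct G as (-> & -> & -> & ->), G' as (-> & -> & -> & ->). reflexivity.
  - intros (K & x & y & z) w w' Hw Hw'
      (_ & a & d & B & C & G & Hr & D & M1 & M2) (_ & a' & d' & B' & C' & G' & Hr' & D' & M1' & M2').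
    assert (a = a' /\ d = d' /\ B = B' /\ C = C') as (-> & -> & -> & ->).
    { destruct G as (HK & Hz & Hy & Hx), G' as (HK' & Hz' & Hy' & Hx').
      destruct Hr as ((ta & Ea) & (td & Ed) & _), Hr' as ((ta' & Ea') & (td' & Ed') & _). lia. }
    now apply (hermite_unique Hm D').
Qed.

End Forms.

(** * Sums of two squares *)

Section TwoSquares.
Local Open Scope Z_scope.

Definition chi (d : Z) : Z := if d mod 4 =? 1 then 1 else if d mod 4 =? 3 then -1 else 0.

Definition chi_sum (n : Z) : Z := zsum chi (divisors n).

Lemma chi_cases d : exists t, (d = 4 * t + 1 /\ chi d = 1) \/ (d = 4 * t + 3 /\ chi d = -1)
  \/ ((d = 4 * t \/ d = 4 * t + 2) /\ chi d = 0).
Proof.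
  exists (d / 4). assert (H := Z.div_mod d 4 (ltac:(lia))). assert (H' := Z.mod_pos_bound d 4 (ltac:(lia))).
  unfold chi. destruct (Z.eqb_spec (d mod 4) 1); [left; lia|right].
  destruct (Z.eqb_spec (d mod 4) 3); [left; lia|right]. lia.
Qed.

Lemma chi_even d : ~ Z.Odd d -> chi d = 0.
Proof.
  intros H. destruct (chi_cases d) as (t & [[E _]|[[E _]|[_ E]]]); [| |exact E]; exfalso; apply H.
  - exists (2 * t). lia.
  - exists (2 * t + 1). lia.
Qed.

Lemma chi_add_odd u v : Z.Odd u -> (exists t, u + v = 4 * t) -> chi v = - chi u.
Proof.
  intros [k Hk] [t Ht].
  destruct (chi_cases u) as (i & Hi), (chi_cases v) as (j & Hj). lia.
Qed.

Lemma zsum_single A (f : A -> Z) a l : NoDup l -> In a l ->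
  (forall b, In b l -> b <> a -> f b = 0) -> zsum f l = f a.
Proof.
  intros N I H. destruct (in_split _ _ I) as (l1 & l2 & ->).
  assert (H0 : forall l', (forall b, In b l' -> f b = 0) -> zsum f l' = 0).
  { intros l'. induction l' as [|b l' IH]; simpl; intros Hb; [reflexivity|].
    rewrite (Hb b), IH; auto. }
  apply NoDup_remove_2 in N. rewrite in_app_iff in N.
  rewrite zsum_app. simpl. rewrite !H0; [lia| |].
  - intros b Hb. apply H; [apply in_app_iff; simpl; tauto|]. intros ->. tauto.
  - intros b Hb. apply H; [apply in_app_iff; simpl; tauto|]. intros ->. tauto.
Qed.

(** The term j = 0 is n r(n) and all others involve smaller arguments, so the recurrence determines
    r from its values at n <= 0. *)
Lemma square_recurrence_unique (r R : Z -> Z) :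
  (forall n, n <= 0 -> r n = R n) ->
  (forall n, 0 < n -> zsum (fun j => (n - 3 * (j * j)) * r (n - j * j)) (zbox n) = 0) ->
  (forall n, 0 < n -> zsum (fun j => (n - 3 * (j * j)) * R (n - j * j)) (zbox n) = 0) ->
  forall n, r n = R n.
Proof.
  intros H0 Hr HR n. destruct (Z_le_gt_dec n 0) as [Hn|Hn]; [now apply H0|].
  assert (Hn' : 0 <= n) by lia. revert Hn.
  pattern n. apply Z_lt_induction; [|exact Hn']. clear n Hn'. intros n IH Hn.
  assert (E : zsum (fun j => (n - 3 * (j * j)) * (r (n - j * j) - R (n - j * j))) (zbox n) = 0).
  { transitivity (zsum (fun j => (n - 3 * (j * j)) * r (n - j * j) + -1 * ((n - 3 * (j * j)) * R (n - j * j))) (zbox n)).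
    - apply zsum_ext. intros; ring.
    - rewrite zsum_add, zsum_scale, Hr, HR by lia. reflexivity. }
  rewrite (zsum_single (a := 0)) in E.
  - cbv beta in E. rewrite Z.mul_0_l, Z.mul_0_r, !Z.sub_0_r in E. apply Z.mul_eq_0 in E. lia.
  - apply enum_zbox.
  - apply enum_zbox. lia.
  - intros j _ Hj. assert (0 < j * j) by nia.
    destruct (Z_le_gt_dec (n - j * j) 0) as [Hj'|Hj'].
    + rewrite H0 by lia. ring.
    + rewrite IH by lia. ring.
Qed.

Definition two_squares (n : Z) : list (Z * Z) :=
  filter (fun w => fst w * fst w + snd w * snd w =? n) (zbox2 n).

Definition r2 (n : Z) := card (two_squares n).

Lemma enum_two_squares n : enum (two_squares n) (fun w => fst w * fst w + snd w * snd w = n).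
Proof.
  refine (enum_iff (enum_filter (Q := fun w => fst w * fst w + snd w * snd w = n) (enum_zbox2 n) _) _).
  - intros. apply Z.eqb_eq.
  - intros (x & y). simpl. split; [tauto|]. intros H. split; [|exact H]. split; nia.
Qed.

(* Sum [x^2 + y^2 + z^2 - 3 z^2] over the representations of [n] by three squares. *)
Lemma r2_recurrence n : zsum (fun j => (n - 3 * (j * j)) * r2 (n - j * j)) (zbox n) = 0.
Proof.
  set (l := dsum (zbox n) (fun j => two_squares (n - j * j))).
  assert (El : enum l (fun w => fst w * fst w + fst (snd w) * fst (snd w) + snd (snd w) * snd (snd w) = n)).
  { refine (enum_iff (enum_dsum (enum_zbox n) (fun j _ => enum_two_squares (n - j * j))) _).
    intros (j & x & y). simpl. split; [lia|]. intros H. split; nia. }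
  transitivity (zsum (fun w => n - 3 * (fst w * fst w)) l).
  { unfold l. rewrite zsum_dsum. apply zsum_ext. intros j _. unfold r2, card.
    rewrite <- zsum_scale. apply zsum_ext. intros; simpl; ring. }
  set (P1 := zsum (fun w : Z * (Z * Z) => fst w * fst w) l).
  assert (E1 : zsum (fun w : Z * (Z * Z) => fst (snd w) * fst (snd w)) l = P1).
  { apply (enum_zsum_bij (h := fun w => (fst (snd w), (fst w, snd (snd w))))
      (k := fun w => (fst (snd w), (fst w, snd (snd w)))) El El); intros (j & x & y); simpl; intros; repeat split; lia. }
  assert (E2 : zsum (fun w : Z * (Z * Z) => snd (snd w) * snd (snd w)) l = P1).
  { apply (enum_zsum_bij (h := fun w => (snd (snd w), (fst (snd w), fst w)))
      (k := fun w => (snd (snd w), (fst (snd w), fst w))) El El); intros (j & x & y); simpl; intros; repeat split; lia. }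
  transitivity (zsum (fun w : Z * (Z * Z) => (-2) * (fst w * fst w)
     + (fst (snd w) * fst (snd w) + snd (snd w) * snd (snd w))) l).
  - apply zsum_ext. intros w Hw. apply El in Hw. lia.
  - rewrite !zsum_add, zsum_scale, E1, E2. unfold P1. lia.
Qed.

(** Triples (i, (d, e)) with i^2 + d e = n, d, e > 0 and e odd; an even divisor e would have chi(e)
    = 0. *)
Definition square_plus_product (n : Z) : list (Z * (Z * Z)) :=
  filter (fun w => Z.odd (snd (snd w)))
    (dsum (zbox n) (fun i => map (fun e => ((n - i * i) / e, e)) (divisors (n - i * i)))).

Lemma divisors_nonpos n : n <= 0 -> divisors n = [].
Proof. intros H. unfold divisors, zrange. replace (Z.to_nat (n + 1 - 1)) with 0%nat by lia. reflexivity. Qed.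

Lemma enum_factorizations n :
  enum (map (fun e => (n / e, e)) (divisors n)) (fun w => 0 < fst w /\ 0 < snd w /\ fst w * snd w = n).
Proof.
  destruct (Z_le_gt_dec n 0) as [Hn|Hn].
  - rewrite divisors_nonpos by assumption. split; [constructor|]. intros (d & e). simpl.
    split; [tauto|]. nia.
  - assert (Hn' : 0 < n) by lia. destruct (enum_divisors Hn') as [N I]. split.
    + apply NoDup_map_NoDup_ForallPairs; [|exact N]. intros x y _ _ [=]. assumption.
    + intros (d & e). rewrite in_map_iff. simpl. split.
      * intros (e' & [= <- <-] & He). apply I in He as (He & (q & ->)).
        rewrite Z.div_mul by lia. split; [nia|]. lia.
      * intros (Hd & He & <-). exists e. rewrite Z.div_mul by lia. split; [reflexivity|].
        apply I. split; [assumption|]. now exists d.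
Qed.

Lemma enum_square_plus_product n : enum (square_plus_product n) (fun w =>
  fst w * fst w + fst (snd w) * snd (snd w) = n /\ 0 < fst (snd w) /\ 0 < snd (snd w) /\ Z.Odd (snd (snd w))).
Proof.
  refine (enum_iff (enum_filter (Q := fun w => Z.Odd (snd (snd w)))
    (enum_dsum (enum_zbox n) (fun i _ => enum_factorizations (n - i * i))) _) _).
  - intros w _. apply Z.odd_spec.
  - intros (i & d & e). simpl. split; [intuition lia|]. intros (E & Hd & He & Oe).
    assert (0 < d * e) by nia. repeat split; auto; [nia|lia].
Qed.

Lemma chi_sum_square_plus_product (n : Z) :
  zsum (fun j => (n - 3 * (j * j)) * chi_sum (n - j * j)) (zbox n)
  = zsum (fun w => chi (snd (snd w)) * (n - 3 * (fst w * fst w))) (square_plus_product n).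
Proof.
  unfold square_plus_product. rewrite zsum_filter, zsum_dsum. apply zsum_ext. intros i _.
  rewrite zsum_map. unfold chi_sum. rewrite <- zsum_scale. apply zsum_ext. intros e _. cbn [fst snd].
  destruct (Z.odd e) eqn:O; [ring|]. rewrite (chi_even (d := e)); [ring|].
  intros H. apply Z.odd_spec in H. congruence.
Qed.

Lemma zrange_snoc a b : a <= b -> zrange a (b + 1) = zrange a b ++ [b].
Proof.
  intros H. unfold zrange. replace (Z.to_nat (b + 1 - a)) with (S (Z.to_nat (b - a))) by lia.
  rewrite seq_S, map_app. simpl. do 2 f_equal. lia.
Qed.

Lemma chi_4k k : chi (4 * k) = 0 /\ chi (4 * k + 1) = 1 /\ chi (4 * k + 2) = 0 /\ chi (4 * k + 3) = -1.
Proof.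
  destruct (chi_cases (4 * k)) as (t0 & H0), (chi_cases (4 * k + 1)) as (t1 & H1),
    (chi_cases (4 * k + 2)) as (t2 & H2), (chi_cases (4 * k + 3)) as (t3 & H3). lia.
Qed.

(** Each block of four consecutive numbers contributes - (4 i + 1) + (4 i + 3) = 2, whatever c
    is. *)
Lemma weighted_chi_sum c (k : nat) :
  zsum (fun x => chi x * (c - x)) (zrange 1 (4 * Z.of_nat k + 1)) = 2 * Z.of_nat k.
Proof.
  induction k as [|k IH]; [reflexivity|].
  replace (4 * Z.of_nat (S k) + 1) with (4 * Z.of_nat k + 1 + 1 + 1 + 1 + 1) by lia.
  rewrite !zrange_snoc, !zsum_app, IH by lia. cbn [zsum].
  destruct (chi_4k (Z.of_nat k)) as (_ & C1 & C2 & C3), (chi_4k (Z.of_nat k + 1)) as (C4 & _).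
  replace (4 * (Z.of_nat k + 1)) with (4 * Z.of_nat k + 1 + 1 + 1 + 1) in C4 by ring.
  replace (4 * Z.of_nat k + 2) with (4 * Z.of_nat k + 1 + 1) in C2 by ring.
  replace (4 * Z.of_nat k + 3) with (4 * Z.of_nat k + 1 + 1 + 1) in C3 by ring.
  rewrite C1, C2, C3, C4. lia.
Qed.

Lemma alternating_odd_sum s : 0 < s -> zsum (fun x => chi x * (2 * s - x)) (zrange 1 (2 * s)) = s.
Proof.
  intros Hs. destruct (Z.Even_or_Odd s) as [(t & E)|(t & E)].
  - assert (H := weighted_chi_sum (2 * s) (Z.to_nat t)). rewrite Z2Nat.id in H by lia.
    replace (4 * t) with (2 * s) in H by lia.
    rewrite zrange_snoc, zsum_app in H by lia. cbn [zsum] in H. lia.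
  - assert (H := weighted_chi_sum (2 * s) (Z.to_nat t)). rewrite Z2Nat.id in H by lia.
    assert (E' : zrange 1 (2 * s) = zrange 1 (4 * t + 1) ++ [4 * t + 1]).
    { rewrite <- zrange_snoc by lia. f_equal. lia. }
    rewrite E', zsum_app, H. cbn [zsum].
    destruct (chi_4k t) as (_ & -> & _). lia.
Qed.

Lemma zsum_split A (f : A -> Z) (b : A -> bool) l :
  zsum f l = zsum f (filter b l) + zsum f (filter (fun a => negb (b a)) l).
Proof. rewrite !zsum_filter, <- zsum_add. apply zsum_ext. intros a _. destruct (b a); simpl; lia. Qed.

(* With [x = e - 2 i], [y = d + i], [z = 2 d + 2 i - e] one has [4 n = x^2 + 4 y^2 - z^2], and the
   domain becomes [z < 2 y], [- z < x]. The terms with [x < z] cancel under [x -> - x], those with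
   [z < x] under [z -> - z] combined with [(y, z) -> (- y, - z)] where needed. *)
Lemma chi_sum_recurrence n : 0 < n ->
  zsum (fun j => (n - 3 * (j * j)) * chi_sum (n - j * j)) (zbox n)
  = zsum (fun w => chi (snd (snd w)) * ((snd (snd w) - 2 * fst w) * (fst (snd w) + fst w)))
     (filter (fun w => fst (snd w) + 2 * fst w =? snd (snd w)) (square_plus_product n)).
Proof.
  intros Hn. rewrite chi_sum_square_plus_product.
  set (f := fun w : Z * (Z * Z) => chi (snd (snd w)) * ((snd (snd w) - 2 * fst w) * (fst (snd w) + fst w))).
  assert (El := enum_square_plus_product n). set (l := square_plus_product n) in *.
  (* On i^2 + d e = n the weight n - 3 i^2 exceeds (e - 2 i) (d + i) by i (2 d - e), which is odd in
     i and sums to 0. *)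
  transitivity (zsum f l).
  { assert (zsum (fun w => chi (snd (snd w)) * (n - 3 * (fst w * fst w)) + -1 * f w) l = 0).
    - apply (zsum_sign_reversing (h := fun w => (- fst w, snd w)) El).
      intros (i & d & e). unfold f. cbn [fst snd]. intros (E & H). repeat split; try tauto; try lia.
      f_equal. lia.
    - rewrite zsum_add, zsum_scale in H. lia. }
  rewrite (zsum_split f (fun w => fst (snd w) + 2 * fst w =? snd (snd w)) l).
  set (l' := filter (fun w => negb _) l).
  assert (Hb : forall w : Z * (Z * Z), negb (fst (snd w) + 2 * fst w =? snd (snd w)) = true <->
    fst (snd w) + 2 * fst w <> snd (snd w)) by (intros w; rewrite Bool.negb_true_iff; apply Z.eqb_neq).
  assert (El' := enum_filter El (fun w _ => Hb w)). fold l' in El'.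
  rewrite (zsum_split f (fun w => fst (snd w) + 2 * fst w >? snd (snd w)) l').
  assert (H1 : forall w : Z * (Z * Z), (fst (snd w) + 2 * fst w >? snd (snd w)) = true <->
    snd (snd w) < fst (snd w) + 2 * fst w) by (intros w; rewrite Z.gtb_lt; reflexivity).
  assert (H2 : forall w : Z * (Z * Z), negb (fst (snd w) + 2 * fst w >? snd (snd w)) = true <->
    fst (snd w) + 2 * fst w <= snd (snd w)) by (intros w; rewrite Bool.negb_true_iff, Z.gtb_ltb; apply Z.ltb_ge).
  rewrite (zsum_sign_reversing (f := f) (h := fun w => let '(i, (d, e)) := w in (e - i, (d + 2 * i - e, e)))
    (enum_filter El' (fun w _ => H1 w))).
  2: { intros (i & d & e). unfold f. cbn [fst snd]. intros (((E & Hd & He & Oe) & H3) & H4).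
       repeat split; auto; try lia. f_equal; [lia|f_equal; lia]. }
  rewrite (zsum_sign_reversing (f := f) (h := fun w => let '(i, (d, e)) := w in
      if 4 * d + 4 * i - e >? 0 then (2 * d + 3 * i - e, (e - 2 * i - d, 4 * d + 4 * i - e))
      else (- 2 * d - i, (d, e - 4 * d - 4 * i)))
    (enum_filter El' (fun w _ => H2 w))).
  - lia.
  - intros (i & d & e). unfold f. cbn [fst snd]. intros (((E & Hd & He & Oe) & H4) & H5).
    assert (Oe' : Z.Odd (e - 4 * d - 4 * i)) by (destruct Oe as (t & ->); exists (t - 2 * d - 2 * i); lia).
    assert (Oe'' : Z.Odd (4 * d + 4 * i - e)) by (destruct Oe as (t & ->); exists (2 * d + 2 * i - t - 1); lia).
    destruct (Z.gtb_spec (4 * d + 4 * i - e) 0) as [H3|H3]; cbn [fst snd].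
    + destruct (Z.gtb_spec (4 * (e - 2 * i - d) + 4 * (2 * d + 3 * i - e) - (4 * d + 4 * i - e)) 0); [|lia].
      repeat split; auto; try lia.
      * f_equal; [lia|f_equal; lia].
      * rewrite (@chi_add_odd e (4 * d + 4 * i - e)); [ring|assumption|exists (d + i); lia].
    + destruct (Z.gtb_spec (4 * d + 4 * (- 2 * d - i) - (e - 4 * d - 4 * i)) 0); [lia|].
      assert (e - 4 * d - 4 * i <> 0) by (destruct Oe' as (t & Ht); lia).
      repeat split; auto; try lia.
      * f_equal; [lia|f_equal; lia].
      * replace (e - 4 * d - 4 * i) with (- (4 * d + 4 * i - e)) by ring.
        rewrite (@chi_add_odd (4 * d + 4 * i - e)); [|assumption|exists 0; lia].
        rewrite (@chi_add_odd e (4 * d + 4 * i - e)); [ring|assumption|exists (d + i); lia].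
Qed.

Lemma zsum_zero A (f : A -> Z) l : (forall a, In a l -> f a = 0) -> zsum f l = 0.
Proof. intros H. rewrite (zsum_ext (g := fun _ => 0 * 0)) by auto. rewrite zsum_scale. lia. Qed.

Lemma enum_sqrt s : 0 < s -> enum [s; - s] (fun j => j * j = s * s).
Proof.
  intros Hs. split.
  - repeat constructor; simpl; lia.
  - intros j. simpl. split; [intros [<-|[<-|[]]]; ring|]. intros H.
    assert (E : (j - s) * (j + s) = 0) by lia. apply Z.mul_eq_0 in E. lia.
Qed.

(** The surviving terms have e = d + 2 i, hence n = (i + d)^2 and i + d = s. They are indexed by the
    odd e < 2 s, with d = 2 s - e and i = e - s, and have the weight chi(e) s (2 s - e). *)
Lemma chi_sum_recurrence_square s : 0 < s ->
  zsum (fun j => (s * s - 3 * (j * j)) * chi_sum (s * s - j * j)) (zbox (s * s)) = s * s.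
Proof.
  intros Hs. rewrite chi_sum_recurrence by nia.
  assert (Hb : forall w : Z * (Z * Z), (fst (snd w) + 2 * fst w =? snd (snd w)) = true <->
    fst (snd w) + 2 * fst w = snd (snd w)) by (intros w; apply Z.eqb_eq).
  assert (El := enum_filter (enum_square_plus_product (s * s)) (fun w _ => Hb w)).
  assert (El' := enum_filter (enum_zrange 1 (2 * s)) (fun e _ => Z.odd_spec e)).
  transitivity (zsum (fun e => s * (chi e * (2 * s - e))) (filter Z.odd (zrange 1 (2 * s)))).
  - symmetry.
    apply (enum_zsum_bij (h := fun e => (e - s, (2 * s - e, e))) (k := fun w => snd (snd w)) El' El).
    + intros e (He & Oe). cbn [fst snd]. repeat split; auto; lia.
    + intros (i & d & e) ((E & Hd & He & Oe) & H). cbn [fst snd] in *.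
      assert (E' : (i + d - s) * (i + d + s) = 0) by (subst e; lia).
      apply Z.mul_eq_0 in E'.
      assert (i + d = s) by lia. repeat split; auto; try lia. f_equal; [lia|f_equal; lia].
  - rewrite zsum_filter. transitivity (s * zsum (fun x => chi x * (2 * s - x)) (zrange 1 (2 * s)));
      [rewrite <- zsum_scale|now rewrite alternating_odd_sum].
    apply zsum_ext. intros e _. destruct (Z.odd e) eqn:O; [reflexivity|].
    rewrite (chi_even (d := e)); [ring|]. intros H. apply Z.odd_spec in H. congruence.
Qed.

Lemma chi_sum_recurrence_nonsquare n : 0 < n -> (forall s, n <> s * s) ->
  zsum (fun j => (n - 3 * (j * j)) * chi_sum (n - j * j)) (zbox n) = 0.
Proof.
  intros Hn H. rewrite chi_sum_recurrence by assumption. apply zsum_zero.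
  intros (i & d & e) I. apply filter_In in I as (I & E). apply enum_square_plus_product in I.
  cbn [fst snd] in *. apply Z.eqb_eq in E. exfalso. apply (H (i + d)). destruct I as (I & _). subst e. lia.
Qed.

(** Both sides satisfy one recurrence once the value at 0 is corrected from 0 to 1. For n = s^2 the
    corrected terms j = s and j = - s add 2 (n - 3 n) = - 4 s^2, which cancels four times the sum
    s^2 obtained for [chi_sum]. *)
Theorem r2_chi_sum n : 0 < n -> r2 n = 4 * chi_sum n.
Proof.
  intros Hn. set (R := fun n => if n =? 0 then 1 else 4 * chi_sum n).
  transitivity (R n); [|unfold R; destruct (Z.eqb_spec n 0); lia]. clear Hn.
  apply square_recurrence_unique; clear n.
  - intros n Hn. unfold R, chi_sum. rewrite divisors_nonpos by assumption. simpl.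
    destruct (Z.eqb_spec n 0) as [->|]; [reflexivity|].
    unfold r2. apply zsum_zero. intros (x & y) I. apply enum_two_squares in I. simpl in I. nia.
  - intros. apply r2_recurrence.
  - intros n Hn.
    transitivity (zsum (fun j => (if j * j =? n then -2 * n else 0) + 4 * ((n - 3 * (j * j)) * chi_sum (n - j * j))) (zbox n)).
    { apply zsum_ext. intros j _. unfold R. destruct (Z.eqb_spec (j * j) n) as [<-|E].
      - rewrite Z.sub_diag. change (chi_sum 0) with 0. change (0 =? 0) with true. cbv iota. lia.
      - destruct (Z.eqb_spec (n - j * j) 0); [lia|]. ring. }
    rewrite zsum_add, zsum_scale, <- (zsum_filter (fun _ => -2 * n)).
    destruct (classic (exists s, n = s * s)) as [(s & Es)|Hs].
    + assert (exists s, 0 < s /\ n = s * s) as (s' & Hs' & ->).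
      { exists (Z.abs s). rewrite Z.abs_square. split; [nia|assumption]. }
      rewrite chi_sum_recurrence_square by assumption.
      transitivity (zsum (fun _ => -2 * (s' * s')) [s'; - s'] + 4 * (s' * s')); [f_equal|cbn [zsum]; ring].
      apply zsum_permutation, NoDup_Permutation.
      * apply NoDup_filter, enum_zbox.
      * now apply enum_sqrt.
      * intros j. rewrite filter_In, Z.eqb_eq. rewrite (proj2 (enum_sqrt Hs') j).
        split; [tauto|]. intros E. split; [|exact E]. apply enum_zbox. nia.
    + rewrite chi_sum_recurrence_nonsquare; [|assumption|intros s E; apply Hs; now exists s].
      rewrite zsum_zero; [reflexivity|]. intros j I. apply filter_In in I as (_ & I).
      apply Z.eqb_eq in I. exfalso. apply Hs. now exists j.
Qed.

End TwoSquares.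

(** * A convolution identity *)

Section FourSquares.
Local Open Scope Z_scope.

Definition odd_quad_eq (m : Z) (w : Z * (Z * (Z * Z))) : Prop :=
  let '(d, (e, (d', e'))) := w in
  (Z.Odd d /\ 0 < d) /\ (Z.Odd e /\ 0 < e) /\ (Z.Odd d' /\ 0 < d') /\ (Z.Odd e' /\ 0 < e') /\
  d * e + d' * e' = 2 * m.

Definition odd_quads (m : Z) : list (Z * (Z * (Z * Z))) :=
  filter (fun w => let '(d, (e, (d', e'))) := w in d * e + d' * e' =? 2 * m)
    (dsum (odds (2 * m)) (fun _ => dsum (odds (2 * m)) (fun _ => dsum (odds (2 * m)) (fun _ => odds (2 * m))))).

Lemma enum_odd_quads m : enum (odd_quads m) (odd_quad_eq m).
Proof.
  assert (Hb : forall w : Z * (Z * (Z * Z)),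
    (let '(d, (e, (d', e'))) := w in d * e + d' * e' =? 2 * m) = true <->
    (let '(d, (e, (d', e'))) := w in d * e + d' * e' = 2 * m)) by (intros (d & e & d' & e'); apply Z.eqb_eq).
  assert (O := enum_odds (2 * m)).
  refine (enum_iff (enum_filter (enum_dsum O (fun _ _ => enum_dsum O (fun _ _ => enum_dsum O (fun _ _ => O))))
    (fun w _ => Hb w)) _).
  intros (d & e & d' & e'). unfold odd_quad_eq. cbn [fst snd]. split; [tauto|].
  intros ((? & ?) & (? & ?) & (? & ?) & (? & ?) & E).
  assert (0 < d * e) by (now apply Z.mul_pos_pos). assert (0 < d' * e') by (now apply Z.mul_pos_pos).
  assert (d <= d * e) by (apply Z.le_mul_diag_r; lia). assert (d' <= d' * e') by (apply Z.le_mul_diag_r; lia).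
  assert (e <= d * e) by (rewrite Z.mul_comm; apply Z.le_mul_diag_r; lia).
  assert (e' <= d' * e') by (rewrite Z.mul_comm; apply Z.le_mul_diag_r; lia).
  repeat split; auto; lia.
Qed.

Lemma odd_factors a b : Z.Odd (a * b) -> Z.Odd a /\ Z.Odd b.
Proof. rewrite <- !Z.odd_spec, Z.odd_mul, Bool.andb_true_iff. tauto. Qed.

Lemma odd_product a b : Z.Odd a -> Z.Odd b -> Z.Odd (a * b).
Proof. intros (i & ->) (j & ->). exists (2 * i * j + i + j). lia. Qed.

Definition chi2 (w : Z * (Z * (Z * Z))) : Z := let '(d, (_, (d', _))) := w in chi d * chi d'.

Lemma chi_sum_convolution m :
  zsum (fun a => chi_sum a * chi_sum (2 * m - a)) (odds (2 * m)) = zsum chi2 (odd_quads m).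
Proof.
  transitivity (zsum (fun w => chi (fst (snd w)) * chi (snd (snd w)))
    (dsum (odds (2 * m)) (fun a => dsum (divisors a) (fun _ => divisors (2 * m - a))))).
  { rewrite zsum_dsum. apply zsum_ext. intros a _. rewrite zsum_dsum. cbn [fst snd].
    unfold chi_sum. rewrite Z.mul_comm, <- zsum_scale. apply zsum_ext. intros d _.
    rewrite zsum_scale. ring. }
  assert (L : forall a, Z.Odd a /\ 0 < a <= 2 * m -> 0 < a /\ 0 < 2 * m - a).
  { intros a ((t & ->) & H). lia. }
  refine (enum_zsum_bij
    (h := fun w => let '(a, (d, d')) := w in (d, (a / d, (d', (2 * m - a) / d'))))
    (k := fun w => let '(d, (e, (d', _))) := w in (d * e, (d, d')))
    (enum_dsum (enum_odds (2 * m)) (fun a Ha => enum_dsum (enum_divisors (proj1 (L a Ha)))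
       (fun _ _ => enum_divisors (proj2 (L a Ha))))) (enum_odd_quads m) _ _).
  - intros (a & d & d'). cbn [fst snd]. intros ((Oa & Ha) & (Hd & (e & He)) & (Hd' & (e' & He'))).
    rewrite He'. rewrite He. rewrite !Z.div_mul by lia.
    assert (Ha' := L a (conj Oa Ha)).
    assert (Oa' : Z.Odd (2 * m - a)) by (destruct Oa as (t & ->); exists (m - t - 1); lia).
    rewrite He in Oa. rewrite He' in Oa'. apply odd_factors in Oa, Oa'.
    unfold odd_quad_eq, chi2. repeat split; try tauto; try lia.
    + f_equal. lia.
  - intros (d & e & d' & e'). unfold odd_quad_eq. cbn [fst snd].
    intros ((Od & Hd) & (Oe & He) & (Od' & Hd') & (Oe' & He') & E).
    assert (0 < d * e) by (now apply Z.mul_pos_pos). assert (0 < d' * e') by (now apply Z.mul_pos_pos).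
    replace (2 * m - d * e) with (e' * d') by lia. rewrite (Z.mul_comm d e), !Z.div_mul by lia.
    rewrite (Z.mul_comm e d).
    repeat split; auto; try lia; [now apply odd_product|exists e; ring|exists e'; lia].
Qed.

(* Liouville's substitution; [k] is the unique integer for which the image is positive, and it is
   the same for the image, so that this is an involution. *)
Definition quad_swap (w : Z * (Z * (Z * Z))) : Z * (Z * (Z * Z)) :=
  let '(d, (e, (d', e'))) := w in
  let a := d - d' in let s := e + e' in let k := d' / a + 1 in
  (e + k * s, (d - k * a, (k * s - e', k * a - d'))).

(** For a quadruple it says d d' = e e' modulo 4, the congruence behind the change of sign in
    [quad_swap_spec]. As m is odd, the halves (u - 1) / 2, (v - 1) / 2, (w - 1) / 2, (z - 1) / 2
    have an even sum. *)
Lemma odd_mod4 u v w z m : Z.Odd m -> Z.Odd u -> Z.Odd v -> Z.Odd w -> Z.Odd z ->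
  u * v + w * z = 2 * m -> exists t, u * w - v * z = 4 * t.
Proof.
  intros (i & ->) (a & ->) (b & ->) (c & ->) (d & ->) E.
  assert (D : exists s, a + b + c + d = 2 * s).
  { exists (i - a * b - c * d). lia. }
  destruct D as (s & D). exists (a * c - b * d + s - b - d). lia.
Qed.

Lemma chi_mul u v : chi (u * v) = chi u * chi v.
Proof.
  destruct (chi_cases u) as (i & [(E1 & ->)|[(E1 & ->)|(E1 & ->)]]),
    (chi_cases v) as (j & [(E2 & ->)|[(E2 & ->)|(E2 & ->)]]);
  match goal with |- chi ?w = _ => destruct (chi_cases w) as (k & [(E3 & ->)|[(E3 & ->)|(E3 & ->)]]) end;
  try reflexivity; exfalso.
  all: try (subst u); try (subst v); try (destruct E1 as [-> | ->]); try (destruct E2 as [-> | ->]);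
    try (destruct E3 as [E3|E3]); try lia.
Qed.

(** The image exchanges the roles of a and s and has the same k. The sign changes because the old
    and new products of first and third entries add up to d d' - e e' + k s (e - e') + k^2 s^2, a
    multiple of 4 as s and e - e' are even. *)
Lemma quad_swap_spec m d e d' e' : Z.Odd m -> d' < d -> odd_quad_eq m (d, (e, (d', e'))) ->
  let w := quad_swap (d, (e, (d', e'))) in
  odd_quad_eq m w /\ fst (snd (snd w)) < fst w /\ quad_swap w = (d, (e, (d', e'))) /\
  chi2 w = - chi2 (d, (e, (d', e'))).
Proof.
  intros Om Hlt ((Od & Hd) & (Oe & He) & (Od' & Hd') & (Oe' & He') & E).
  assert (M := odd_mod4 Om Od Oe Od' Oe' E). destruct M as (t & M).
  unfold quad_swap. set (a := d - d'). set (s := e + e'). set (k := d' / a + 1).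
  assert (a0 : 0 < a) by (unfold a; lia).
  assert (B := Z.div_mod d' a (ltac:(lia))). assert (B' := Z.mod_pos_bound d' a a0).
  assert (k0 : 0 <= d' / a) by (apply Z.div_pos; lia).
  assert (Ea : exists al, a = 2 * al).
  { destruct Od as (i & ->), Od' as (j & ->). exists (i - j). unfold a. lia. }
  assert (Es : exists si, s = 2 * si).
  { destruct Oe as (i & ->), Oe' as (j & ->). exists (i + j + 1). unfold s. lia. }
  destruct Ea as (al & Ea), Es as (si & Es).
  (* Since a is even and d' odd, the remainder is not 0, which makes both d - k a and k a - d'
     strictly positive. *)
  assert (B0 : d' mod a <> 0).
  { intros Z0. destruct Od' as (j & Ej). rewrite Z0, Ea in B.
    assert (d' = 2 * (al * (d' / (2 * al)))) by lia. lia. }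
  set (q := d' / a) in *. set (r := d' mod a) in *.
  assert (Hk : k = q + 1) by reflexivity. clearbody q r k.
  assert (Ka : k * a - d' = a - r) by (rewrite Hk; lia).
  assert (Da : d - k * a = r) by (unfold a in *; lia).
  assert (Ks : s <= k * s) by (assert (0 <= q * s) by (apply Z.mul_nonneg_nonneg; unfold s; lia); lia).
  assert (A1 : e + k * s - (k * s - e') = s) by (unfold s; lia).
  assert (S1 : d - k * a + (k * a - d') = a) by (unfold a; lia).
  assert (O1 : Z.Odd (e + k * s)) by (destruct Oe as (i & ->); exists (i + k * si); rewrite Es; lia).
  assert (O1' : Z.Odd (k * s - e')) by (destruct Oe' as (i & ->); exists (k * si - i - 1); rewrite Es; lia).
  assert (O2 : Z.Odd (d - k * a)) by (destruct Od as (i & Ei); exists (i - k * al); rewrite Ea; lia).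
  assert (O2' : Z.Odd (k * a - d')) by (destruct Od' as (i & Ei); exists (k * al - i - 1); rewrite Ea; lia).
  assert (K1 : (k * s - e') / s + 1 = k).
  { assert ((k * s - e') / s = k - 1); [|lia]. symmetry. apply Z.div_unique with (s - e').
    - left. unfold s. lia.
    - ring. }
  cbn [fst snd]. repeat split; auto; try lia.
  - unfold odd_quad_eq. unfold s in *. repeat split; auto; try lia.
  - rewrite A1, S1, K1. f_equal; [lia|f_equal; [|f_equal; lia]]. unfold s. lia.
  - unfold chi2. rewrite <- !chi_mul. apply chi_add_odd; [now apply odd_product|].
    exists (t + k * (si * (si - e')) + k * k * (si * si)).
    assert (Ee : e = 2 * si - e') by (unfold s in Es; lia).
    transitivity (d * d' - e * e' + k * (s * (e - e')) + k * k * (s * s)); [ring|].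
    rewrite M, Es, Ee. ring.
Qed.

Definition quad_flip (w : Z * (Z * (Z * Z))) : Z * (Z * (Z * Z)) :=
  let '(d, (e, (d', e'))) := w in (d', (e', (d, e))).

(** Quadruples with d <> d' cancel under Liouville's involution, conjugated by the exchange of the
    two products when d < d'. Those with d = d' have weight 1 and e + e' = 2 m / d, which leaves m /
    d odd values of e, sigma(m) in all. *)
Theorem chi_sum_convolution_hermite m : Z.Odd m -> 0 < m ->
  zsum (fun a => chi_sum a * chi_sum (2 * m - a)) (odds (2 * m)) = card (hermite m).
Proof.
  intros Om Hm. rewrite chi_sum_convolution.
  assert (El := enum_odd_quads m). set (l := odd_quads m) in *.
  rewrite (zsum_split chi2 (fun w => let '(d, (_, (d', _))) := w in d =? d') l).
  set (l' := filter (fun w => negb _) l).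
  assert (Hb0 : forall w, (let '(d, (_, (d', _))) := w in d =? d') = true <->
    (let '(d, (_, (d', _))) := (w : Z * (Z * (Z * Z))) in d = d')) by (intros (d & e & d' & e'); apply Z.eqb_eq).
  assert (Hb1 : forall w, negb (let '(d, (_, (d', _))) := w in d =? d') = true <->
    (let '(d, (_, (d', _))) := (w : Z * (Z * (Z * Z))) in d <> d'))
    by (intros (d & e & d' & e'); rewrite Bool.negb_true_iff; apply Z.eqb_neq).
  assert (El' := enum_filter El (fun w _ => Hb1 w)). fold l' in El'.
  rewrite (zsum_sign_reversing (l := l') (f := chi2)
    (h := fun w => if fst (snd (snd w)) <? fst w then quad_swap w else quad_flip (quad_swap (quad_flip w))) El').
  - rewrite Z.add_0_r. symmetry. unfold card.
    apply (enum_zsum_bij (h := fun w => let '(d, c) := w in (d, (2 * c + 1, (d, 2 * (m / d) - (2 * c + 1)))))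
      (k := fun w => let '(d, (e, _)) := w in (d, e / 2)) (enum_hermite Hm) (enum_filter El (fun w _ => Hb0 w))).
    + intros (d & c) (Hd & (q & Hq) & Hc). rewrite Hq in Om. destruct (odd_factors Om) as (Oq & Od).
      rewrite Hq in Hc |- *. rewrite Z.div_mul in Hc |- * by lia.
      unfold odd_quad_eq, chi2. repeat split; auto; try lia.
      * now exists c.
      * exists (q - c - 1). lia.
      * f_equal. symmetry. apply Z.div_unique with 1; lia.
      * destruct (chi_cases d) as (t & [(_ & ->)|[(_ & ->)|(F & _)]]); [reflexivity|reflexivity|].
        destruct Od as (i & Ei). lia.
    + intros (d & e & d' & e') (((Od & Hd) & ((c & Oe) & He) & (Od' & Hd') & (Oe' & He') & E) & <-).
      assert (F : 2 * m = d * (e + e')) by lia.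
      destruct Oe' as (c' & Oe').
      assert (G : m = (c + c' + 1) * d) by (subst e e'; lia).
      assert (G' : m / d = c + c' + 1) by (rewrite G; apply Z.div_mul; lia).
      replace (e / 2) with c by (apply Z.div_unique with 1; lia).
      unfold hermite_eq. rewrite G'. repeat split; try lia.
      * now exists (c + c' + 1).
      * f_equal. f_equal; [lia|]. f_equal. lia.
  - intros (d & e & d' & e') (Q & Hne). cbn [fst snd]. destruct (Z.ltb_spec d' d) as [Hlt|Hlt].
    + assert (S := quad_swap_spec Om Hlt Q). cbv zeta in S.
      destruct (quad_swap (d, (e, (d', e')))) as (u & v & u' & v'). cbn [fst snd] in *.
      destruct S as (S1 & S2 & S3 & S4). destruct (Z.ltb_spec u' u); [|lia].
      split; [split; [exact S1|lia]|split; [exact S3|exact S4]].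
    + assert (Hlt' : d < d') by lia.
      assert (Q' : odd_quad_eq m (d', (e', (d, e)))) by (unfold odd_quad_eq in *; intuition lia).
      assert (S := quad_swap_spec Om Hlt' Q'). cbv zeta in S.
      change (quad_flip (d, (e, (d', e')))) with (d', (e', (d, e))).
      destruct (quad_swap (d', (e', (d, e)))) as (u & v & u' & v'). cbn [quad_flip fst snd] in *.
      destruct S as (S1 & S2 & S3 & S4). destruct (Z.ltb_spec u u'); [lia|].
      rewrite S3. split; [split; [unfold odd_quad_eq in *; intuition lia|lia]|split; [reflexivity|]].
      unfold chi2 in *. lia.
Qed.

End FourSquares.

(** * Sums of three odd squares *)

Section ThreeSquares.
Local Open Scope Z_scope.

Lemma abs_le_square t : Z.abs t <= t * t.
Proof. nia. Qed.

Definition square_two_squares_eq (M : Z) (w : Z * (Z * Z)) : Prop :=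
  let '(x, (u, v)) := w in Z.Odd x /\ x * x + 2 * (u * u + v * v) = M.

Definition square_two_squares (M : Z) : list (Z * (Z * Z)) :=
  filter (fun w => let '(x, (u, v)) := w in Z.odd x && (x * x + 2 * (u * u + v * v) =? M))%bool
    (dsum (zbox M) (fun _ => zbox2 M)).

Lemma enum_square_two_squares M : enum (square_two_squares M) (square_two_squares_eq M).
Proof.
  assert (Hb : forall w : Z * (Z * Z),
    (let '(x, (u, v)) := w in Z.odd x && (x * x + 2 * (u * u + v * v) =? M))%bool = true <->
    square_two_squares_eq M w).
  { intros (x & u & v). rewrite Bool.andb_true_iff, Z.odd_spec, Z.eqb_eq. reflexivity. }
  refine (enum_iff (enum_filter (enum_dsum (enum_zbox M) (fun _ _ => enum_zbox2 M)) (fun w _ => Hb w)) _).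
  intros (x & u & v). unfold square_two_squares_eq. cbn [fst snd].
  split; [tauto|]. intros (Ox & E).
  assert (Ax := @abs_le_square x). assert (Au := @abs_le_square u). assert (Av := @abs_le_square v).
  repeat split; try tauto; lia.
Qed.

Definition level_squares (m : Z) : list (Z * (Z * (Z * Z))) :=
  dsum (odds (4 * m)) (fun K => square_two_squares (4 * m - K * K)).

Lemma enum_units : enum [1; -1] (fun e => e * e = 1).
Proof. exact (enum_sqrt Z.lt_0_1). Qed.

(** With K of either sign, s = (K + x) / 2 and t = (K - x) / 2, the equation becomes s^2 + t^2 + u^2
    + v^2 = 2 m with a = s^2 + t^2 odd. So twice the left side is the sum of r2(a) r2(2 m - a) over
    odd a, which is 16 times the convolution of [chi_sum]. *)
Lemma card_level_squares m : Z.Odd m -> 0 < m -> card (level_squares m) = 8 * card (hermite m).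
Proof.
  intros Om Hm.
  assert (H : card (dsum [1; -1] (fun _ => level_squares m))
    = card (dsum (odds (2 * m)) (fun a => dsum (two_squares a) (fun _ => two_squares (2 * m - a))))).
  { refine (enum_card_bij
      (h := fun w => let '(e, (K, (x, (u, v)))) := w in
         (((e * K + x) / 2) * ((e * K + x) / 2) + ((e * K - x) / 2) * ((e * K - x) / 2),
          (((e * K + x) / 2, (e * K - x) / 2), (u, v))))
      (k := fun w => let '(a, ((s, t), (u, v))) := w in (Z.sgn (s + t), (Z.abs (s + t), (s - t, (u, v)))))
      (enum_dsum enum_units (fun _ _ => enum_dsum (enum_odds (4 * m)) (fun K _ => enum_square_two_squares (4 * m - K * K))))
      (enum_dsum (enum_odds (2 * m)) (fun a _ => enum_dsum (enum_two_squares a) (fun _ _ => enum_two_squares (2 * m - a)))) _ _).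
    - intros (e & K & x & u & v). unfold square_two_squares_eq. cbn [fst snd].
      intros (He & (OK & HK) & Ox & E).
      assert (He' : e = 1 \/ e = -1) by (apply Z.eq_mul_1 with e; assumption).
      assert (Hst : exists s t, e * K = s + t /\ x = s - t).
      { destruct OK as (i & ->), Ox as (j & ->). destruct He' as [-> | ->].
        - exists (i + j + 1), (i - j). lia.
        - exists (j - i), (- i - j - 1). lia. }
      destruct Hst as (s & t & Hs & Ht). rewrite Hs, Ht.
      replace ((s + t + (s - t)) / 2) with s by (apply Z.div_unique with 0; lia).
      replace ((s + t - (s - t)) / 2) with t by (apply Z.div_unique with 0; lia).
      assert (E' : K * K = (s + t) * (s + t)) by (rewrite <- Hs; destruct He' as [-> | ->]; ring).
      assert (E'' : s * s + t * t + (u * u + v * v) = 2 * m) by (rewrite E', Ht in E; lia).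
      repeat split; try lia.
      + destruct Ox as (j & Ox). assert (s = t + 2 * j + 1) as -> by lia.
        exists (t * t + 2 * j * j + 2 * j * t + 2 * j + t). ring.
      + nia.
      + nia.
      + rewrite <- Hs. destruct He' as [-> | ->]; repeat f_equal; lia.
    - intros (a & (s & t) & u & v). unfold square_two_squares_eq. cbn [fst snd].
      intros ((Oa & Ha) & E1 & E2).
      assert (Ost : Z.Odd (s + t)).
      { destruct Oa as (i & Oa). destruct (Z.Even_or_Odd (s + t)) as [(j & Hj)|]; [exfalso|assumption].
        assert (t = 2 * j - s) as -> by lia. lia. }
      assert (Hs : Z.sgn (s + t) * Z.abs (s + t) = s + t) by (rewrite Z.mul_comm; apply Z.abs_sgn).
      assert (N0 : s + t <> 0) by (destruct Ost; lia).
      split; [|].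
      + split; [destruct (Z.sgn_spec (s + t)) as [[_ ->]|[[? _]|[_ ->]]]; lia|]. rewrite Z.abs_square. split; [split|split].
        * destruct Ost as (i & Hi). destruct (Z.abs_spec (s + t)) as [[_ ->]|[_ ->]]; [exists i|exists (- i - 1)]; lia.
        * split; [lia|]. assert (T := @abs_le_square (s + t)).
          assert (0 <= (s - t) * (s - t)) by apply Z.square_nonneg.
          assert (0 <= u * u) by apply Z.square_nonneg. assert (0 <= v * v) by apply Z.square_nonneg. lia.
        * destruct Ost as (i & Hi). exists (i - t). lia.
        * lia.
      + rewrite Hs.
        replace ((s + t + (s - t)) / 2) with s by (apply Z.div_unique with 0; lia).
        replace ((s + t - (s - t)) / 2) with t by (apply Z.div_unique with 0; lia).
        rewrite E1. reflexivity. }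
  assert (L : forall a, In a (odds (2 * m)) -> 0 < a /\ 0 < 2 * m - a).
  { intros a Ha. apply enum_odds in Ha. destruct Ha as ((t & ->) & Ha). lia. }
  rewrite !card_dsum in H. cbn [zsum] in H.
  rewrite (zsum_ext (g := fun a => 16 * (chi_sum a * chi_sum (2 * m - a)))) in H.
  - rewrite zsum_scale, chi_sum_convolution_hermite in H by assumption. lia.
  - intros a Ha. rewrite card_dsum. unfold card at 1. rewrite zsum_const, <- card_length.
    change (r2 (2 * m - a) * r2 a = 16 * (chi_sum a * chi_sum (2 * m - a))).
    destruct (L a Ha). rewrite !r2_chi_sum by assumption. ring.
Qed.

(* Both sides have the same sum over the levels [4 m - K^2], [K] odd; [K = 1] gives the top term. *)
Lemma square_two_squares_three_forms j : 0 <= j ->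
  card (square_two_squares (8 * j + 3)) = 8 * card (three_forms (8 * j + 3)).
Proof.
  intros Hj. assert (Hj0 := Hj). revert Hj. pattern j. apply Z_lt_induction; [|exact Hj0].
  clear j Hj0. intros j IH Hj.
  set (m := 2 * j + 1).
  assert (Om : Z.Odd m) by now exists j.
  assert (Hm : 0 < m) by (unfold m; lia).
  assert (H1 := card_level_squares Om Hm). rewrite <- level_forms_hermite in H1 by assumption.
  unfold level_squares, level_forms in H1. rewrite !card_dsum in H1.
  assert (H2 : zsum (fun K => card (square_two_squares (4 * m - K * K)) + -8 * card (three_forms (4 * m - K * K)))
    (odds (4 * m)) = 0) by (rewrite zsum_add, zsum_scale; lia).
  rewrite (zsum_single (a := 1)) in H2.
  - cbv beta in H2. replace (4 * m - 1 * 1) with (8 * j + 3) in H2 by (unfold m; ring). lia.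
  - apply enum_odds.
  - apply enum_odds. split; [now exists 0|lia].
  - intros K HK K1. apply enum_odds in HK as ((k & EK) & HK).
    assert (Ek : exists i, k * (k + 1) = 2 * i).
    { destruct (Z.Even_or_Odd k) as [(i & ->)|(i & ->)]; [exists (i * (2 * i + 1))|exists ((2 * i + 1) * (i + 1))]; ring. }
    destruct Ek as (i & Ei).
    assert (EM : 4 * m - K * K = 8 * (j - i) + 3) by (unfold m; subst K; lia).
    assert (0 < i) by nia.
    rewrite EM. destruct (Z_le_gt_dec 0 (j - i)) as [Hji|Hji].
    + rewrite IH by lia. ring.
    + assert (N1 : card (square_two_squares (8 * (j - i) + 3)) = 0).
      { apply zsum_zero. intros (x & u & v) I. apply enum_square_two_squares in I as (_ & E).
        assert (0 <= x * x) by apply Z.square_nonneg.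
        assert (0 <= u * u) by apply Z.square_nonneg. assert (0 <= v * v) by apply Z.square_nonneg. lia. }
      assert (N2 : card (three_forms (8 * (j - i) + 3)) = 0).
      { apply zsum_zero. intros (x & y & z) I. apply enum_three_forms in I as ((_ & Hx) & (_ & Hy) & (_ & Hz) & E).
        assert (T1 := Z.mul_pos_pos _ _ Hx Hy). assert (T2 := Z.mul_pos_pos _ _ Hy Hz).
        assert (T3 := Z.mul_pos_pos _ _ Hz Hx). lia. }
      rewrite N1, N2. reflexivity.
Qed.

(** The squares are those of x, u + v and u - v, and u + v is odd because x^2 + 2 (u^2 + v^2) = 3
    modulo 4 makes u^2 + v^2 odd. *)
Theorem three_odd_squares j : 0 <= j ->
  exists x y z, Z.Odd x /\ Z.Odd y /\ Z.Odd z /\ 8 * j + 3 = x * x + y * y + z * z.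
Proof.
  intros Hj. assert (H := square_two_squares_three_forms Hj).
  assert (I : In (1, (1, 4 * j + 1)) (three_forms (8 * j + 3))).
  { apply enum_three_forms. unfold three_forms_eq.
    repeat split; try lia; [now exists 0|now exists 0|exists (2 * j); lia]. }
  assert (P : 0 < card (three_forms (8 * j + 3))).
  { rewrite card_length. destruct (three_forms (8 * j + 3)); [contradiction|simpl length; lia]. }
  assert (E := enum_square_two_squares (8 * j + 3)).
  destruct (square_two_squares (8 * j + 3)) as [|(x, (u, v)) l].
  - change (0 = 8 * card (three_forms (8 * j + 3))) in H. lia.
  - destruct (proj1 (proj2 E _) (or_introl eq_refl)) as (Ox & Ex).
    assert (Ouv : Z.Odd (u + v)).
    { destruct Ox as (i & ->). destruct (Z.Even_or_Odd (u + v)) as [(t & Ht)|]; [exfalso|assumption].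
      assert (Ei : exists k, i * (i + 1) = 2 * k).
      { destruct (Z.Even_or_Odd i) as [(k & ->)|(k & ->)]; [exists (k * (2 * k + 1))|exists ((2 * k + 1) * (k + 1))]; ring. }
      destruct Ei as (k & Ek). assert (v = 2 * t - u) as -> by lia. lia. }
    exists x, (u + v), (u - v). split; [exact Ox|]. split; [exact Ouv|].
    split; [destruct Ouv as (t & Ht); exists (t - v); lia|]. lia.
Qed.

End ThreeSquares.

(** * Hurwitz quaternions *)

Section Quaternions.
Local Open Scope Z_scope.

(** Changing the sign of y1 changes the half-sum by the odd number y1. *)
Lemma odd_four_sum y1 y2 y3 y4 : Z.Odd y1 -> Z.Odd y2 -> Z.Odd y3 -> Z.Odd y4 ->
  exists e h, (e = 1 \/ e = -1) /\ Z.Odd h /\ e * y1 + y2 + y3 + y4 = 2 * h.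
Proof.
  intros (a & ->) (b & ->) (c & ->) (d & ->).
  destruct (Z.Even_or_Odd (a + b + c + d + 2)) as [(t & H)|H].
  - exists (-1), (b + c + d - a + 1). split; [now right|]. split; [exists (t - a - 1)|]; lia.
  - exists 1, (a + b + c + d + 2). split; [now left|]. split; [assumption|lia].
Qed.

Lemma odd_sub_odd h y : Z.Odd h -> Z.Odd y -> exists t, h - y = 2 * t.
Proof. intros (a & ->) (b & ->). exists (a - b). lia. Qed.

(** The vector (e, x, y, z) of norm 8 m + 4 is reflected, up to sign, in the all-ones vector. As the
    half-sum h is odd, the images h - e, h - x, h - y, h - z are even, and their halves have norm 2
    m + 1. *)
Lemma four_squares_odd m : 0 <= m ->
  exists a b c d, 2 * m + 1 = a * a + b * b + c * c + d * d.
Proof.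
  intros Hm. destruct (three_odd_squares Hm) as (x & y & z & Ox & Oy & Oz & E).
  assert (O1 : Z.Odd 1) by now exists 0.
  destruct (odd_four_sum O1 Ox Oy Oz) as (e & h & He & Oh & Hh).
  assert (Oe : Z.Odd (e * 1)) by (destruct He as [-> | ->]; [now exists 0|now exists (-1)]).
  destruct (odd_sub_odd Oh Oe) as (a & Ha), (odd_sub_odd Oh Ox) as (b & Hb),
    (odd_sub_odd Oh Oy) as (c & Hc), (odd_sub_odd Oh Oz) as (d & Hd).
  exists a, b, c, d.
  assert (Ee : (e * 1) * (e * 1) = 1) by (destruct He as [-> | ->]; reflexivity).
  assert (S : 2 * a * (2 * a) + 2 * b * (2 * b) + 2 * c * (2 * c) + 2 * d * (2 * d)
    = 4 * h * h - 2 * h * (e * 1 + x + y + z) + e * 1 * (e * 1) + (x * x + y * y + z * z))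
    by (rewrite <- Ha, <- Hb, <- Hc, <- Hd; ring).
  rewrite Hh, Ee, <- E in S. lia.
Qed.

Lemma four_squares n : 0 <= n -> exists a b c d, n = a * a + b * b + c * c + d * d.
Proof.
  intros Hn. assert (Hn0 := Hn). revert Hn. pattern n. apply Z_lt_induction; [|exact Hn0].
  clear n Hn0. intros n IH Hn.
  destruct (Z.Even_or_Odd n) as [(m & E)|(m & E)].
  - destruct (Z.eq_dec m 0) as [->|Hm]; [exists 0, 0, 0, 0; lia|].
    destruct (IH m (ltac:(lia)) (ltac:(lia))) as (a & b & c & d & Em).
    exists (a + b), (a - b), (c + d), (c - d). lia.
  - rewrite E. apply four_squares_odd. lia.
Qed.

(* [Hur e f g h] stands for the Hurwitz quaternion [e w + f i + g j + h k], [w = (1 + i + j + k) / 2]. *)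
Record hurwitz := Hur { he : Z; hf : Z; hg : Z; hh : Z }.

Definition hnorm (x : hurwitz) : Z :=
  he x * he x + he x * (hf x + hg x + hh x) + hf x * hf x + hg x * hg x + hh x * hh x.

(** The conjugate of w is w - i - j - k. *)
Definition hconj (x : hurwitz) := Hur (he x) (- he x - hf x) (- he x - hg x) (- he x - hh x).

Definition hadd (x y : hurwitz) := Hur (he x + he y) (hf x + hf y) (hg x + hg y) (hh x + hh y).

Definition hscale (c : Z) (x : hurwitz) := Hur (c * he x) (c * hf x) (c * hg x) (c * hh x).

Definition hmul (x y : hurwitz) := Hur
  (- (he x * he y) - he x * hf y - he x * hg y - he x * hh y - hf x * he y - 2 * (hf x * hf y)
    - hg x * he y - 2 * (hg x * hg y) - hh x * he y - 2 * (hh x * hh y))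
  (he x * he y + he x * hf y + he x * hh y + hf x * he y + hf x * hf y + hg x * he y
    + hg x * hg y + hg x * hh y - hh x * hg y + hh x * hh y)
  (he x * he y + he x * hf y + he x * hg y + hf x * hf y - hf x * hh y + hg x * he y
    + hg x * hg y + hh x * he y + hh x * hf y + hh x * hh y)
  (he x * he y + he x * hg y + he x * hh y + hf x * he y + hf x * hf y + hf x * hg y
    - hg x * hf y + hg x * hg y + hh x * he y + hh x * hh y).

Lemma hurwitz_eq x y : he x = he y -> hf x = hf y -> hg x = hg y -> hh x = hh y -> x = y.
Proof. destruct x, y; simpl; congruence. Qed.

Lemma hnorm_mul x y : hnorm (hmul x y) = hnorm x * hnorm y.
Proof. unfold hnorm, hmul; cbn [he hf hg hh]; ring. Qed.

Lemma hnorm_conj x : hnorm (hconj x) = hnorm x.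
Proof. unfold hnorm, hconj; cbn [he hf hg hh]; ring. Qed.

Lemma hnorm_scale c x : hnorm (hscale c x) = c * c * hnorm x.
Proof. unfold hnorm, hscale; cbn [he hf hg hh]; ring. Qed.

Lemma hconj_mul x y : hconj (hmul x y) = hmul (hconj y) (hconj x).
Proof. apply hurwitz_eq; unfold hconj, hmul; cbn [he hf hg hh]; ring. Qed.

Lemma hconjK x : hconj (hconj x) = x.
Proof. apply hurwitz_eq; unfold hconj; cbn [he hf hg hh]; ring. Qed.

Lemma hmul_addr x y z : hmul x (hadd y z) = hadd (hmul x y) (hmul x z).
Proof. apply hurwitz_eq; unfold hmul, hadd; cbn [he hf hg hh]; ring. Qed.

Lemma hmul_conjA x y : hmul (hconj x) (hmul x y) = hscale (hnorm x) y.
Proof. apply hurwitz_eq; unfold hmul, hconj, hnorm, hscale; cbn [he hf hg hh]; ring. Qed.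

Lemma hnorm_quadruple x : 4 * hnorm x = he x * he x + (he x + 2 * hf x) * (he x + 2 * hf x)
  + (he x + 2 * hg x) * (he x + 2 * hg x) + (he x + 2 * hh x) * (he x + 2 * hh x).
Proof. unfold hnorm. ring. Qed.

Lemma hnorm_nonneg x : 0 <= hnorm x.
Proof.
  assert (H := hnorm_quadruple x). assert (S := Z.square_nonneg).
  assert (S1 := S (he x)). assert (S2 := S (he x + 2 * hf x)). assert (S3 := S (he x + 2 * hg x)).
  assert (S4 := S (he x + 2 * hh x)). lia.
Qed.

Lemma square_zero a : a * a = 0 -> a = 0.
Proof. intros H. apply Z.mul_eq_0 in H. tauto. Qed.

Lemma hnorm_zero x : hnorm x = 0 -> x = Hur 0 0 0 0.
Proof.
  intros H0. assert (H := hnorm_quadruple x). assert (S := Z.square_nonneg).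
  assert (S1 := S (he x)). assert (S2 := S (he x + 2 * hf x)). assert (S3 := S (he x + 2 * hg x)).
  assert (S4 := S (he x + 2 * hh x)).
  assert (E1 : he x = 0) by (apply square_zero; lia).
  assert (E2 : he x + 2 * hf x = 0) by (apply square_zero; lia).
  assert (E3 : he x + 2 * hg x = 0) by (apply square_zero; lia).
  assert (E4 : he x + 2 * hh x = 0) by (apply square_zero; lia).
  apply hurwitz_eq; cbn [he hf hg hh]; lia.
Qed.

Lemma rounding l x : 0 < l -> exists q, - l <= 2 * (x - l * q) <= l.
Proof.
  intros Hl. exists ((2 * x + l) / (2 * l)).
  assert (H := Z.div_mod (2 * x + l) (2 * l) (ltac:(lia))).
  assert (H' := Z.mod_pos_bound (2 * x + l) (2 * l) (ltac:(lia))).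
  set (q := (2 * x + l) / (2 * l)) in *. clearbody q. lia.
Qed.

Lemma square_bound l x : - l <= x <= l -> x * x <= l * l.
Proof. intros. nia. Qed.

(** The real coordinate of 2 y' is at most l / 2 and the three others at most l in absolute value,
    so 4 times the norm is at most 13 l^2 / 4 < 4 l^2. The strict inequality drives the descent. *)
Lemma hurwitz_rounding l y : 0 < l -> exists c y', y = hadd y' (hscale l c) /\ hnorm y' < l * l.
Proof.
  intros Hl. destruct (rounding (he y) Hl) as (e & He).
  destruct (rounding (he y - l * e + 2 * (hf y)) (ltac:(lia) : 0 < 2 * l)) as (f & Hf).
  destruct (rounding (he y - l * e + 2 * (hg y)) (ltac:(lia) : 0 < 2 * l)) as (g & Hg).
  destruct (rounding (he y - l * e + 2 * (hh y)) (ltac:(lia) : 0 < 2 * l)) as (h & Hh).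
  exists (Hur e f g h), (Hur (he y - l * e) (hf y - l * f) (hg y - l * g) (hh y - l * h)).
  split; [apply hurwitz_eq; unfold hadd, hscale; cbn [he hf hg hh]; ring|].
  match goal with |- hnorm ?x < _ => assert (H := hnorm_quadruple x) end. cbn [he hf hg hh] in H.
  assert (B1 := @square_bound l (2 * (he y - l * e)) He).
  assert (B2 := @square_bound l (he y - l * e + 2 * (hf y - l * f)) (ltac:(lia))).
  assert (B3 := @square_bound l (he y - l * e + 2 * (hg y - l * g)) (ltac:(lia))).
  assert (B4 := @square_bound l (he y - l * e + 2 * (hh y - l * h)) (ltac:(lia))).
  assert (0 < l * l) by (now apply Z.mul_pos_pos).
  match goal with |- hnorm ?x < _ => set (N := hnorm x) in * end. clearbody N.
  assert (E : 4 * ((he y - l * e) * (he y - l * e)) <= l * l) by lia.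
  clear B1 He Hf Hg Hh. lia.
Qed.

(* Descent: modulo [l] the quaternion may be taken of norm less than [l^2], and then conjugation
   exchanges the roles of [l] and of the smaller cofactor. *)
Theorem hurwitz_factor l : 0 < l -> forall k y, hnorm y = l * k ->
  exists v z, y = hmul (hconj v) z /\ hnorm v = l /\ hnorm z = k.
Proof.
  intros Hl. assert (Hl0 : 0 <= l) by lia. revert Hl. pattern l. apply Z_lt_induction; [|exact Hl0].
  clear l Hl0. intros l IH Hl k y Hy.
  destruct (hurwitz_rounding y Hl) as (c & y' & Ey & Hy').
  assert (N' := @hnorm_nonneg y').
  assert (D : exists k', hnorm y' = l * k').
  { exists (k - (2 * he y' * he c + he y' * (hf c + hg c + hh c) + he c * (hf y' + hg y' + hh y')
       + 2 * (hf y' * hf c + hg y' * hg c + hh y' * hh c)) - l * hnorm c).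
    rewrite !Z.mul_sub_distr_l, <- Hy, Ey. unfold hnorm, hadd, hscale. cbn [he hf hg hh]. ring. }
  destruct D as (k' & Hk').
  assert (Hk0 : 0 <= k' < l) by nia.
  destruct (Z.eq_dec k' 0) as [->|Hk1].
  - rewrite Z.mul_0_r in Hk'. apply hnorm_zero in Hk'. subst y'.
    destruct (@four_squares l (ltac:(lia))) as (a1 & a2 & a3 & a4 & El).
    (* This is a1 + a2 i + a3 j + a4 k, written in the basis w, i, j, k. *)
    set (v := Hur (2 * a1) (a2 - a1) (a3 - a1) (a4 - a1)).
    assert (Hv : hnorm v = l) by (rewrite El; unfold hnorm, v; cbn [he hf hg hh]; ring).
    exists v, (hmul v c). rewrite hmul_conjA, Hv, hnorm_mul, Hv.
    assert (Ey' : y = hscale l c) by (rewrite Ey; apply hurwitz_eq; reflexivity).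
    split; [exact Ey'|]. split; [reflexivity|].
    rewrite Ey', hnorm_scale in Hy. apply (Z.mul_cancel_l _ _ l); lia.
  - destruct (IH k' Hk0 (ltac:(lia)) l (hconj y')) as (u & w & Eu & Hu & Hw).
    { rewrite hnorm_conj. lia. }
    assert (Ey' : y' = hmul (hconj w) u) by (rewrite <- (hconjK y'), Eu, hconj_mul, hconjK; reflexivity).
    exists w, (hadd u (hmul w c)).
    assert (Eyw : y = hmul (hconj w) (hadd u (hmul w c))) by (rewrite hmul_addr, hmul_conjA, Hw, <- Ey'; exact Ey).
    split; [exact Eyw|]. split; [exact Hw|].
    apply (Z.mul_cancel_l _ _ l); [lia|]. rewrite <- Hy, Eyw, hnorm_mul, hnorm_conj, Hw. reflexivity.
Qed.

Definition odd4 a b c d := Z.Odd a /\ Z.Odd b /\ Z.Odd c /\ Z.Odd d.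

Definition odd_pair l k t := exists v1 v2 v3 v4 z1 z2 z3 z4, odd4 v1 v2 v3 v4 /\ odd4 z1 z2 z3 z4 /\
  v1 * v1 + v2 * v2 + v3 * v3 + v4 * v4 = 4 * l /\
  z1 * z1 + z2 * z2 + z3 * z3 + z4 * z4 = 4 * k /\
  v1 * z1 + v2 * z2 + v3 * z3 + v4 * z4 = 2 * t.

(* Reflecting in the all-ones vector (up to a sign) makes [v + z] even, so that the images of [v]
   and [z] have the same parity; it is odd because [v . z = 2 t] is not divisible by 4. *)
Lemma odd_pair_mixed l k t v1 v2 v3 v4 z1 z2 z3 z4 : Z.Odd t -> odd4 v1 v2 v3 v4 ->
  v1 * v1 + v2 * v2 + v3 * v3 + v4 * v4 = 4 * l ->
  4 * (z1 * z1 + z2 * z2 + z3 * z3 + z4 * z4) = 4 * k ->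
  2 * (v1 * z1 + v2 * z2 + v3 * z3 + v4 * z4) = 2 * t -> odd_pair l k t.
Proof.
  intros Ot (O1 & O2 & O3 & O4) Hv Hz Hvz.
  assert (S : forall a b, Z.Odd a -> Z.Odd (a + 2 * b)) by (intros a b (c & ->); exists (c + b); lia).
  destruct (odd_four_sum (S _ z1 O1) (S _ z2 O2) (S _ z3 O3) (S _ z4 O4)) as (e & h & He & Oh & Eh).
  set (b := e * z1 + z2 + z3 + z4). set (a := h - b).
  assert (Ea : e * v1 + v2 + v3 + v4 = 2 * a) by (unfold a, b; lia).
  assert (Ee : e * e = 1) by (destruct He as [-> | ->]; reflexivity).
  assert (Oe : Z.Odd (e * v1)) by (apply odd_product; [destruct He as [-> | ->]; [now exists 0|now exists (-1)]|assumption]).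
  assert (Q : forall p1 p2 p3 p4 q1 q2 q3 q4 s r, e * p1 + p2 + p3 + p4 = 2 * s -> e * q1 + q2 + q3 + q4 = 2 * r ->
    (s - e * p1) * (r - e * q1) + (s - p2) * (r - q2) + (s - p3) * (r - q3) + (s - p4) * (r - q4)
    = p1 * q1 + p2 * q2 + p3 * q3 + p4 * q4).
  { intros p1 p2 p3 p4 q1 q2 q3 q4 s r Ep Eq.
    transitivity (4 * s * r - s * (e * q1 + q2 + q3 + q4) - r * (e * p1 + p2 + p3 + p4)
      + e * e * (p1 * q1) + p2 * q2 + p3 * q3 + p4 * q4); [ring|]. rewrite Ep, Eq, Ee. ring. }
  assert (Eb : e * (2 * z1) + 2 * z2 + 2 * z3 + 2 * z4 = 2 * b) by (unfold b; ring).
  assert (Qv := Q _ _ _ _ _ _ _ _ _ _ Ea Ea). assert (Qz := Q _ _ _ _ _ _ _ _ _ _ Eb Eb).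
  assert (Qvz := Q _ _ _ _ _ _ _ _ _ _ Ea Eb).
  destruct (Z.Even_or_Odd a) as [(i & Ei)|Oa].
  - assert (Ob : Z.Odd b) by (destruct Oh as (j & Oh); exists (j - i); unfold a in Ei; lia).
    exists (a - e * v1), (a - v2), (a - v3), (a - v4), (b - e * (2 * z1)), (b - 2 * z2), (b - 2 * z3), (b - 2 * z4).
    assert (S1 : forall y, Z.Odd y -> Z.Odd (a - y)) by (intros y (j & ->); exists (i - j - 1); lia).
    assert (S2 : forall y, Z.Odd (b - 2 * y)) by (intros y; destruct Ob as (j & ->); exists (j - y); lia).
    unfold odd4. rewrite Qv, Qz, Qvz. repeat split; auto; try lia.
    replace (e * (2 * z1)) with (2 * (e * z1)) by ring. apply S2.
  - exfalso.
    destruct (odd_sub_odd Oa Oe) as (w1 & W1), (odd_sub_odd Oa O2) as (w2 & W2),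
      (odd_sub_odd Oa O3) as (w3 & W3), (odd_sub_odd Oa O4) as (w4 & W4).
    assert (Eb2 : exists j, b = 2 * j) by (destruct Oh as (j & Oh), Oa as (j' & Oa); exists (j - j'); unfold a in Oa; lia).
    destruct Eb2 as (j & Ej). rewrite W1, W2, W3, W4, Ej in Qvz. destruct Ot as (s & Et).
    assert (4 * (w1 * (j - e * z1) + w2 * (j - z2) + w3 * (j - z3) + w4 * (j - z4)) = 2 * (2 * s + 1)).
    { rewrite <- Et, <- Hvz. transitivity (v1 * (2 * z1) + v2 * (2 * z2) + v3 * (2 * z3) + v4 * (2 * z4)); [|ring].
      rewrite <- Qvz. ring. }
    lia.
Qed.

Lemma odd_pair_sym l k t : odd_pair l k t -> odd_pair k l t.
Proof.
  intros (v1 & v2 & v3 & v4 & z1 & z2 & z3 & z4 & Ov & Oz & Hv & Hz & Hvz).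
  exists z1, z2, z3, z4, v1, v2, v3, v4. repeat split; try assumption; try apply Ov; try apply Oz. lia.
Qed.

(** The four coordinates of 2 v have the same parity, and so have those of 2 z. If all eight were
    even, t would be even; one even vector is the mixed case. *)
Lemma odd_pair_of_hurwitz l k t v z : Z.Odd t -> hnorm v = l -> hnorm z = k ->
  he v * he z + (he v + 2 * hf v) * (he z + 2 * hf z) + (he v + 2 * hg v) * (he z + 2 * hg z)
    + (he v + 2 * hh v) * (he z + 2 * hh z) = 2 * t ->
  odd_pair l k t.
Proof.
  intros Ot Hv Hz Hvz.
  assert (Qv := hnorm_quadruple v). assert (Qz := hnorm_quadruple z). rewrite Hv in Qv. rewrite Hz in Qz.
  destruct v as [e f g h], z as [e' f' g' h']. cbn [he hf hg hh] in *. clear Hv Hz.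
  assert (O : forall a, Z.Odd a -> forall b, Z.Odd (a + 2 * b)) by (intros a (c & ->) b; exists (c + b); lia).
  destruct (Z.Even_or_Odd e) as [(i & Ei)|Oe], (Z.Even_or_Odd e') as [(i' & Ei')|Oe'].
  - exfalso. destruct Ot as (s & ->). subst e e'.
    assert (2 * (i * i' + (i + f) * (i' + f') + (i + g) * (i' + g') + (i + h) * (i' + h')) = 2 * s + 1) by lia.
    lia.
  - apply odd_pair_sym. apply (@odd_pair_mixed k l t e' (e' + 2 * f') (e' + 2 * g') (e' + 2 * h')
      i (i + f) (i + g) (i + h)); unfold odd4; subst e; auto; lia.
  - apply (@odd_pair_mixed l k t e (e + 2 * f) (e + 2 * g) (e + 2 * h)
      i' (i' + f') (i' + g') (i' + h')); unfold odd4; subst e'; auto; lia.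
  - exists e, (e + 2 * f), (e + 2 * g), (e + 2 * h), e', (e' + 2 * f'), (e' + 2 * g'), (e' + 2 * h').
    unfold odd4. repeat split; auto; lia.
Qed.

(* [4 l k - t^2] is 3 modulo 8, so [t] is twice the real part of a Hurwitz quaternion of norm [l k]. *)
Theorem odd_pair_exists l k t : 0 < l -> Z.Odd l -> Z.Odd k -> Z.Odd t -> t * t < 4 * l * k ->
  odd_pair l k t.
Proof.
  intros Hl (i & El) (j & Ek) Ot Ht. assert (Ot' := Ot). destruct Ot' as (s & Et).
  assert (Es : exists r, s * (s + 1) = 2 * r).
  { destruct (Z.Even_or_Odd s) as [(r & ->)|(r & ->)]; [exists (r * (2 * r + 1))|exists ((2 * r + 1) * (r + 1))]; ring. }
  destruct Es as (r & Es). set (q := 2 * i * j + i + j - r).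
  assert (Eq : 4 * l * k - t * t = 8 * q + 3) by (unfold q; subst l k t; lia).
  destruct (@three_odd_squares q (ltac:(lia))) as (x & y & z & (a & Ex) & (b & Ey) & (c & Ez) & E).
  set (w := Hur t (a - s) (b - s) (c - s)).
  assert (Hw : hnorm w = l * k).
  { unfold w. assert (Q := hnorm_quadruple (Hur t (a - s) (b - s) (c - s))). cbn [he hf hg hh] in Q.
    replace (t + 2 * (a - s)) with x in Q by lia. replace (t + 2 * (b - s)) with y in Q by lia.
    replace (t + 2 * (c - s)) with z in Q by lia. lia. }
  destruct (hurwitz_factor Hl Hw) as (u & v & Ew & Hu & Hv).
  apply (odd_pair_of_hurwitz Ot Hu Hv).
  (* The coefficient of w is twice the real part, and the real part of conj(u) v is the scalar
     product of u and v. *)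
  assert (E0 : t = he (hmul (hconj u) v)) by (rewrite <- Ew; reflexivity).
  rewrite E0. unfold hmul, hconj. cbn [he hf hg hh]. ring.
Qed.

End Quaternions.

(** * Representations prime to p *)

Section Representations.
Local Open Scope Z_scope.

(* A zero coordinate stands for an absent one. *)
Definition allowed (p x : Z) : Prop := x = 0 \/ ~ (p | x).

Definition good (p n : Z) : Prop := exists a b c d,
  n = a * a + b * b + c * c + d * d /\ allowed p a /\ allowed p b /\ allowed p c /\ allowed p d.

Lemma allowed_small p x : Z.abs x < p -> allowed p x.
Proof.
  intros H. destruct (Z.eq_dec x 0) as [->|N]; [now left|right]. intros D.
  apply Z.divide_abs_r in D. apply Z.divide_pos_le in D; lia.
Qed.

Lemma abs_lt_of_square v p : 0 < p -> v * v < p * p -> Z.abs v < p.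
Proof. intros. nia. Qed.

Lemma good_small p n : 0 < p -> 0 <= n < p * p -> good p n.
Proof.
  intros Hp Hn. destruct (@four_squares n (proj1 Hn)) as (a & b & c & d & E).
  assert (S := Z.square_nonneg). assert (Sa := S a). assert (Sb := S b). assert (Sc := S c). assert (Sd := S d).
  exists a, b, c, d. split; [exact E|].
  repeat split; apply allowed_small, abs_lt_of_square; lia.
Qed.

Lemma combination_not_divisible p t v z x : prime p -> ~ (p | t) -> v <> 0 -> Z.abs v < p ->
  (p | x) -> t * v + p * z <> 2 * x.
Proof.
  intros Pp Ht Hv Hvp (q & ->) E.
  assert (D : (p | t * v)) by (exists (2 * q - z); lia).
  apply prime_mult in D as [D|D]; [contradiction| |assumption].
  apply Z.divide_abs_r, Z.divide_pos_le in D; lia.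
Qed.

Lemma odd_ne0 v : Z.Odd v -> v <> 0.
Proof. intros (i & ->). lia. Qed.

Lemma odd_combination t v p z : Z.Odd t -> Z.Odd v -> Z.Odd p -> Z.Odd z ->
  exists x, t * v + p * z = 2 * x.
Proof.
  intros Ot Ov Op Oz. destruct (odd_product Ot Ov) as (i & ->), (odd_product Op Oz) as (j & ->).
  exists (i + j + 1). lia.
Qed.

(** Here [t] is the multiplier of V and [s] is half the scalar product of V and Z; s^2 < 4 l k says
    that their Gram matrix is positive definite. *)
Lemma odd_good p l k t s : prime p -> Z.Odd p -> Z.Odd l -> Z.Odd k -> Z.Odd t -> Z.Odd s ->
  ~ (p | t) -> 0 < l -> s * s < 4 * l * k -> 4 * l < p * p ->
  good p (t * t * l + t * p * s + p * p * k).
Proof.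
  intros Pp Op Ol Ok Ot Os Ht Hl Hs Hlp. assert (p0 := prime_ge_2 p Pp).
  destruct (odd_pair_exists Hl Ol Ok Os Hs)
    as (v1 & v2 & v3 & v4 & z1 & z2 & z3 & z4 & (V1 & V2 & V3 & V4) & (Z1 & Z2 & Z3 & Z4) & Ev & Ez & Evz).
  destruct (odd_combination Ot V1 Op Z1) as (a & Ea), (odd_combination Ot V2 Op Z2) as (b & Eb),
    (odd_combination Ot V3 Op Z3) as (c & Ec), (odd_combination Ot V4 Op Z4) as (d & Ed).
  exists a, b, c, d. split.
  - assert (E : 4 * (a * a + b * b + c * c + d * d) = t * t * (v1 * v1 + v2 * v2 + v3 * v3 + v4 * v4)
      + 2 * t * p * (v1 * z1 + v2 * z2 + v3 * z3 + v4 * z4) + p * p * (z1 * z1 + z2 * z2 + z3 * z3 + z4 * z4)).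
    { transitivity (2 * a * (2 * a) + 2 * b * (2 * b) + 2 * c * (2 * c) + 2 * d * (2 * d)); [ring|].
      rewrite <- Ea, <- Eb, <- Ec, <- Ed. ring. }
    apply (Z.mul_cancel_l _ _ 4); [discriminate|]. rewrite E, Ev, Ez, Evz. ring.
  - assert (S := Z.square_nonneg). assert (S1 := S v1). assert (S2 := S v2). assert (S3 := S v3). assert (S4 := S v4).
    assert (A : forall v z x, Z.Odd v -> v * v < p * p -> t * v + p * z = 2 * x -> allowed p x).
    { intros v z x Ov Hv E. right. intros D. revert E. apply combination_not_divisible; try assumption.
      - now apply odd_ne0.
      - apply abs_lt_of_square; lia. }
    repeat split; [apply (A v1 z1)|apply (A v2 z2)|apply (A v3 z3)|apply (A v4 z4)]; try assumption; lia.
Qed.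

(** (v + w) / 2 is a nonzero integer, and (v + w)^2 <= 2 (v^2 + w^2) keeps it below p in absolute
    value. *)
Lemma pair_not_divisible p t v w y z x : prime p -> Z.Odd p -> ~ (p | t) -> Z.Odd v -> Z.Odd w ->
  v + w <> 0 -> 2 * (v * v + w * w) < 4 * (p * p) -> t * (v + w) + p * (y + z) = 2 * x -> allowed p x.
Proof.
  intros Pp Op Ht (i & ->) (j & ->) N B E. assert (p0 := prime_ge_2 p Pp). right. intros (q & ->).
  assert (D : (p | 2 * (t * (i + j + 1)))) by (exists (2 * q - (y + z)); lia).
  apply prime_mult in D as [D|D]; [| |assumption].
  - apply Z.divide_pos_le in D; [|lia]. destruct Op. lia.
  - apply prime_mult in D as [D|D]; [contradiction| |assumption].
    assert (Z.abs (i + j + 1) < p).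
    { apply abs_lt_of_square; [lia|]. assert (0 <= (i - j) * (i - j)) by apply Z.square_nonneg. lia. }
    apply Z.divide_abs_r, Z.divide_pos_le in D; lia.
Qed.

Lemma even_good_pairing p l k t s v1 v2 v3 v4 z1 z2 z3 z4 :
  prime p -> Z.Odd p -> Z.Odd t -> ~ (p | t) -> 2 * l < p * p ->
  odd4 v1 v2 v3 v4 -> odd4 z1 z2 z3 z4 ->
  v1 * v1 + v2 * v2 + v3 * v3 + v4 * v4 = 4 * l ->
  z1 * z1 + z2 * z2 + z3 * z3 + z4 * z4 = 4 * k ->
  v1 * z1 + v2 * z2 + v3 * z3 + v4 * z4 = 2 * s ->
  v1 * v1 <> v2 * v2 -> v3 * v3 <> v4 * v4 ->
  good p (2 * (t * t * l + t * p * s + p * p * k)).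
Proof.
  intros Pp Op Ot Ht Hlp (V1 & V2 & V3 & V4) (Z1 & Z2 & Z3 & Z4) Ev Ez Evz N12 N34.
  destruct (odd_combination Ot V1 Op Z1) as (a & Ea), (odd_combination Ot V2 Op Z2) as (b & Eb),
    (odd_combination Ot V3 Op Z3) as (c & Ec), (odd_combination Ot V4 Op Z4) as (d & Ed).
  exists (a + b), (a - b), (c + d), (c - d). split.
  - assert (E : 4 * (a * a + b * b + c * c + d * d) = t * t * (v1 * v1 + v2 * v2 + v3 * v3 + v4 * v4)
      + 2 * t * p * (v1 * z1 + v2 * z2 + v3 * z3 + v4 * z4) + p * p * (z1 * z1 + z2 * z2 + z3 * z3 + z4 * z4)).
    { transitivity (2 * a * (2 * a) + 2 * b * (2 * b) + 2 * c * (2 * c) + 2 * d * (2 * d)); [ring|].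
      rewrite <- Ea, <- Eb, <- Ec, <- Ed. ring. }
    transitivity (2 * (a * a + b * b + c * c + d * d)); [f_equal|ring].
    apply (Z.mul_cancel_l _ _ 4); [discriminate|]. rewrite E, Ev, Ez, Evz. ring.
  - assert (S := Z.square_nonneg). assert (S1 := S v1). assert (S2 := S v2). assert (S3 := S v3). assert (S4 := S v4).
    assert (N : forall v w, v * v <> w * w -> v + w <> 0 /\ v - w <> 0).
    { intros v w H. split; intros H'; apply H; [assert (v = - w) as -> by lia|assert (v = w) as -> by lia]; ring. }
    assert (O : forall v, Z.Odd v -> Z.Odd (- v)) by (intros v (i & ->); exists (- i - 1); lia).
    destruct (N _ _ N12), (N _ _ N34).
    repeat split;
      [apply (@pair_not_divisible p t v1 v2 z1 z2)|apply (@pair_not_divisible p t v1 (- v2) z1 (- z2))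
      |apply (@pair_not_divisible p t v3 v4 z3 z4)|apply (@pair_not_divisible p t v3 (- v4) z3 (- z4))];
      auto; lia.
Qed.

(** Modulo 3 the equation would read b^2 = 2. *)
Lemma not_three_equal l a b r : l = 3 * r + 2 -> 4 * l = 3 * (a * a) + b * b -> False.
Proof.
  intros -> E. assert (H := Z.div_mod b 3 (ltac:(lia))). assert (B := Z.mod_pos_bound b 3 (ltac:(lia))).
  set (q := b / 3) in *. set (i := b mod 3) in *. clearbody q i.
  assert (i = 0 \/ i = 1 \/ i = 2) as [->|[->| ->]] by lia; subst b; lia.
Qed.

(** As no three of the squares are equal, the pairing 13, 24 separates equal squares whenever 12, 34
    does not. *)
Lemma even_good p l k t s r : prime p -> Z.Odd p -> Z.Odd l -> Z.Odd k -> Z.Odd t -> Z.Odd s ->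
  ~ (p | t) -> 0 < l -> s * s < 4 * l * k -> 2 * l < p * p -> l = 3 * r + 2 ->
  good p (2 * (t * t * l + t * p * s + p * p * k)).
Proof.
  intros Pp Op Ol Ok Ot Os Ht Hl Hs Hlp Hr.
  destruct (odd_pair_exists Hl Ol Ok Os Hs)
    as (v1 & v2 & v3 & v4 & z1 & z2 & z3 & z4 & (V1 & V2 & V3 & V4) & (Z1 & Z2 & Z3 & Z4) & Ev & Ez & Evz).
  assert (N : forall a b, 4 * l <> 3 * (a * a) + b * b) by (intros a b E; exact (not_three_equal Hr E)).
  assert (N1 := N v1 v4). assert (N2 := N v1 v3). assert (N3 := N v1 v2). assert (N4 := N v2 v1). clear N.
  destruct (Z.eq_dec (v1 * v1) (v2 * v2)) as [E12|N12].
  - apply (@even_good_pairing p l k t s v1 v3 v2 v4 z1 z3 z2 z4); unfold odd4; auto; lia.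
  - destruct (Z.eq_dec (v3 * v3) (v4 * v4)) as [E34|N34].
    + assert (N5 := not_three_equal (a := v3) (b := v1) Hr). assert (N6 := not_three_equal (a := v3) (b := v2) Hr).
      apply (@even_good_pairing p l k t s v1 v3 v2 v4 z1 z3 z2 z4); unfold odd4; auto; lia.
    + apply (@even_good_pairing p l k t s v1 v2 v3 v4 z1 z2 z3 z4); unfold odd4; auto; lia.
Qed.

Lemma crt M N a b lo : 0 < M -> 0 < N -> Z.gcd M N = 1 ->
  exists x, (M | x - a) /\ (N | x - b) /\ lo <= x < lo + M * N.
Proof.
  intros HM HN G. destruct (Z.gcd_bezout M N 1 G) as (u & v & E).
  set (x0 := a * (v * N) + b * (u * M)).
  assert (H := Z.div_mod (x0 - lo) (M * N) (ltac:(nia))).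
  assert (B := Z.mod_pos_bound (x0 - lo) (M * N) (ltac:(nia))).
  set (q := (x0 - lo) / (M * N)) in *. exists (lo + (x0 - lo) mod (M * N)). split; [|split; [|lia]].
  - exists (b * u - a * u - q * N). assert (x0 - a = (b * u - a * u) * M); [|lia].
    unfold x0. transitivity (a * (u * M + v * N) - a + (b * u - a * u) * M); [ring|]. rewrite E. ring.
  - exists (a * v - b * v - q * M). assert (x0 - b = (a * v - b * v) * N); [|lia].
    unfold x0. transitivity (b * (u * M + v * N) - b + (a * v - b * v) * N); [ring|]. rewrite E. ring.
Qed.

End Representations.

(** * Choice of l, k and the scalar product *)

Section Selection.
Local Open Scope Z_scope.

(** Modulo p, s is determined by t s = (n - t^2 l) / p; a class modulo 2 h can be prescribed as
    well, with |s| <= h p. Then p^2 k >= n - t^2 l - h t p^2, and the last hypothesis yields s^2 < 4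
    l k. With h = 1 only the parity of s is fixed, with h = 3 also its residue modulo 3. *)
Lemma decompose p l t n h c : Z.Odd p -> Z.Odd l -> Z.Odd t -> Z.Odd n -> Z.Odd c ->
  0 < p -> 0 < l -> 0 < t -> 0 < h -> Z.gcd p (2 * h) = 1 -> Z.gcd t p = 1 -> (p | n - t * t * l) ->
  h * h * (p * p * (p * p)) < 4 * l * (n - t * t * l - h * t * (p * p)) ->
  exists k s, Z.Odd k /\ Z.Odd s /\ (2 * h | s - c) /\ s * s < 4 * l * k /\
    n = t * t * l + t * p * s + p * p * k.
Proof.
  intros Op Ol Ot On Oc Hp Hl Ht Hh G1 G2 (q & Eq) B.
  destruct (Z.gcd_bezout t p 1 G2) as (u & v & E).
  destruct (@crt p (2 * h) (q * u) c (- (h * p)) Hp (ltac:(lia)) G1) as (s & (i & Ei) & (j & Ej) & Hs).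
  assert (Os : Z.Odd s) by (destruct Oc as (x & ->); exists (j * h + x); lia).
  set (k := q * v - t * i).
  assert (Ek : q - t * s = p * k).
  { assert (Es : s = i * p + q * u) by lia. rewrite Es. unfold k.
    transitivity (q * (u * t + v * p) - t * (i * p + q * u)); [rewrite E|]; ring. }
  assert (En : n = t * t * l + t * p * s + p * p * k).
  { transitivity (t * t * l + p * (t * s + p * k)); [rewrite <- Ek; lia|ring]. }
  assert (Ok : Z.Odd k).
  { destruct (odd_product (odd_product Ot Ot) Ol) as (a & Ea).
    destruct (odd_product (odd_product Ot Op) Os) as (b & Eb). rewrite Ea, Eb in En.
    destruct On as (x & ->). apply (@odd_factors (p * p)). exists (x - a - b - 1). lia. }
  exists k, s. split; [exact Ok|]. split; [exact Os|]. split; [now exists j|]. split; [|exact En].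
  assert (S1 : s * s <= (h * p) * (h * p)) by (apply square_bound; lia).
  assert (S2 : t * p * s <= t * p * (h * p)).
  { apply Z.mul_le_mono_nonneg_l; [apply Z.mul_nonneg_nonneg|]; lia. }
  assert (S3 : 4 * l * (n - t * t * l - h * t * (p * p)) <= 4 * l * (p * p * k)).
  { apply Z.mul_le_mono_nonneg_l; lia. }
  apply (Z.le_lt_trans _ _ _ S1). apply (Z.mul_lt_mono_pos_l (p * p)); [now apply Z.mul_pos_pos|]. lia.
Qed.

Lemma gcd_prime p t : prime p -> ~ (p | t) -> Z.gcd t p = 1.
Proof.
  intros Pp Ht. rewrite Z.gcd_comm. apply Zgcd_1_rel_prime. now apply prime_rel_prime.
Qed.

Lemma gcd_odd_2 p : Z.Odd p -> Z.gcd p 2 = 1.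
Proof. intros (i & ->). apply Z.bezout_1_gcd. exists 1, (- i). lia. Qed.

Lemma gcd_odd_6 p : prime p -> 3 < p -> Z.Odd p -> Z.gcd p 6 = 1.
Proof.
  intros Pp H3 Op. rewrite Z.gcd_comm. apply gcd_prime; [assumption|]. intros D.
  assert (D' : (p | 2 * 3)) by exact D. apply prime_mult in D' as [D'|D']; [| |assumption];
    apply Z.divide_pos_le in D'; lia.
Qed.

Lemma odd_good_bound p l t n : prime p -> Z.Odd p -> Z.Odd l -> Z.Odd t -> Z.Odd n -> 0 < l -> 0 < t ->
  ~ (p | t) -> (p | n - t * t * l) -> 4 * l < p * p ->
  p * p * (p * p) < 4 * l * (n - t * t * l - t * (p * p)) -> good p n.
Proof.
  intros Pp Op Ol Ot On Hl Ht Hpt D Hlp B. assert (p0 := prime_ge_2 p Pp).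
  destruct (@decompose p l t n 1 1) as (k & s & Ok & Os & _ & Hs & ->); try assumption; try lia.
  - now exists 0.
  - now apply gcd_odd_2.
  - now apply gcd_prime.
  - now apply odd_good.
Qed.

Lemma even_good_bound p l t m r : prime p -> Z.Odd p -> Z.Odd l -> Z.Odd t -> Z.Odd m -> 0 < l -> 0 < t ->
  ~ (p | t) -> (p | m - t * t * l) -> 2 * l < p * p -> l = 3 * r + 2 ->
  p * p * (p * p) < 4 * l * (m - t * t * l - t * (p * p)) -> good p (2 * m).
Proof.
  intros Pp Op Ol Ot On Hl Ht Hpt D Hlp Er B. assert (p0 := prime_ge_2 p Pp).
  destruct (@decompose p l t m 1 1) as (k & s & Ok & Os & _ & Hs & ->); try assumption; try lia.
  - now exists 0.
  - now apply gcd_odd_2.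
  - now apply gcd_prime.
  - now apply (even_good (r := r)).
Qed.

Lemma prime_ndiv_1 p : prime p -> ~ (p | 1).
Proof. intros Pp D. assert (p0 := prime_ge_2 p Pp). apply Z.divide_pos_le in D; lia. Qed.

(** The interval is off centre because l, which is at least 3 p^2 / 20 in both applications, is
    still to be subtracted. Here k = 2 j + 1 is at least 3. *)
Lemma select_level p n : 0 < p -> 19 * (p * p) <= 10 * n ->
  exists j, 1 <= j /\ - 11 * (p * p) <= 10 * (n - p * p * (2 * j + 1)) < 9 * (p * p).
Proof.
  intros Hp H. set (P := p * p) in *. assert (0 < P) by (now apply Z.mul_pos_pos).
  exists ((10 * n + P) / (20 * P)).
  assert (D := Z.div_mod (10 * n + P) (20 * P) (ltac:(lia))).
  assert (B := Z.mod_pos_bound (10 * n + P) (20 * P) (ltac:(lia))).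
  assert (L : 1 <= (10 * n + P) / (20 * P)) by (apply Z.div_le_lower_bound; lia).
  set (q := (10 * n + P) / (20 * P)) in *. set (r := (10 * n + P) mod (20 * P)) in *. clearbody q r. lia.
Qed.

Lemma scaled_abs_le p s a b c : 0 < p -> 0 < c -> - (a * (p * p)) <= c * (p * s) <= b * (p * p) ->
  - (a * p) <= c * s <= b * p.
Proof. intros Hp Hc (H1 & H2). split; apply (Z.mul_le_mono_pos_l _ _ p Hp); lia. Qed.

Lemma select_shift p n l k : Z.Odd p -> Z.Odd n -> Z.Odd l -> Z.Odd k -> (p | n - l) ->
  exists s, Z.Odd s /\ n - l - p * p * k = p * s.
Proof.
  intros Op On Ol Ok (q & Eq). exists (q - p * k). split; [|lia].
  assert (Eq' : q * p = n - l) by lia. destruct On as (a & ->), Ol as (b & ->).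
  destruct (Z.Even_or_Odd q) as [(c & ->)|Oq].
  - destruct (odd_product Op Ok) as (d & ->). exists (c - d - 1). lia.
  - destruct (odd_product Oq Op) as (d & Ed). lia.
Qed.

(** Put P = p^2, 4 P / 25 <= l < P / 4. For n < 1.9 P and k = 1 one has |s| <= 0.74 p, and 0.74^2 <
    16 / 25 gives s^2 < 4 l. For larger n and k >= 3 one has |s| <= 1.35 p, and 1.35^2 < 48 / 25
    gives s^2 < 12 l. *)
Lemma odd_good_large p n : prime p -> 23 <= p -> Z.Odd p -> Z.Odd n -> p * p <= n -> good p n.
Proof.
  intros Pp Hp Op On Hn.
  destruct (@crt p 2 n 1 ((4 * (p * p) + 24) / 25)) as (l & (i & Ei) & (j & Ej) & Hl);
    [lia|lia|now apply gcd_odd_2|].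
  assert (P23 : 23 * p <= p * p) by (apply Z.mul_le_mono_nonneg_r; lia).
  assert (L1 : 4 * (p * p) <= 25 * l /\ 4 * l < p * p).
  { assert (D := Z.div_mod (4 * (p * p) + 24) 25 (ltac:(lia))).
    assert (B := Z.mod_pos_bound (4 * (p * p) + 24) 25 (ltac:(lia))).
    set (x := (4 * (p * p) + 24) / 25) in *. set (y := (4 * (p * p) + 24) mod 25) in *. clearbody x y. lia. }
  destruct L1 as (L1 & L2).
  assert (Ol : Z.Odd l) by (exists j; lia).
  assert (Dl : (p | n - l)) by (exists (- i); lia).
  assert (K : exists k s, Z.Odd k /\ Z.Odd s /\ s * s < 4 * l * k /\ n - l - p * p * k = p * s).
  { destruct (Z_lt_ge_dec (10 * n) (19 * (p * p))) as [H|H].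
    - assert (O1 : Z.Odd 1) by now exists 0.
      destruct (select_shift Op On Ol O1 Dl) as (s & Os & Es).
      exists 1, s. repeat split; auto.
      assert (S : - (74 * p) <= 100 * s <= 74 * p) by (apply scaled_abs_le; lia).
      assert (Q := square_bound S). lia.
    - destruct (@select_level p n (ltac:(lia)) (ltac:(lia))) as (a & Ha & Hk).
      assert (Ok : Z.Odd (2 * a + 1)) by now exists a.
      destruct (select_shift Op On Ol Ok Dl) as (s & Os & Es).
      exists (2 * a + 1), s. repeat split; auto.
      assert (S : - (135 * p) <= 100 * s <= 74 * p) by (apply scaled_abs_le; lia).
      assert (Q := @square_bound (135 * p) (100 * s) (ltac:(lia))).
      assert (12 * l <= 4 * l * (2 * a + 1)) by nia. lia. }
  destruct K as (k & s & Ok & Os & Hs & E).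
  replace n with (1 * 1 * l + 1 * p * s + p * p * k) by lia.
  apply odd_good; auto; [now exists 0|now apply prime_ndiv_1|lia].
Qed.

(** Now l = 5 modulo 6, and m may be as small as p^2 / 2, so for k = 1 the difference m - l - p^2
    can be as low as - (p^2 / 2 + l). The wider window for l leaves room for this. *)
Lemma even_good_large p m : prime p -> 19 <= p -> Z.Odd p -> Z.Odd m -> p * p <= 2 * m -> good p (2 * m).
Proof.
  intros Pp Hp Op Om Hm.
  destruct (@crt p 6 m 5 ((3 * (p * p) + 19) / 20)) as (l & (i & Ei) & (j & Ej) & Hl);
    [lia|lia|apply gcd_odd_6; [assumption|lia|assumption]|].
  assert (P19 : 19 * p <= p * p) by (apply Z.mul_le_mono_nonneg_r; lia).
  assert (L1 : 3 * (p * p) <= 20 * l /\ 2 * l < p * p).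
  { assert (D := Z.div_mod (3 * (p * p) + 19) 20 (ltac:(lia))).
    assert (B := Z.mod_pos_bound (3 * (p * p) + 19) 20 (ltac:(lia))).
    set (x := (3 * (p * p) + 19) / 20) in *. set (y := (3 * (p * p) + 19) mod 20) in *. clearbody x y. lia. }
  destruct L1 as (L1 & L2).
  assert (Ol : Z.Odd l) by (exists (3 * j + 2); lia).
  assert (Dl : (p | m - l)) by (exists (- i); lia).
  assert (P0 : 0 < p * p) by lia.
  (* The inequalities needed state that convex quadratic polynomials in l are negative on the
     window; the product of the distances to its two ends supplies the term in l^2. *)
  assert (C : 0 <= (20 * l - 3 * (p * p)) * (p * p - 2 * l)) by (apply Z.mul_nonneg_nonneg; lia).
  assert (K : exists k s, Z.Odd k /\ Z.Odd s /\ s * s < 4 * l * k /\ m - l - p * p * k = p * s).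
  { destruct (Z_lt_ge_dec (10 * m) (19 * (p * p))) as [H|H].
    - assert (O1 : Z.Odd 1) by now exists 0.
      destruct (select_shift Op Om Ol O1 Dl) as (s & Os & Es).
      exists 1, s. repeat split; auto.
      apply (Z.mul_lt_mono_pos_l (p * p)); [exact P0|].
      replace (p * p * (s * s)) with (p * s * (p * s)) by ring. set (P := p * p) in *. set (d := p * s) in *.
      assert (T : 0 <= P * (20 * l - 3 * P)) by (apply Z.mul_nonneg_nonneg; lia).
      assert (T' : 0 < P * P) by (now apply Z.mul_pos_pos).
      clearbody P d.
      destruct (Z_lt_ge_dec d 0) as [Hd|Hd].
      + assert (Q := @square_bound (P + 2 * l) (2 * d) (ltac:(lia))). lia.
      + assert (Q := @square_bound (75 * P) (100 * d) (ltac:(lia))). lia.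
    - destruct (@select_level p m (ltac:(lia)) (ltac:(lia))) as (a & Ha & Hk).
      assert (Ok : Z.Odd (2 * a + 1)) by now exists a.
      destruct (select_shift Op Om Ol Ok Dl) as (s & Os & Es).
      exists (2 * a + 1), s. repeat split; auto.
      apply (Z.mul_lt_mono_pos_l (p * p)); [exact P0|].
      replace (p * p * (s * s)) with (p * s * (p * s)) by ring.
      assert (S1 : 12 * l * (p * p) <= p * p * (4 * l * (2 * a + 1))).
      { rewrite (Z.mul_comm (12 * l)). apply Z.mul_le_mono_nonneg_l; [lia|]. nia. }
      set (P := p * p) in *. set (d := p * s) in *.
      assert (T : 0 <= P * (20 * l - 3 * P)) by (apply Z.mul_nonneg_nonneg; lia).
      assert (T' : 0 < P * P) by (now apply Z.mul_pos_pos).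
      set (R := P * (4 * l * (2 * a + 1))) in *. set (W := P * (2 * a + 1)) in *.
      clearbody P d R W.
      assert (Q := @square_bound (11 * P + 10 * l) (10 * d) (ltac:(lia))). lia. }
  destruct K as (k & s & Ok & Os & Hs & E).
  replace m with (1 * 1 * l + 1 * p * s + p * p * k) by lia.
  apply (even_good (r := 2 * j + 1)); auto; [now exists 0|now apply prime_ndiv_1|lia|lia].
Qed.

End Selection.

(** * The primes 5 and 7 *)

Section FiveSeven.
Local Open Scope Z_scope.

(** Both vectors are reflected in the all-ones vector, up to signs that make the half-sum of v odd.
    Then v becomes 2 u, and the image of z is odd since otherwise t would be even. *)
Lemma odd_pair_even_odd l k t : Z.Odd t -> odd_pair l k t ->
  exists u1 u2 u3 u4 z1 z2 z3 z4, odd4 z1 z2 z3 z4 /\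
  u1 * u1 + u2 * u2 + u3 * u3 + u4 * u4 = l /\
  z1 * z1 + z2 * z2 + z3 * z3 + z4 * z4 = 4 * k /\
  u1 * z1 + u2 * z2 + u3 * z3 + u4 * z4 = t.
Proof.
  intros Ot (v1 & v2 & v3 & v4 & z1 & z2 & z3 & z4 & (V1 & V2 & V3 & V4) & (Z1 & Z2 & Z3 & Z4) & Ev & Ez & Evz).
  destruct (odd_four_sum V1 V2 V3 V4) as (e & a & He & Oa & Ea).
  assert (Ee : e * e = 1) by (destruct He as [-> | ->]; reflexivity).
  assert (Oe : Z.Odd e) by (destruct He as [-> | ->]; [now exists 0|now exists (-1)]).
  destruct (odd_sub_odd Oa (odd_product Oe V1)) as (u1 & U1), (odd_sub_odd Oa V2) as (u2 & U2),
    (odd_sub_odd Oa V3) as (u3 & U3), (odd_sub_odd Oa V4) as (u4 & U4).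
  assert (Hb : exists b, e * z1 + z2 + z3 + z4 = 2 * b).
  { destruct (odd_product Oe Z1) as (i1 & ->), Z2 as (i2 & ->), Z3 as (i3 & ->), Z4 as (i4 & ->).
    exists (i1 + i2 + i3 + i4 + 2). lia. }
  destruct Hb as (b & Eb).
  assert (Q : forall p1 p2 p3 p4 q1 q2 q3 q4 s r, e * p1 + p2 + p3 + p4 = 2 * s -> e * q1 + q2 + q3 + q4 = 2 * r ->
    (s - e * p1) * (r - e * q1) + (s - p2) * (r - q2) + (s - p3) * (r - q3) + (s - p4) * (r - q4)
    = p1 * q1 + p2 * q2 + p3 * q3 + p4 * q4).
  { intros p1 p2 p3 p4 q1 q2 q3 q4 s r Ep Eq.
    transitivity (4 * s * r - s * (e * q1 + q2 + q3 + q4) - r * (e * p1 + p2 + p3 + p4)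
      + e * e * (p1 * q1) + p2 * q2 + p3 * q3 + p4 * q4); [ring|]. rewrite Ep, Eq, Ee. ring. }
  assert (Qv := Q _ _ _ _ _ _ _ _ _ _ Ea Ea). assert (Qz := Q _ _ _ _ _ _ _ _ _ _ Eb Eb).
  assert (Qvz := Q _ _ _ _ _ _ _ _ _ _ Ea Eb). clear Q.
  rewrite U1, U2, U3, U4, Ev in Qv. rewrite U1, U2, U3, U4, Evz in Qvz. rewrite Ez in Qz.
  exists u1, u2, u3, u4, (b - e * z1), (b - z2), (b - z3), (b - z4).
  split; [|split; [lia|split; [assumption|]]].
  - destruct (Z.Even_or_Odd b) as [(i & Ei)|Ob].
    + assert (S : forall y, Z.Odd y -> Z.Odd (b - y)) by (intros y (j & ->); exists (i - j - 1); lia).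
      unfold odd4. auto using odd_product.
    + exfalso.
      destruct (odd_sub_odd Ob (odd_product Oe Z1)) as (w1 & W1), (odd_sub_odd Ob Z2) as (w2 & W2),
        (odd_sub_odd Ob Z3) as (w3 & W3), (odd_sub_odd Ob Z4) as (w4 & W4).
      rewrite W1, W2, W3, W4 in Qvz. destruct Ot as (s & ->).
      assert (2 * (u1 * w1 + u2 * w2 + u3 * w3 + u4 * w4) = 2 * s + 1) by lia. lia.
  - apply (Z.mul_cancel_l _ _ 2); [discriminate|]. rewrite <- Qvz. ring.
Qed.

Lemma square_values u : u * u <= 8 -> u = 0 \/ u = 1 \/ u = -1 \/ u = 2 \/ u = -2.
Proof. intros. assert (-3 < u < 3) by nia. lia. Qed.

Lemma odd_sign e y : e = 1 \/ e = -1 -> Z.Odd y -> exists z, Z.Odd z /\ z * z = y * y /\ z = e * y.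
Proof. intros [-> | ->] (i & Ei); [exists y|exists (- y)]; repeat split; try lia; [exists i|exists (- i - 1)]; lia. Qed.

(** 7 = 4 + 1 + 1 + 1 is its only expression by four squares, so permutations and signs, transferred
    to z, turn u into (1, 1, 1, 2). *)
Lemma seven_vector k t : Z.Odd t -> odd_pair 7 k t -> exists z1 z2 z3 z4, odd4 z1 z2 z3 z4 /\
  z1 * z1 + z2 * z2 + z3 * z3 + z4 * z4 = 4 * k /\ z1 + z2 + z3 + 2 * z4 = t.
Proof.
  intros Ot H.
  destruct (odd_pair_even_odd Ot H)
    as (u1 & u2 & u3 & u4 & z1 & z2 & z3 & z4 & (Z1 & Z2 & Z3 & Z4) & Eu & Ez & Euz).
  assert (S := Z.square_nonneg). assert (S1 := S u1). assert (S2 := S u2). assert (S3 := S u3). assert (S4 := S u4).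
  assert (W : forall a b c d y1 y2 y3 y4, odd4 y1 y2 y3 y4 -> y1 * y1 + y2 * y2 + y3 * y3 + y4 * y4 = 4 * k ->
    a * y1 + b * y2 + c * y3 + d * y4 = t ->
    (a = 1 \/ a = -1) -> (b = 1 \/ b = -1) -> (c = 1 \/ c = -1) -> (d = 2 \/ d = -2) ->
    exists z1 z2 z3 z4, odd4 z1 z2 z3 z4 /\
    z1 * z1 + z2 * z2 + z3 * z3 + z4 * z4 = 4 * k /\ z1 + z2 + z3 + 2 * z4 = t).
  { intros a b c d y1 y2 y3 y4 (O1 & O2 & O3 & O4) Ey Ed Ha Hb Hc Hd.
    assert (Hd' : exists e, (e = 1 \/ e = -1) /\ d = 2 * e) by (destruct Hd as [-> | ->]; [exists 1|exists (-1)]; lia).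
    destruct Hd' as (e & He & ->).
    destruct (odd_sign Ha O1) as (x1 & P1 & Q1 & R1), (odd_sign Hb O2) as (x2 & P2 & Q2 & R2),
      (odd_sign Hc O3) as (x3 & P3 & Q3 & R3), (odd_sign He O4) as (x4 & P4 & Q4 & R4).
    exists x1, x2, x3, x4. unfold odd4. repeat split; auto; lia. }
  destruct (@square_values u1 (ltac:(lia))) as [E1|[E1|[E1|[E1|E1]]]],
    (@square_values u2 (ltac:(lia))) as [E2|[E2|[E2|[E2|E2]]]]; try (exfalso; subst u1 u2; lia);
  destruct (@square_values u3 (ltac:(lia))) as [E3|[E3|[E3|[E3|E3]]]]; try (exfalso; subst u1 u2 u3; lia);
  destruct (@square_values u4 (ltac:(lia))) as [E4|[E4|[E4|[E4|E4]]]]; try (exfalso; subst u1 u2 u3 u4; lia);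
  first [solve [apply (W u1 u2 u3 u4 z1 z2 z3 z4); unfold odd4; auto; lia]
    |solve [apply (W u1 u2 u4 u3 z1 z2 z4 z3); unfold odd4; auto; lia]
    |solve [apply (W u1 u4 u3 u2 z1 z4 z3 z2); unfold odd4; auto; lia]
    |solve [apply (W u4 u2 u3 u1 z4 z2 z3 z1); unfold odd4; auto; lia]].
Qed.

(** Likewise 3 = 1 + 1 + 1 + 0 is the only possibility for u. *)
Lemma three_vector k t : Z.Odd t -> odd_pair 3 k t -> exists z1 z2 z3 z4, odd4 z1 z2 z3 z4 /\
  z1 * z1 + z2 * z2 + z3 * z3 + z4 * z4 = 4 * k /\ z1 + z2 + z3 = t.
Proof.
  intros Ot H.
  destruct (odd_pair_even_odd Ot H)
    as (u1 & u2 & u3 & u4 & z1 & z2 & z3 & z4 & (Z1 & Z2 & Z3 & Z4) & Eu & Ez & Euz).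
  assert (S := Z.square_nonneg). assert (S1 := S u1). assert (S2 := S u2). assert (S3 := S u3). assert (S4 := S u4).
  assert (W : forall a b c y1 y2 y3 y4, odd4 y1 y2 y3 y4 -> y1 * y1 + y2 * y2 + y3 * y3 + y4 * y4 = 4 * k ->
    a * y1 + b * y2 + c * y3 = t ->
    (a = 1 \/ a = -1) -> (b = 1 \/ b = -1) -> (c = 1 \/ c = -1) ->
    exists z1 z2 z3 z4, odd4 z1 z2 z3 z4 /\
    z1 * z1 + z2 * z2 + z3 * z3 + z4 * z4 = 4 * k /\ z1 + z2 + z3 = t).
  { intros a b c y1 y2 y3 y4 (O1 & O2 & O3 & O4) Ey Ed Ha Hb Hc.
    destruct (odd_sign Ha O1) as (x1 & P1 & Q1 & R1), (odd_sign Hb O2) as (x2 & P2 & Q2 & R2),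
      (odd_sign Hc O3) as (x3 & P3 & Q3 & R3).
    exists x1, x2, x3, y4. unfold odd4. repeat split; auto; lia. }
  destruct (@square_values u1 (ltac:(lia))) as [E1|[E1|[E1|[E1|E1]]]]; try (exfalso; subst u1; lia);
  destruct (@square_values u2 (ltac:(lia))) as [E2|[E2|[E2|[E2|E2]]]]; try (exfalso; subst u1 u2; lia);
  destruct (@square_values u3 (ltac:(lia))) as [E3|[E3|[E3|[E3|E3]]]]; try (exfalso; subst u1 u2 u3; lia);
  destruct (@square_values u4 (ltac:(lia))) as [E4|[E4|[E4|[E4|E4]]]]; try (exfalso; subst u1 u2 u3 u4; lia);
  first [solve [apply (W u1 u2 u3 z1 z2 z3 z4); unfold odd4; auto; subst; lia]
    |solve [apply (W u1 u2 u4 z1 z2 z4 z3); unfold odd4; auto; subst; lia]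
    |solve [apply (W u1 u4 u3 z1 z4 z3 z2); unfold odd4; auto; subst; lia]
    |solve [apply (W u4 u2 u3 z4 z2 z3 z1); unfold odd4; auto; subst; lia]].
Qed.

Lemma residue3 x : exists q, x = 3 * q \/ x = 3 * q + 1 \/ x = 3 * q - 1.
Proof.
  exists ((x + 1) / 3). assert (H := Z.div_mod (x + 1) 3 (ltac:(lia))).
  assert (B := Z.mod_pos_bound (x + 1) 3 (ltac:(lia))). lia.
Qed.

(** The halves of y1 + y2, y1 - y2, y3 + y4, y3 - y4 have square sum 2 m. *)
Lemma good_quarter p m y1 y2 y3 y4 : odd4 y1 y2 y3 y4 -> y1 * y1 + y2 * y2 + y3 * y3 + y4 * y4 = 4 * m ->
  ~ (p | y1 + y2) -> ~ (p | y1 - y2) -> ~ (p | y3 + y4) -> ~ (p | y3 - y4) -> good p (2 * m).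
Proof.
  intros ((a & ->) & (b & ->) & (c & ->) & (d & ->)) E N1 N2 N3 N4.
  exists (a + b + 1), (a - b), (c + d + 1), (c - d). split; [lia|].
  assert (A : forall x y, ~ (p | y) -> y = 2 * x -> allowed p x).
  { intros x y H ->. right. intros (q & ->). apply H. exists (2 * q). ring. }
  repeat split; [apply (A _ _ N1)|apply (A _ _ N2)|apply (A _ _ N3)|apply (A _ _ N4)]; lia.
Qed.

Lemma reflect3 y s : Z.Odd y -> Z.Odd (y - 2 * s) /\ Z.Odd (y + 2 * s).
Proof. intros (i & ->). split; [exists (i - s)|exists (i + s)]; lia. Qed.

(* Reflecting in a vector [w] of norm 3 turns [2 t (1, 1, 1, 2)] into a vector which modulo 5 is a
   multiple of [(0, 0, 1, 1)]; similarly in the next two lemmas. *)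
Lemma good5_seven m t z1 z2 z3 z4 s : t = 1 \/ t = 3 -> odd4 z1 z2 z3 z4 ->
  let y1 := 2 * t + 5 * z1 in let y2 := 2 * t + 5 * z2 in
  let y3 := 2 * t + 5 * z3 in let y4 := 4 * t + 5 * z4 in
  y1 * y1 + y2 * y2 + y3 * y3 + y4 * y4 = 4 * m -> y1 + y2 + y4 = 3 * s -> good 5 (2 * m).
Proof.
  intros Ht ((a & ->) & (b & ->) & (c & ->) & (d & ->)) y1 y2 y3 y4 E Hs.
  assert (O : odd4 y1 y2 y3 y4).
  { unfold odd4, y1, y2, y3, y4, Z.Odd.
    repeat split; [exists (t + 5 * a + 2)|exists (t + 5 * b + 2)|exists (t + 5 * c + 2)|exists (2 * t + 5 * d + 2)]; lia. }
  destruct O as (O1 & O2 & O3 & O4).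
  apply (@good_quarter 5 m (y1 - 2 * s) y3 (y2 - 2 * s) (y4 - 2 * s)).
  - unfold odd4. repeat split; try apply reflect3; assumption.
  - transitivity (y1 * y1 + y2 * y2 + y3 * y3 + y4 * y4 - 4 * s * (y1 + y2 + y4 - 3 * s)); [ring|]. rewrite Hs. lia.
  - intros (q & Q). unfold y1, y2, y3, y4 in *. lia.
  - intros (q & Q). unfold y1, y2, y3, y4 in *. lia.
  - intros (q & Q). unfold y1, y2, y3, y4 in *. lia.
  - intros (q & Q). unfold y1, y2, y3, y4 in *. lia.
Qed.

Lemma good5_three m t z1 z2 z3 z4 s : t = 1 \/ t = 3 -> odd4 z1 z2 z3 z4 ->
  let y1 := 2 * t + 5 * z1 in let y2 := 2 * t + 5 * z2 in
  let y3 := 2 * t + 5 * z3 in let y4 := 5 * z4 in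
  y1 * y1 + y2 * y2 + y3 * y3 + y4 * y4 = 4 * m -> y1 - y2 + y3 = 3 * s -> good 5 (2 * m).
Proof.
  intros Ht ((a & ->) & (b & ->) & (c & ->) & (d & ->)) y1 y2 y3 y4 E Hs.
  assert (O : odd4 y1 y2 y3 y4).
  { unfold odd4, y1, y2, y3, y4, Z.Odd.
    repeat split; [exists (t + 5 * a + 2)|exists (t + 5 * b + 2)|exists (t + 5 * c + 2)|exists (5 * d + 2)]; lia. }
  destruct O as (O1 & O2 & O3 & O4).
  apply (@good_quarter 5 m (y1 - 2 * s) (y2 + 2 * s) (y3 - 2 * s) y4).
  - unfold odd4. repeat split; try apply reflect3; assumption.
  - transitivity (y1 * y1 + y2 * y2 + y3 * y3 + y4 * y4 - 4 * s * (y1 - y2 + y3 - 3 * s)); [ring|]. rewrite Hs. lia.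
  - intros (q & Q). unfold y1, y2, y3, y4 in *. lia.
  - intros (q & Q). unfold y1, y2, y3, y4 in *. lia.
  - intros (q & Q). unfold y1, y2, y3, y4 in *. lia.
  - intros (q & Q). unfold y1, y2, y3, y4 in *. lia.
Qed.

Lemma good7_seven m z1 z2 z3 z4 s : odd4 z1 z2 z3 z4 ->
  let y1 := 2 + 7 * z1 in let y2 := 2 + 7 * z2 in
  let y3 := 2 + 7 * z3 in let y4 := 4 + 7 * z4 in
  y1 * y1 + y2 * y2 + y3 * y3 + y4 * y4 = 4 * m -> y1 - y2 + y4 = 3 * s -> good 7 (2 * m).
Proof.
  intros ((a & ->) & (b & ->) & (c & ->) & (d & ->)) y1 y2 y3 y4 E Hs.
  assert (O : odd4 y1 y2 y3 y4).
  { unfold odd4, y1, y2, y3, y4, Z.Odd.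
    repeat split; [exists (7 * a + 4)|exists (7 * b + 4)|exists (7 * c + 4)|exists (7 * d + 5)]; lia. }
  destruct O as (O1 & O2 & O3 & O4).
  apply (@good_quarter 7 m (y1 - 2 * s) (y2 + 2 * s) y3 (y4 - 2 * s)).
  - unfold odd4. repeat split; try apply reflect3; assumption.
  - transitivity (y1 * y1 + y2 * y2 + y3 * y3 + y4 * y4 - 4 * s * (y1 - y2 + y4 - 3 * s)); [ring|]. rewrite Hs. lia.
  - intros (q & Q). unfold y1, y2, y3, y4 in *. lia.
  - intros (q & Q). unfold y1, y2, y3, y4 in *. lia.
  - intros (q & Q). unfold y1, y2, y3, y4 in *. lia.
  - intros (q & Q). unfold y1, y2, y3, y4 in *. lia.
Qed.

End FiveSeven.

(** * Residues modulo 3 that make the reflections integral *)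

Section FiveSevenSelection.
Local Open Scope Z_scope.

Lemma sum_div3 x y z a b c : (a = -1 \/ a = 0 \/ a = 1) -> (b = -1 \/ b = 0 \/ b = 1) ->
  (c = -1 \/ c = 0 \/ c = 1) -> (a = b /\ b = c \/ a + b + c = 0) ->
  exists s, 3 * x + a + (3 * y + b) + (3 * z + c) = 3 * s.
Proof.
  intros Ha Hb Hc H. assert (a + b + c = -3 \/ a + b + c = 0 \/ a + b + c = 3) as [E|[E|E]] by lia;
  [exists (x + y + z - 1)|exists (x + y + z)|exists (x + y + z + 1)]; lia.
Qed.

Lemma residue3' x : exists q r, (r = -1 \/ r = 0 \/ r = 1) /\ x = 3 * q + r.
Proof.
  destruct (residue3 x) as (q & [->|[->| ->]]); [exists q, 0|exists q, 1|exists q, (-1)]; split; lia.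
Qed.

(** A reflection in w of norm 3 is integral when 3 divides y . w, and modulo 3 the sum of squares
    counts the coordinates prime to 3. The case m = 2 modulo 3 is out of reach for every h: (1, 1,
    0, 0), its negative and (1, 0, 0, 1) are counterexamples with h = 2, 1, 0. *)
Lemma mod3_choice_seven y1 y2 y3 y4 m h :
  y1 * y1 + y2 * y2 + y3 * y3 + y4 * y4 = 4 * m -> y1 + y2 + y3 + 2 * y4 = h ->
  (exists a b, m = 3 * a + 1 /\ h = 3 * b) \/ (exists a b, m = 3 * a /\ (h = 3 * b + 1 \/ h = 3 * b + 2)) ->
  exists s, y1 + y2 + y4 = 3 * s \/ y1 + y3 + y4 = 3 * s \/ y2 + y3 + y4 = 3 * s.
Proof.
  intros E L H.
  destruct (residue3' y1) as (q1 & a & Ha & ->), (residue3' y2) as (q2 & b & Hb & ->),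
    (residue3' y3) as (q3 & c & Hc & ->), (residue3' y4) as (q4 & d & Hd & ->).
  assert (C : (a = b /\ b = d \/ a + b + d = 0) \/ (a = c /\ c = d \/ a + c + d = 0) \/ (b = c /\ c = d \/ b + c + d = 0)).
  { assert (E' : exists u, a * a + b * b + c * c + d * d = m + 3 * u).
    { exists (m - 3 * (q1 * q1 + q2 * q2 + q3 * q3 + q4 * q4) - 2 * (q1 * a + q2 * b + q3 * c + q4 * d)). lia. }
    destruct E' as (u & E'). clear E.
    assert (Hm : exists v e f, (e = 1 /\ f = 0 \/ e = 0 /\ (f = 1 \/ f = 2)) /\
      a * a + b * b + c * c + d * d = 3 * v + e /\ exists w, a + b + c + 2 * d = 3 * w + f).
    { destruct H as [(i & j & -> & Hh)|(i & j & -> & [Hh|Hh])];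
        [exists (u + i), 1, 0|exists (u + i), 0, 1|exists (u + i), 0, 2];
        (split; [lia|split; [lia|exists (j - q1 - q2 - q3 - 2 * q4); lia]]). }
    clear E' L H u. destruct Hm as (v & e & f & Hef & E & w & L).
    destruct Ha as [->|[->| ->]], Hb as [->|[->| ->]], Hc as [->|[->| ->]], Hd as [->|[->| ->]]; lia. }
  clear E L. destruct C as [C|[C|C]].
  - destruct (sum_div3 q1 q2 q4 Ha Hb Hd C) as (s & Hs). exists s. lia.
  - destruct (sum_div3 q1 q3 q4 Ha Hc Hd C) as (s & Hs). exists s. lia.
  - destruct (sum_div3 q2 q3 q4 Hb Hc Hd C) as (s & Hs). exists s. lia.
Qed.

(** Exactly two coordinates are prime to 3. As y1 + y2 + y3 is divisible by 3, they are two of the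
    first three and opposite modulo 3. *)
Lemma mod3_choice_three y1 y2 y3 y4 m :
  y1 * y1 + y2 * y2 + y3 * y3 + y4 * y4 = 4 * m -> (exists h, y1 + y2 + y3 = 3 * h) ->
  (exists a, m = 3 * a + 2) ->
  exists s, y1 - y2 + y3 = 3 * s \/ y2 - y1 + y3 = 3 * s \/ y1 - y3 + y2 = 3 * s.
Proof.
  intros E (h & L) (i & ->).
  destruct (residue3' y1) as (q1 & a & Ha & ->), (residue3' y2) as (q2 & b & Hb & ->),
    (residue3' y3) as (q3 & c & Hc & ->), (residue3' y4) as (q4 & d & Hd & ->).
  assert (C : (b = 0 /\ a + c = 0) \/ (a = 0 /\ b + c = 0) \/ (c = 0 /\ a + b = 0)).
  { assert (E' : exists u, a * a + b * b + c * c + d * d = 3 * u + 2).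
    { exists (4 * i + 2 - 3 * (q1 * q1 + q2 * q2 + q3 * q3 + q4 * q4) - 2 * (q1 * a + q2 * b + q3 * c + q4 * d)). lia. }
    destruct E' as (u & E'). clear E.
    assert (L' : exists w, a + b + c = 3 * w) by (exists (h - q1 - q2 - q3); lia).
    clear L. destruct L' as (w & L).
    destruct Ha as [->|[->| ->]], Hb as [->|[->| ->]], Hc as [->|[->| ->]], Hd as [->|[->| ->]]; lia. }
  clear E L. destruct C as [C|[C|C]].
  - exists (q1 - q2 + q3). lia.
  - exists (q2 - q1 + q3). lia.
  - exists (q1 - q3 + q2). lia.
Qed.

(** For p = 7 the mirror vectors are (1, -1, 0, 1) and its permutations fixing the last coordinate;
    these also serve m = 2 modulo 3. *)
Lemma mod3_choice_seven' y1 y2 y3 y4 m h :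
  y1 * y1 + y2 * y2 + y3 * y3 + y4 * y4 = 4 * m -> y1 + y2 + y3 + 2 * y4 = h ->
  (exists a b, m = 3 * a + 1 /\ h = 3 * b) \/
  (exists a b, (m = 3 * a \/ m = 3 * a + 2) /\ (h = 3 * b + 1 \/ h = 3 * b + 2)) ->
  exists s, y1 - y2 + y4 = 3 * s \/ y2 - y1 + y4 = 3 * s \/ y1 - y3 + y4 = 3 * s
    \/ y3 - y1 + y4 = 3 * s \/ y2 - y3 + y4 = 3 * s \/ y3 - y2 + y4 = 3 * s.
Proof.
  intros E L H.
  destruct (residue3' y1) as (q1 & a & Ha & ->), (residue3' y2) as (q2 & b & Hb & ->),
    (residue3' y3) as (q3 & c & Hc & ->), (residue3' y4) as (q4 & d & Hd & ->).
  assert (C : exists r, a - b + d = 3 * r \/ b - a + d = 3 * r \/ a - c + d = 3 * r \/ c - a + d = 3 * r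
    \/ b - c + d = 3 * r \/ c - b + d = 3 * r).
  { assert (E' : exists u, a * a + b * b + c * c + d * d = m + 3 * u).
    { exists (m - 3 * (q1 * q1 + q2 * q2 + q3 * q3 + q4 * q4) - 2 * (q1 * a + q2 * b + q3 * c + q4 * d)). lia. }
    destruct E' as (u & E'). clear E.
    assert (Hm : exists v e f, (e = 1 /\ f = 0 \/ (e = 0 \/ e = 2) /\ (f = 1 \/ f = 2)) /\
      a * a + b * b + c * c + d * d = 3 * v + e /\ exists w, a + b + c + 2 * d = 3 * w + f).
    { destruct H as [(i & j & -> & Hh)|(i & j & [-> | ->] & [Hh|Hh])];
        [exists (u + i), 1, 0|exists (u + i), 0, 1|exists (u + i), 0, 2|exists (u + i), 2, 1|exists (u + i), 2, 2];
        (split; [lia|split; [lia|exists (j - q1 - q2 - q3 - 2 * q4); lia]]). }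
    clear E' L H u. destruct Hm as (v & e & f & Hef & E & w & L).
    destruct Ha as [->|[->| ->]], Hb as [->|[->| ->]], Hc as [->|[->| ->]], Hd as [->|[->| ->]];
      first [exists 0; lia|exists 1; lia|exists (-1); lia]. }
  clear E L H Ha Hb Hc Hd. destruct C as (r & [C|[C|[C|[C|[C|C]]]]]).
  - exists (q1 - q2 + q4 + r). lia.
  - exists (q2 - q1 + q4 + r). lia.
  - exists (q1 - q3 + q4 + r). lia.
  - exists (q3 - q1 + q4 + r). lia.
  - exists (q2 - q3 + q4 + r). lia.
  - exists (q3 - q2 + q4 + r). lia.
Qed.

Lemma prime_5' : prime 5.
Proof.
  apply prime_intro; [lia|]. intros n Hn. apply Zgcd_1_rel_prime.
  assert (n = 1 \/ n = 2 \/ n = 3 \/ n = 4) as [->|[->|[->| ->]]] by lia; reflexivity.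
Qed.

Lemma odd_le3 t : t = 1 \/ t = 3 -> Z.Odd t.
Proof. intros [-> | ->]; [now exists 0|now exists 1]. Qed.

(** The class of s modulo 6 puts y1 + y2 + y3 + 2 y4 = 14 t + 5 s in the residue class modulo 3 that
    the choice of the mirror requires. The bound is that of [decompose] in the worst case t = 3:
    5625 < 28 (m - 63 - 225). *)
Lemma even_good5_seven m t : t = 1 \/ t = 3 -> Z.Odd m -> (5 | m - t * t * 7) -> ~ (exists a, m = 3 * a + 2) ->
  500 < m -> good 5 (2 * m).
Proof.
  intros Ht Om D N B.
  assert (Hc : exists c, Z.Odd c /\ ((exists a, m = 3 * a + 1) /\ (exists b, 2 * t * 7 + 5 * c = 3 * b)
    \/ (exists a, m = 3 * a) /\ (exists b, 2 * t * 7 + 5 * c = 3 * b + 1 \/ 2 * t * 7 + 5 * c = 3 * b + 2))).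
  { destruct (residue3 m) as (a & [E|[E|E]]).
    - exists 1. split; [now exists 0|]. right. split; [now exists a|].
      destruct Ht as [-> | ->]; [exists 6|exists 15]; lia.
    - destruct Ht as [-> | ->].
      + exists 5. split; [now exists 2|]. left. split; [now exists a|]. exists 13. lia.
      + exists 3. split; [now exists 1|]. left. split; [now exists a|]. exists 19. lia.
    - exfalso. apply N. exists (a - 1). lia. }
  destruct Hc as (c & Oc & Hc).
  destruct (@decompose 5 7 t m 3 c) as (k & s & Ok & Os & (j & Ej) & Hs & Em); auto using odd_le3;
    try lia; try reflexivity; [now exists 2|now exists 3|destruct Ht as [-> | ->]; reflexivity|].
  destruct (@seven_vector k s Os) as (z1 & z2 & z3 & z4 & (O1 & O2 & O3 & O4) & Ez & Eu).
  { apply odd_pair_exists; auto; [lia|now exists 3]. }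
  assert (Q : (2 * t + 5 * z1) * (2 * t + 5 * z1) + (2 * t + 5 * z2) * (2 * t + 5 * z2)
    + (2 * t + 5 * z3) * (2 * t + 5 * z3) + (4 * t + 5 * z4) * (4 * t + 5 * z4) = 4 * m).
  { transitivity (28 * (t * t) + 20 * t * (z1 + z2 + z3 + 2 * z4) + 25 * (z1 * z1 + z2 * z2 + z3 * z3 + z4 * z4));
      [ring|]. rewrite Ez, Eu, Em. ring. }
  destruct (mod3_choice_seven Q (h := 2 * t * 7 + 5 * s)) as (r & [R|[R|R]]).
  - lia.
  - assert (Es : s = j * (2 * 3) + c) by lia.
    destruct Hc as [((a & Ha) & (b & Hb))|((a & Ha) & (b & Hb))]; [left|right]; exists a, (b + 10 * j); lia.
  - apply (@good5_seven m t z1 z2 z3 z4 r); unfold odd4; auto.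
  - apply (@good5_seven m t z1 z3 z2 z4 r); unfold odd4; auto; lia.
  - apply (@good5_seven m t z2 z3 z1 z4 r); unfold odd4; auto; lia.
Qed.

(** Taking s = 3 modulo 6 makes y1 + y2 + y3 = 6 t + 5 s divisible by 3. The worst case t = 3 of the
    bound is 5625 < 12 (m - 27 - 225). *)
Lemma even_good5_three m t : t = 1 \/ t = 3 -> Z.Odd m -> (5 | m - t * t * 3) -> (exists a, m = 3 * a + 2) ->
  750 < m -> good 5 (2 * m).
Proof.
  intros Ht Om D N B.
  destruct (@decompose 5 3 t m 3 3) as (k & s & Ok & Os & (j & Ej) & Hs & Em); auto using odd_le3;
    try lia; try reflexivity; [now exists 2|destruct Ht as [-> | ->]; reflexivity|].
  destruct (@three_vector k s Os) as (z1 & z2 & z3 & z4 & (O1 & O2 & O3 & O4) & Ez & Eu).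
  { apply odd_pair_exists; auto; [lia|now exists 1]. }
  assert (Q : (2 * t + 5 * z1) * (2 * t + 5 * z1) + (2 * t + 5 * z2) * (2 * t + 5 * z2)
    + (2 * t + 5 * z3) * (2 * t + 5 * z3) + (5 * z4) * (5 * z4) = 4 * m).
  { transitivity (12 * (t * t) + 20 * t * (z1 + z2 + z3) + 25 * (z1 * z1 + z2 * z2 + z3 * z3 + z4 * z4));
      [ring|]. rewrite Ez, Eu, Em. ring. }
  destruct (mod3_choice_three Q) as (r & [R|[R|R]]).
  - exists (2 * t + 10 * j + 5). lia.
  - exact N.
  - apply (@good5_three m t z1 z2 z3 z4 r); unfold odd4; auto.
  - apply (@good5_three m t z2 z1 z3 z4 r); unfold odd4; auto; lia.
  - apply (@good5_three m t z1 z3 z2 z4 r); unfold odd4; auto; lia.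
Qed.

(** The same method with t = 1; the bound is 21609 < 28 (m - 7 - 147). *)
Lemma even_good7_seven m : Z.Odd m -> (7 | m) -> 930 < m -> good 7 (2 * m).
Proof.
  intros Om (q & D) B.
  assert (Hc : exists c, Z.Odd c /\ ((exists a, m = 3 * a + 1) /\ (exists b, 2 * 7 + 7 * c = 3 * b)
    \/ (exists a, m = 3 * a \/ m = 3 * a + 2) /\ (exists b, 2 * 7 + 7 * c = 3 * b + 1 \/ 2 * 7 + 7 * c = 3 * b + 2))).
  { destruct (residue3 m) as (a & [E|[E|E]]).
    - exists 3. split; [now exists 1|]. right. split; [exists a; lia|]. exists 11; lia.
    - exists 1. split; [now exists 0|]. left. split; [exists a; lia|]. exists 7; lia.
    - exists 3. split; [now exists 1|]. right. split; [exists (a - 1); lia|]. exists 11; lia. }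
  destruct Hc as (c & Oc & Hc).
  destruct (@decompose 7 7 1 m 3 c) as (k & s & Ok & Os & (j & Ej) & Hs & Em); auto;
    try lia; try reflexivity; [now exists 3|now exists 3|now exists 0|exists (q - 1); lia|].
  destruct (@seven_vector k s Os) as (z1 & z2 & z3 & z4 & (O1 & O2 & O3 & O4) & Ez & Eu).
  { apply odd_pair_exists; auto; [lia|now exists 3]. }
  assert (Q : (2 + 7 * z1) * (2 + 7 * z1) + (2 + 7 * z2) * (2 + 7 * z2)
    + (2 + 7 * z3) * (2 + 7 * z3) + (4 + 7 * z4) * (4 + 7 * z4) = 4 * m).
  { transitivity (28 + 28 * (z1 + z2 + z3 + 2 * z4) + 49 * (z1 * z1 + z2 * z2 + z3 * z3 + z4 * z4));
      [ring|]. rewrite Ez, Eu, Em. ring. }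
  destruct (mod3_choice_seven' Q (h := 2 * 7 + 7 * s)) as (r & [R|[R|[R|[R|[R|R]]]]]).
  - lia.
  - assert (Es : s = j * (2 * 3) + c) by lia.
    destruct Hc as [((a & Ha) & (b & Hb))|((a & Ha) & (b & Hb))]; [left|right]; exists a, (b + 14 * j); lia.
  - apply (@good7_seven m z1 z2 z3 z4 r); unfold odd4; auto.
  - apply (@good7_seven m z2 z1 z3 z4 r); unfold odd4; auto; lia.
  - apply (@good7_seven m z1 z3 z2 z4 r); unfold odd4; auto; lia.
  - apply (@good7_seven m z3 z1 z2 z4 r); unfold odd4; auto; lia.
  - apply (@good7_seven m z2 z3 z1 z4 r); unfold odd4; auto; lia.
  - apply (@good7_seven m z3 z2 z1 z4 r); unfold odd4; auto; lia.
Qed.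

End FiveSevenSelection.

(** * Small primes *)

Section SmallPrimes.
Local Open Scope Z_scope.

Definition allowedb (p x : Z) : bool := ((x =? 0) || negb (x mod p =? 0))%bool.

Lemma allowedbP p x : 0 < p -> allowedb p x = true -> allowed p x.
Proof.
  unfold allowedb. rewrite Bool.orb_true_iff, Bool.negb_true_iff, Z.eqb_eq, Z.eqb_neq.
  intros Hp [H|H]; [now left|right]. intros D. apply H. apply Z.mod_divide; [lia|assumption].
Qed.

Definition allowed_pairs (p N : Z) : list (Z * Z) :=
  filter (fun w => fst w * fst w + snd w * snd w <=? N)
    (dsum (filter (allowedb p) (zrange 0 (Z.sqrt N + 1))) (fun x => filter (allowedb p) (zrange 0 (x + 1)))).

(** Keys are sums of two squares plus 1, because keys are positive and the sum 0 occurs. *)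
Definition pair_table (l : list (Z * Z)) : PositiveMap.t (Z * Z) :=
  fold_right (fun w t => PositiveMap.add (Z.to_pos (fst w * fst w + snd w * snd w + 1)) w t)
    (PositiveMap.empty _) l.

(** The pair found is tested again, so soundness does not depend on the contents of the table. *)
Definition represented (p : Z) (l : list (Z * Z)) (t : PositiveMap.t (Z * Z)) (n : Z) : bool :=
  existsb (fun w => let r := n - fst w * fst w - snd w * snd w in
    if r <? 0 then false else
    match PositiveMap.find (Z.to_pos (r + 1)) t with
    | Some v => (r =? fst v * fst v + snd v * snd v) && allowedb p (fst w) && allowedb p (snd w)
        && allowedb p (fst v) && allowedb p (snd v)
    | None => false
    end)%bool l.

Lemma representedP p l t n : 0 < p -> represented p l t n = true -> good p n.
Proof.
  intros Hp H. apply existsb_exists in H as ((x & y) & _ & H). cbn [fst snd] in H. cbv zeta in H.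
  destruct (_ <? 0); [discriminate|].
  destruct (PositiveMap.find _ t) as [(u & v)|]; [|discriminate].
  rewrite !Bool.andb_true_iff, Z.eqb_eq in H. destruct H as ((((E & H1) & H2) & H3) & H4). cbn [fst snd] in *.
  exists x, y, u, v. split; [lia|]. auto using allowedbP.
Qed.

Definition all_represented (p N : Z) (ns : list Z) : bool :=
  let l := allowed_pairs p N in let t := pair_table l in forallb (represented p l t) ns.

Lemma all_representedP p N ns n : 0 < p -> all_represented p N ns = true -> In n ns -> good p n.
Proof.
  intros Hp H Hn. unfold all_represented in H. cbv zeta in H. rewrite forallb_forall in H.
  exact (representedP Hp (H n Hn)).
Qed.

Definition odd_range (a b : Z) : list Z := filter Z.odd (zrange a b).

Lemma In_odd_range a b n : Z.Odd n -> a <= n < b -> In n (odd_range a b).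
Proof. intros O H. apply filter_In. split; [now apply enum_zrange|now apply Z.odd_spec]. Qed.

(* [B] is a lower bound for [n] above which the choice [(t, l)] works in the class [r] modulo [p]. *)
Definition odd_candidate (p B r : Z) (w : Z * Z) : bool :=
  (let '(t, l) := w in
  ((r - t * t * l) mod p =? 0) && Z.odd t && Z.odd l && (0 <? t) && (0 <? l) && negb (t mod p =? 0)
  && (4 * l <? p * p) && (p * p * (p * p) <? 4 * l * (B - t * t * l - t * (p * p))))%bool.

Lemma odd_candidateP p B n w : prime p -> Z.Odd p -> Z.Odd n -> B <= n ->
  odd_candidate p B (n mod p) w = true -> good p n.
Proof.
  intros Pp Op On Hn H. assert (p0 := prime_ge_2 p Pp). destruct w as (t, l). unfold odd_candidate in H.
  rewrite !Bool.andb_true_iff, Bool.negb_true_iff, Z.eqb_neq, Z.eqb_eq, !Z.ltb_lt, !Z.odd_spec in H.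
  destruct H as (((((((D & Ot) & Ol) & Ht) & Hl) & N) & H4) & H).
  apply (@odd_good_bound p l t n); auto.
  - intros D'. apply N. apply Z.mod_divide; [lia|assumption].
  - rewrite Zminus_mod_idemp_l in D. apply Z.mod_divide; [lia|assumption].
  - assert (4 * l * B <= 4 * l * n) by (apply Z.mul_le_mono_nonneg_l; lia). lia.
Qed.

Definition even_candidate (p B r : Z) (w : Z * Z) : bool :=
  (let '(t, l) := w in
  ((r - t * t * l) mod p =? 0) && Z.odd t && Z.odd l && (0 <? t) && (0 <? l) && negb (t mod p =? 0)
  && (2 * l <? p * p) && (l mod 3 =? 2) && (p * p * (p * p) <? 4 * l * (B - t * t * l - t * (p * p))))%bool.

Lemma even_candidateP p B m w : prime p -> Z.Odd p -> Z.Odd m -> B <= m ->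
  even_candidate p B (m mod p) w = true -> good p (2 * m).
Proof.
  intros Pp Op Om Hm H. assert (p0 := prime_ge_2 p Pp). destruct w as (t, l). unfold even_candidate in H.
  rewrite !Bool.andb_true_iff, Bool.negb_true_iff, Z.eqb_neq, !Z.eqb_eq, !Z.ltb_lt, !Z.odd_spec in H.
  destruct H as ((((((((D & Ot) & Ol) & Ht) & Hl) & N) & H4) & H3) & H).
  apply (@even_good_bound p l t m (l / 3)); auto.
  - intros D'. apply N. apply Z.mod_divide; [lia|assumption].
  - rewrite Zminus_mod_idemp_l in D. apply Z.mod_divide; [lia|assumption].
  - rewrite <- H3. apply Z.div_mod. discriminate.
  - assert (4 * l * B <= 4 * l * m) by (apply Z.mul_le_mono_nonneg_l; lia). lia.
Qed.

Definition candidates (a b : Z) : list (Z * Z) := dsum [1; 3] (fun _ => odd_range a b).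

(** Lagrange's theorem covers n < p^2 and the residue table covers n >= B; the last premise is the
    finite gap between them. *)
Lemma good_odd_by_table p B a b n : prime p -> Z.Odd p -> Z.Odd n -> 0 < n ->
  forallb (fun r => existsb (odd_candidate p B r) (candidates a b)) (zrange 0 p) = true ->
  (n < B -> p * p <= n -> good p n) -> good p n.
Proof.
  intros Pp Op On Hn T S. assert (p0 := prime_ge_2 p Pp).
  destruct (Z_lt_ge_dec n (p * p)) as [H|H]; [apply good_small; lia|].
  destruct (Z_lt_ge_dec n B) as [H'|H']; [apply S; lia|].
  rewrite forallb_forall in T.
  assert (R : In (n mod p) (zrange 0 p)) by (apply enum_zrange, Z.mod_pos_bound; lia).
  apply T in R. apply existsb_exists in R as (w & _ & R). apply (odd_candidateP (B := B) (w := w)); auto; lia.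
Qed.

Lemma good_even_by_table p B a b m : prime p -> Z.Odd p -> Z.Odd m -> B <= m ->
  existsb (even_candidate p B (m mod p)) (candidates a b) = true -> good p (2 * m).
Proof.
  intros Pp Op Om Hm R. apply existsb_exists in R as (w & _ & R). apply (even_candidateP (B := B) (w := w)); auto; lia.
Qed.

Lemma brute_even p B m : 0 < p -> Z.Odd m -> 0 < m < B ->
  all_represented p (2 * B) (map (Z.mul 2) (odd_range 1 B)) = true -> good p (2 * m).
Proof.
  intros Hp Om Hm H. apply (all_representedP Hp H). apply in_map. apply In_odd_range; [assumption|lia].
Qed.

Lemma good_odd_table p B a b n : prime p -> Z.Odd p -> Z.Odd n -> 0 < n ->
  forallb (fun r => existsb (odd_candidate p B r) (candidates a b)) (zrange 0 p) = true ->
  all_represented p B (odd_range (p * p) B) = true -> good p n.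
Proof.
  intros Pp Op On Hn T R. assert (p0 := prime_ge_2 p Pp). apply (good_odd_by_table Pp Op On Hn T).
  intros H1 H2. apply (fun H => all_representedP H R); [lia|]. now apply In_odd_range.
Qed.

Lemma good_even_table p B a b m : prime p -> Z.Odd p -> Z.Odd m -> 0 < m ->
  forallb (fun r => existsb (even_candidate p B r) (candidates a b)) (zrange 0 p) = true ->
  all_represented p (2 * B) (map (Z.mul 2) (odd_range 1 B)) = true -> good p (2 * m).
Proof.
  intros Pp Op Om Hm T R. assert (p0 := prime_ge_2 p Pp).
  destruct (Z_lt_ge_dec m B) as [H|H]; [apply (brute_even (B := B)); auto; lia|].
  rewrite forallb_forall in T. apply (good_even_by_table (B := B) (a := a) (b := b)); auto; [lia|].
  apply T, enum_zrange, Z.mod_pos_bound. lia.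
Qed.

Lemma small_primes p : prime p -> 5 <= p < 23 -> p = 5 \/ p = 7 \/ p = 11 \/ p = 13 \/ p = 17 \/ p = 19.
Proof.
  intros Pp Hp.
  assert (D : forall d q, 1 < d < p -> p <> d * q).
  { intros d q Hd E. assert (Dv : (d | p)) by (exists q; lia).
    apply prime_divisors in Dv as [|[|[|]]]; [lia|lia|lia|lia|assumption]. }
  assert (D2 := fun q => D 2 q (ltac:(lia))). assert (D3 := fun q => D 3 q (ltac:(lia))).
  assert (p <> 6 /\ p <> 8 /\ p <> 9 /\ p <> 10 /\ p <> 12 /\ p <> 14 /\ p <> 15 /\ p <> 16 /\ p <> 18 /\ p <> 20
    /\ p <> 21 /\ p <> 22); [|lia].
  assert (A := D2 3). assert (A1 := D2 4). assert (A2 := D2 5). assert (A3 := D2 6). assert (A4 := D2 7).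
  assert (A5 := D2 8). assert (A6 := D2 9). assert (A7 := D2 10). assert (A8 := D2 11).
  assert (A9 := D3 3). assert (A10 := D3 5). assert (A11 := D3 7). lia.
Qed.

Lemma prime_odd p : prime p -> 2 < p -> Z.Odd p.
Proof.
  intros Pp Hp. destruct (Z.Even_or_Odd p) as [(q & E)|]; [exfalso|assumption].
  assert (Dv : (2 | p)) by (exists q; lia).
  apply prime_divisors in Dv as [|[|[|]]]; [lia|lia|lia|lia|assumption].
Qed.

Lemma good5_odd n : Z.Odd n -> 0 < n -> n <> 79 -> good 5 n.
Proof.
  intros On Hn N. assert (P5 := prime_5'). assert (O5 : Z.Odd 5) by now exists 2.
  (* The largest threshold belongs to n = 4 modulo 5, where t = 3 and l = 1 require 625 < 4 (n - 9 -
     75). *)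
  apply (good_odd_by_table (B := 242) (a := 1) (b := 7)); try assumption; [now vm_compute|]. intros H1 H2.
  assert (R : all_represented 5 242 (filter (fun n => negb (n =? 79)) (odd_range 1 242)) = true) by now vm_compute.
  apply (fun H => all_representedP H R); [lia|]. apply filter_In. split; [apply In_odd_range; [assumption|lia]|].
  apply Bool.negb_true_iff, Z.eqb_neq, N.
Qed.

Lemma odd_good_all p n : prime p -> 5 <= p -> Z.Odd n -> 0 < n -> ~ (p = 5 /\ n = 79) -> good p n.
Proof.
  intros Pp Hp On Hn N. assert (Op := prime_odd Pp (ltac:(lia))).
  destruct (Z_lt_ge_dec p 23) as [H|H].
  - destruct (small_primes Pp (conj Hp H)) as [->|[->|[->|[->|[->| ->]]]]].
    + apply good5_odd; auto.
    + apply (good_odd_table (B := 375) (a := 1) (b := 13)); try assumption; now vm_compute.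
    + apply (good_odd_table (B := 537) (a := 9) (b := 31)); try assumption; now vm_compute.
    + apply (good_odd_table (B := 607) (a := 17) (b := 43)); try assumption; now vm_compute.
    + apply (good_odd_table (B := 865) (a := 39) (b := 73)); try assumption; now vm_compute.
    + apply (good_odd_table (B := 1030) (a := 53) (b := 91)); try assumption; now vm_compute.
  - destruct (Z_lt_ge_dec n (p * p)) as [H'|H']; [apply good_small; lia|]. apply odd_good_large; auto; lia.
Qed.

(** The table with l = 5 and l = 11 serves the classes 0, 1, 4. For the classes 2 and 3 the vector
    of norm l = 7 is used, or l = 3 when m = 2 modulo 3; as 7 = 2 and 3 = -2 modulo 5, the two
    values of l take opposite t^2, so 1 and 3 are exchanged. *)
Lemma good5_even m : Z.Odd m -> 0 < m -> good 5 (2 * m).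
Proof.
  intros Om Hm. assert (P5 := prime_5'). assert (O5 : Z.Odd 5) by now exists 2.
  destruct (Z_lt_ge_dec m 752) as [H|H].
  - apply (brute_even (B := 752)); try assumption; [lia|lia|now vm_compute].
  - assert (B := Z.mod_pos_bound m 5 (ltac:(lia))). assert (D := Z.div_mod m 5 (ltac:(lia))).
    assert (T : forall r, m mod 5 = r -> existsb (even_candidate 5 200 r) (candidates 5 12) = true -> good 5 (2 * m)).
    { intros r E R. subst r. apply (good_even_by_table (B := 200) (a := 5) (b := 12)); try assumption; lia. }
    assert (S : forall t, t = 1 \/ t = 3 -> (5 | m - t * t * 2) -> m mod 5 = 2 \/ m mod 5 = 3 -> good 5 (2 * m)).
    { intros t Ht (q & Hq) _. destruct (classic (exists a, m = 3 * a + 2)) as [H3|H3].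
      - assert (Ht' : exists t', (t' = 1 \/ t' = 3) /\ (5 | m - t' * t' * 3)).
        { destruct Ht as [-> | ->]; [exists 3|exists 1]; (split; [lia|]); [exists (q - 5)|exists (q + 3)]; lia. }
        destruct Ht' as (t' & Ht' & D'). apply (even_good5_three Ht'); auto; lia.
      - apply (even_good5_seven Ht); auto; [exists (q - t * t); lia|lia]. }
    assert (C : m mod 5 = 0 \/ m mod 5 = 1 \/ m mod 5 = 2 \/ m mod 5 = 3 \/ m mod 5 = 4) by lia.
    destruct C as [C|[C|[C|[C|C]]]].
    + apply (T _ C). now vm_compute.
    + apply (T _ C). now vm_compute.
    + apply (S 1); [lia|exists (m / 5); lia|lia].
    + apply (S 3); [lia|exists (m / 5 - 3); lia|lia].
    + apply (T _ C). now vm_compute.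
Qed.

Lemma good7_even m : prime 7 -> Z.Odd m -> 0 < m -> good 7 (2 * m).
Proof.
  intros P7 Om Hm. assert (O7 : Z.Odd 7) by now exists 3.
  destruct (Z_lt_ge_dec m 932) as [H|H].
  - apply (brute_even (B := 932)); try assumption; [lia|lia|now vm_compute].
  - destruct (Z.eq_dec (m mod 7) 0) as [E|E].
    + apply even_good7_seven; [assumption|apply Z.mod_divide; [lia|assumption]|lia].
    + apply (good_even_by_table (B := 336) (a := 5) (b := 25)); try assumption; [lia|].
      assert (T : forallb (fun r => existsb (even_candidate 7 336 r) (candidates 5 25)) (zrange 1 7) = true) by now vm_compute.
      rewrite forallb_forall in T. apply T, enum_zrange. assert (B := Z.mod_pos_bound m 7 (ltac:(lia))). lia.
Qed.

Lemma even_good_all p m : prime p -> 5 <= p -> Z.Odd m -> 0 < m -> good p (2 * m).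
Proof.
  intros Pp Hp Om Hm. assert (Op := prime_odd Pp (ltac:(lia))).
  destruct (Z_lt_ge_dec p 23) as [H|H].
  - destruct (small_primes Pp (conj Hp H)) as [->|[->|[->|[->|[->| ->]]]]].
    + now apply good5_even.
    + now apply good7_even.
    + apply (good_even_table (B := 860) (a := 5) (b := 60)); try assumption; now vm_compute.
    + apply (good_even_table (B := 830) (a := 11) (b := 84)); try assumption; now vm_compute.
    + apply (good_even_table (B := 781) (a := 47) (b := 144)); try assumption; now vm_compute.
    + destruct (Z_lt_ge_dec (2 * m) (19 * 19)) as [H'|H']; [apply good_small; lia|]. apply even_good_large; auto; lia.
  - destruct (Z_lt_ge_dec (2 * m) (p * p)) as [H'|H']; [apply good_small; lia|]. apply even_good_large; auto; lia.
Qed.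

Lemma good_quadruple p n : prime p -> 2 < p -> good p n -> good p (4 * n).
Proof.
  intros Pp Hp (a & b & c & d & E & A1 & A2 & A3 & A4). exists (2 * a), (2 * b), (2 * c), (2 * d).
  split; [lia|].
  assert (A : forall x, allowed p x -> allowed p (2 * x)).
  { intros x [->|N]; [now left|right]. intros D. apply prime_mult in D as [D|D]; [|contradiction|assumption].
    apply Z.divide_pos_le in D; lia. }
  auto.
Qed.

Theorem good_all p n : prime p -> 5 <= p -> 0 < n -> ~ (p = 5 /\ n = 79) -> good p n.
Proof.
  intros Pp Hp Hn. assert (Hn0 : 0 <= n) by lia. revert Hn. pattern n. apply Z_lt_induction; [|exact Hn0].
  clear n Hn0. intros n IH Hn N. destruct (Z.Even_or_Odd n) as [(m & E)|On]; [|now apply odd_good_all].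
  rewrite E. destruct (Z.Even_or_Odd m) as [(n' & E')|Om]; [|apply even_good_all; auto; lia].
  replace (2 * m) with (4 * n') by lia.
  (* Since 79 is exceptional for p = 5, its quadruple 316 cannot come from doubling and is checked
     directly. *)
  destruct (classic (p = 5 /\ n' = 79)) as [(-> & ->)|N'].
  - apply (fun H => @all_representedP 5 316 [316] 316 H); [lia|now vm_compute|now left].
  - apply good_quadruple; [assumption|lia|]. apply IH; auto; lia.
Qed.

End SmallPrimes.

(** * Passage to natural numbers *)

Section NaturalNumbers.

Lemma prime_of_nat (p : nat) : (1 < p)%nat -> (forall d, Nat.divide d p -> d = 1%nat \/ d = p) ->
  prime (Z.of_nat p).
Proof.
  intros Hp H. apply prime_alt. split; [lia|]. intros n Hn (q & Hq).
  assert (0 < q)%Z by nia.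
  destruct (H (Z.to_nat n)) as [E|E]; [|lia|lia].
  exists (Z.to_nat q). nia.
Qed.

Lemma good_nat (p n : nat) : prime (Z.of_nat p) -> (5 <= p)%nat -> (0 < n)%nat -> ~ (p = 5 /\ n = 79)%nat ->
  exists a b c d : nat, n = (a * a + (b * b + (c * c + d * d)))%nat /\
    forall x, In x [a; b; c; d] -> x = 0%nat \/ ~ Nat.divide p x.
Proof.
  intros Pp Hp Hn N.
  destruct (@good_all (Z.of_nat p) (Z.of_nat n) Pp (ltac:(lia)) (ltac:(lia)) (ltac:(lia)))
    as (a & b & c & d & E & A).
  exists (Z.abs_nat a), (Z.abs_nat b), (Z.abs_nat c), (Z.abs_nat d). split.
  - apply Nat2Z.inj. rewrite E, !Nat2Z.inj_add, !Nat2Z.inj_mul, !Zabs2Nat.id_abs, !Z.abs_square. ring.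
  - assert (B : forall y, allowed (Z.of_nat p) y -> Z.abs_nat y = 0%nat \/ ~ Nat.divide p (Z.abs_nat y)).
    { intros y [->|H]; [now left|right]. intros (q & Hq). apply H. apply Z.divide_abs_r. exists (Z.of_nat q). lia. }
    intros x [<-|[<-|[<-|[<-|[]]]]]; apply B; tauto.
Qed.

End NaturalNumbers.

(* The statement over [int] *)
From mathcomp Require Import all_boot all_order all_algebra zify.
Set Implicit Arguments.
Unset Strict Implicit.
Unset Printing Implicit Defensive.
Import Order.TTheory GRing.Theory Num.Theory.
Local Open Scope ring_scope.

Lemma gcdz_prod_eq1 (p k : nat) (x : 'I_k -> int) : prime p ->
  (gcdz p%:Z (\prod_(i < k) x i) = 1) <-> (forall i, ~~ (p %| `|x i|)%N).
Proof.
move=> pp; rewrite /gcdz (big_morph absz abszM absz1).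
have -> : (gcdn `|p%:Z| (\prod_(i < k) `|x i|)%N)%:Z = 1 <->
  coprime p (\prod_(i < k) `|x i|)%N by split=> [[/eqP]|/eqP ->].
rewrite prime_coprime // Euclid_dvd_prod // big_orE negb_exists.
by split=> [/forallP|? ]; [|apply/forallP].
Qed.

Lemma prime_Z (p : nat) : prime p -> Znumtheory.prime (Z.of_nat p).
Proof.
move=> pp; apply: prime_of_nat; first exact/ssrnat.ltP/prime_gt1.
move=> d [q Eq]; have /primeP[_ /(_ d)] := pp.
have -> : (d %| p)%N by apply/dvdnP; exists q.
by case/(_ isT)/orP=> /eqP; [left|right].
Qed.

Lemma sum_of_squares_of_seq (p : nat) (s : seq nat) : prime p -> all (fun a => ~~ (p %| a)%N) s ->
  sum_of_squares_not_div p (size s) (\sum_(a <- s) a * a)%N%:Z.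
Proof.
move=> pp /all_nthP hs; exists (fun i : 'I_(size s) => (nth 0%N s i)%:Z); split.
  rewrite (big_nth 0%N) big_mkord (big_morph Posz PoszD erefl).
  by apply: eq_bigr => i _; rewrite expr2 PoszM.
apply/gcdz_prod_eq1 => // i; exact: hs.
Qed.

Lemma not_four_squares_79 (a b c d : nat) : (a * a + (b * b + (c * c + d * d)) = 79)%N ->
  ~~ all (fun x => (x == 0%N) || ~~ (5 %| x)%N) [:: a; b; c; d].
Proof.
move=> E; have lt9 x y : (x * x + y = 79)%N -> (x < 9)%N.
  by move=> Exy; rewrite ltnNge; apply/negP=> /(fun h => leq_mul h h) h;
    have := leq_trans h (leq_addr y _); rewrite Exy.
have T : all (fun a => all (fun b => all (fun c => all (fun d =>
  (a * a + (b * b + (c * c + d * d)) == 79)%N ==> ~~ all (fun x => (x == 0%N) || ~~ (5 %| x)%N) [:: a; b; c; d])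
  (iota 0 9)) (iota 0 9)) (iota 0 9)) (iota 0 9) by vm_compute.
have mem x y : (x * x + y = 79)%N -> x \in iota 0 9 by move=> /lt9; rewrite mem_iota.
have /(allP T)/allP/(_ b)/(_ _)/allP/(_ c)/(_ _)/allP/(_ d)/(_ _) := mem _ _ E.
rewrite E eqxx; apply.
- by apply: (mem b (a * a + (c * c + d * d))%N); rewrite addnCA.
- apply: (mem c (a * a + (b * b + d * d))%N); rewrite -E; lia.
- apply: (mem d (a * a + (b * b + c * c))%N); rewrite -E; lia.
Qed.

Theorem theorem4p4 :
  (forall (p : nat) (n : int), prime p -> (5 <= p)%N -> 0 < n ->
     (exists k : nat, (0 < k <= 4)%N /\ sum_of_squares_not_div p k n)
     <-> ~ (p = 5%N /\ n = 79))
  /\ sum_of_squares_not_div 5 5 79.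
Proof.
split; last by have := @sum_of_squares_of_seq 5 [:: 1; 1; 2; 3; 8]%N isT isT;
  rewrite unlock.
move=> p [n|//] pp p5 n_gt0; split.
  move=> [k [/andP[_ k4] [x [Ex /(gcdz_prod_eq1 _ pp) cx]]]] [p_eq n_eq].
  move: pp p5 cx; rewrite {}p_eq => _ _ cx; move: Ex; rewrite n_eq => /(etrans (esym (natz 79))) Ex.
  (* The k <= 4 absolute values are extended by zeros to four coordinates. *)
  pose y i : nat := if insub i is Some j then `|x j|%N else 0%N.
  have yE (j : 'I_k) : y j = `|x j|%N by rewrite /y valK.
  have y0 i : (k <= i)%N -> y i = 0%N by move=> ki; rewrite /y insubN // -leqNgt.
  have E : (\sum_(i < 4) y i * y i = 79)%N.
    rewrite [LHS](_ : _ = \sum_(i < 4 | (i < k)%N) y i * y i)%N; last first.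
      rewrite [RHS]big_mkcond; apply: eq_bigr => i _.
      by case: (ltnP i k) => // /y0 ->.
    rewrite -(big_ord_widen 4 (fun i => y i * y i)%N k4).
    apply/eqP; rewrite -eqz_nat Ex (big_morph Posz PoszD erefl); apply/eqP/eq_bigr => j _.
    by rewrite yE PoszM -expr2 abszE real_normK ?num_real.
  have Y i : (y i == 0%N) || ~~ (5 %| y i)%N.
    have [ik|/y0 ->//] := ltnP i k.
    by rewrite (yE (Ordinal ik)) cx orbT.
  move: E; rewrite !big_ord_recl big_ord0 addn0 => /not_four_squares_79.
  by rewrite /= !Y.
move=> N.
have [|||a [b [c [d [En A]]]]] := @good_nat p n (prime_Z pp); try exact/ssrnat.leP.
  by move=> [p_eq n_eq]; apply: N; rewrite p_eq n_eq.
have {}A x : x \in [:: a; b; c; d] -> (x == 0%N) || ~~ (p %| x)%N.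
  move=> xs; have /A [->//|Npx] : List.In x [:: a; b; c; d].
    by move: xs; rewrite !inE => /or4P[] /eqP->; rewrite /=; tauto.
  by apply/orP; right; apply/negP=> /dvdnP[q Eq]; apply: Npx; exists q.
(* Dropping the zeros leaves at most four numbers, and at least one since n > 0. *)
set s := [seq x <- [:: a; b; c; d] | x != 0%N].
have En' : n = (\sum_(x <- s) x * x)%N.
  rewrite En big_filter big_mkcond /= (eq_bigr (fun x => x * x)%N); last by move=> [].
  by rewrite !big_cons big_nil addn0.
exists (size s); split.
  apply/andP; split; last by rewrite size_filter (leq_trans (count_size _ _)).
  by move: n_gt0; rewrite En'; case: (s) => //; rewrite big_nil.
rewrite En'; apply: sum_of_squares_of_seq => //.
by apply/allP=> x; rewrite mem_filter => /andP[/negPf x0 /A]; rewrite x0.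
Qed.
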